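(* Let $M>N$ be integers, let $T$ be the upper-left $N\times N$ block of a Haar-distributed matrix in $U(M)$, let $k\in\mathbb{N}$ and $|z|<1$. Then $$\mathbb{E}\big(|\det(T-z)|^{2k}\big)=\frac{C_{M,N,k}}{(1-|z|^2)^{k(M-N)+k^2}}\,\mathbb{P}\big(\lambda^{(\mathrm{JUE}_{k,M-N,N})}_{\max}<1-|z|^2\big),$$ where $$C_{M,N,k}=\mathbb{E}\big(|\det T|^{2k}\big)=\prod_{j=0}^{k-1}\frac{\Gamma(M-N+1+j)\Gamma(N+1+j)}{\Gamma(M+1+j)\Gamma(1+j)}.$$
   Context: For $k\in\mathbb{N}$ and $\alpha,\beta>-1$, $\mathrm{JUE}_{k,\alpha,\beta}$ (Jacobi unitary ensemble) is the random $k$-point configuration on $[0,1]$ with density proportional to $\prod_{j=1}^k t_j^{\alpha}(1-t_j)^{\beta}\prod_{i<j}(t_j-t_i)^2$; $\lambda^{(\mathrm{JUE}_{k,\alpha,\beta})}_{\max}$ is its largest point. *)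

(* Defs.v *)
From HB Require Import structures.
From mathcomp Require Import all_boot all_order all_algebra.
From mathcomp Require Import complex.
From mathcomp Require Import all_classical all_reals all_analysis.
Set Implicit Arguments. Unset Strict Implicit. Unset Printing Implicit Defensive.
Import Order.TTheory GRing.Theory Num.Theory.
Local Open Scope ring_scope.
Local Open Scope classical_set_scope.

Section Defs.
Variable R : realType.

Definition cmod (z : R[i]) : R := Num.sqrt (complex.Re z ^+ 2 + complex.Im z ^+ 2).

Definition adjmx n (X : 'M[R[i]]_n) : 'M[R[i]]_n := (map_mx Num.conj X)^T.

Definition unitary n (X : 'M[R[i]]_n) : Prop := X *m adjmx X = 1%:M.

Definition cmx n := 'M[R[i]]_n.
HB.instance Definition _ n := Choice.on (cmx n).
HB.instance Definition _ n := isPointed.Build (cmx n) 0.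

Definition mx_coords n (X : cmx n) : (n * n).-tuple (R * R)%type :=
  [tuple (complex.Re (mxvec X ord0 i), complex.Im (mxvec X ord0 i)) | i < n * n].

(* the n x n complex matrices with the Borel sigma-algebra
   (= the sigma-algebra generated by real and imaginary parts of the entries) *)
Definition cmatrix n := g_sigma_algebra_preimageType (@mx_coords n).

Definition haar_unitary n (P : probability (cmatrix n) R) : Prop :=
  P [set X : cmatrix n | unitary X] = 1%E /\
  forall V : 'M[R[i]]_n, unitary V ->
    forall A : set (cmatrix n), measurable A ->
      P [set X : cmatrix n | A (V *m X)] = P A.

Fixpoint iter_int01 (k : nat) (F : seq R -> R) : R :=
  match k with
  | 0 => F [::]
  | k'.+1 => Rintegral lebesgue_measure `[0, 1]%classic
               (fun x => iter_int01 k' (fun s => F (x :: s)))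
  end.

Definition jue_weight (a b : nat) (t : seq R) : R :=
  (\prod_(x <- t) (x ^+ a * (1 - x) ^+ b)) *
  \prod_(i < size t) \prod_(j < size t | (i < j)%N) (t`_j - t`_i) ^+ 2.

Definition jue_lmax_cdf (k a b : nat) (s : R) : R :=
  iter_int01 k (fun t => (if all (fun x => x < s) t then 1 else 0) * jue_weight a b t)
  / iter_int01 k (jue_weight a b).

End Defs.

(* Main.v *)
(* On polynomials in the entries of U consider the Hermitian form <f, g> = E[f g^*];
   writing chi for the characteristic polynomial of T, the moment is
   <chi(z)^k, chi(z)^k>.  Invariance of the Haar measure under the rotations
   1 + (u - 1) Q, with Q an orthogonal projection and |u| = 1, gives to first order at
   u = 1 that the derivation d_ab induced by U |-> E_ab U is adjoint to d_ba.
   Contracting with U^* U = 1, the generator of T |-> T + t becomes adjoint, up to a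
   multiplier, to the generator of T |-> T + t T^2.

   By Taylor expansion and Cauchy-Binet, chi(z)^k is a combination of the minors S_m
   of the coefficient matrix of the polynomials X^j chi.  Each S_m is an eigenvector of
   the Casimir operator of gl_N, with an eigenvalue determined by the sums of the m_i and
   of the m_i^2; together with the ladder relations coming from the other two generators
   this makes the S_m orthogonal and computes their norms.  The moment is thus a
   k x k determinant, which unitriangular changes of basis turn into the Hankel
   determinant of the integrals of t^(L + i + j) (1 - s t)^N over [0, 1], s = 1 - |z|^2.
   By Andreief's identity this is also the integral of the Jacobi density over [0, s]^k,
   up to k! and a power of s.  Taking z = 0 gives the constant. *)
Require Import Defs.
From HB Require Import structures.
From mathcomp Require Import all_boot all_order all_fingroup all_algebra.
From mathcomp Require Import mpoly.
From mathcomp Require Import ring lra zify.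
Set Implicit Arguments.
Unset Strict Implicit.
Import Order.TTheory GRing.Theory Num.Theory.
Local Open Scope ring_scope.

(** * Derivations and characteristic polynomials *)

(** The sums of the [m i] and of their squares do not determine the values of [m]: [{0, 4, 5}] and
    [{1, 2, 6}] share both. The Casimir operator alone therefore does not separate the minors. It is
    sharp enough, however, to isolate one term among the lowered minors in a ladder relation, and
    repeated raising ends at minors that are constants, where the form is known. The ladder relation
    closes on minors only if one row carries the top value [N + K - 1]: that row makes [tr T * S m]
    a sum of lowered minors. Minors of size [k] are therefore bordered by such a row, which does not
    change them. [T] has a density only when [M >= 2 N], so the argument stays on the unitary group.
    The expectation enters through [H 1 1 = 1], the adjointness of [d_ab] and [d_ba], and the
    relation [U^* U = 1]; the rest is algebra with derivations of the polynomial ring in the entries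
    of [U]. The integrals over [[0, 1]] are likewise linear functionals on polynomials until the
    Jacobi density is reached. *)

Definition derivation (A : comNzRingType) (d : A -> A) : Prop :=
  (forall x y, d (x + y) = d x + d y) /\
  (forall x y, d (x * y) = d x * y + x * d y).

Section Derivation.
Variables (A : comNzRingType) (d : A -> A).
Hypothesis dP : derivation d.

Let dD := dP.1.
Let dM := dP.2.

Lemma derivation0 : d 0 = 0.
Proof. by apply: (addrI (d 0)); rewrite -dD !addr0. Qed.

Lemma derivation1 : d 1 = 0.
Proof. by apply: (addrI (d 1)); rewrite addr0 -{3}[1]mulr1 dM mulr1 mul1r. Qed.

Lemma derivationN x : d (- x) = - d x.
Proof. by apply: (addrI (d x)); rewrite -dD !subrr derivation0. Qed.

Lemma derivationB x y : d (x - y) = d x - d y.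
Proof. by rewrite dD derivationN. Qed.

Lemma derivationMn x n : d (x *+ n) = d x *+ n.
Proof. by elim: n => [|n IH]; rewrite ?mulr0n ?derivation0 // !mulrS dD IH. Qed.

Lemma derivation_sum I (r : seq I) (P : pred I) (F : I -> A) :
  d (\sum_(i <- r | P i) F i) = \sum_(i <- r | P i) d (F i).
Proof. exact: (big_morph d dD derivation0). Qed.

Lemma derivation_sign (b : bool) x : d ((-1) ^+ b * x) = (-1) ^+ b * d x.
Proof. by case: b; rewrite ?expr1 ?expr0 ?mulN1r ?mul1r ?derivationN. Qed.

Lemma derivation_prod (I : finType) (P : pred I) (F : I -> A) :
  d (\prod_(i | P i) F i) =
  \sum_(i | P i) d (F i) * \prod_(j | P j && (j != i)) F j.
Proof.
suff H : forall r : seq I, uniq r -> d (\prod_(i <- r | P i) F i) =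
  \sum_(i <- r | P i) d (F i) * \prod_(j <- r | P j && (j != i)) F j.
  by apply: H; rewrite index_enum_uniq.
elim=> [|a r IH]; first by rewrite !big_nil derivation1.
move=> /= /andP[ar ur]; rewrite !big_cons.
case Pa : (P a); last first.
  rewrite IH //; apply: eq_bigr => i Pi; rewrite big_cons Pa //.
rewrite dM IH // eqxx andbF; congr (_ * _ + _).
  rewrite [LHS]big_seq_cond [RHS]big_seq_cond; apply: eq_bigl => j.
  by case: (j \in r) / idP => //= jr; rewrite (contraNneq _ ar) ?andbT // => <-.
rewrite mulr_sumr [LHS]big_seq_cond [RHS]big_seq_cond; apply: eq_bigr => i /andP[ir Pi].
rewrite big_cons Pa /= (contraNneq _ ar); last by move=> ->.
by rewrite mulrCA.
Qed.

Lemma derivation_det_row n (X : 'M[A]_n) :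
  d (\det X) = \sum_i \det (\matrix_(a, b) (if a == i then d (X a b) else X a b)).
Proof.
rewrite /determinant derivation_sum exchange_big /=; apply: eq_bigr => s _.
rewrite derivation_sign derivation_prod mulr_sumr; apply: eq_bigr => i _.
rewrite [in RHS](bigD1 i) //= mxE eqxx; congr (_ * (_ * _)).
by apply: eq_bigr => j ji; rewrite mxE (negbTE ji).
Qed.

End Derivation.

Section DetReplace.
Variables (A : comNzRingType) (n : nat).
Implicit Types X Y Q : 'M[A]_n.

Definition row_repl X Y (i : 'I_n) : 'M[A]_n :=
  \matrix_(a, b) (if a == i then Y a b else X a b).

(** Laplace expansion along each replaced row. Derivatives of minors become traces in this way, and
    any part of [Y] of the form [X *m Q] contributes just [\det X * \tr Q]. *)
Lemma sum_det_row_repl X Y : \sum_i \det (row_repl X Y i) = \tr (\adj X *m Y).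
Proof.
rewrite mxtrace_mulC; apply: eq_bigr => i _; rewrite (expand_det_row _ i) mxE.
apply: eq_bigr => j _; rewrite !mxE eqxx; congr (_ * _).
rewrite /cofactor; congr (_ * \det _); apply/matrixP => a b; rewrite !mxE.
by rewrite eq_sym (negbTE (neq_lift _ _)).
Qed.

End DetReplace.

Lemma derivation_det (A : comNzRingType) (d : A -> A) n (X : 'M[A]_n) :
  derivation d -> d (\det X) = \tr (\adj X *m map_mx d X).
Proof.
move=> dP; rewrite -sum_det_row_repl derivation_det_row //; apply: eq_bigr => i _.
by congr (\det _); apply/matrixP => a b; rewrite !mxE.
Qed.

Lemma derivation_map_poly (A : comNzRingType) (d : A -> A) :
  derivation d -> derivation (map_poly d).
Proof.
move=> dP; have d0 := derivation0 dP; split=> x y; apply/polyP => i.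
  by rewrite coefD !coef_map_id0 // coefD dP.1.
rewrite coefD !coef_map_id0 // !coefM (derivation_sum dP) -big_split /=.
by apply: eq_bigr => j _; rewrite dP.2 !coef_map_id0.
Qed.

Lemma derivation_deriv (A : comNzRingType) : derivation (@deriv A).
Proof. by split=> x y; rewrite ?derivD ?derivM. Qed.


Lemma derivation_map_polyC (A : comNzRingType) (d : A -> A) (a : A) :
  derivation d -> map_poly d a%:P = (d a)%:P.
Proof.
move=> dP; apply/polyP => n; rewrite coef_map_id0 ?(derivation0 dP) // !coefC.
by case: eqP => _ //; rewrite (derivation0 dP).
Qed.

Lemma derivation_map_polyX (A : comNzRingType) (d : A -> A) :
  derivation d -> map_poly d 'X = 0.
Proof.
move=> dP; apply/polyP => n; rewrite coef_map_id0 ?(derivation0 dP) // coefX coef0.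
by case: eqP => _; rewrite ?(derivation0 dP) ?(derivation1 dP).
Qed.

Section CharPolyAdjugate.
Variables (A : comNzRingType) (N : nat) (T : 'M[A]_N).

Local Notation chi := (char_poly T).
Local Notation TP := (map_mx polyC T).

Definition char_adj : 'M[{poly A}]_N := \adj (char_poly_mx T).
(* This is [T *m char_adj], see [mul_char_adj]. *)
Definition char_nn : 'M[{poly A}]_N := 'X *: char_adj - chi%:M.

Local Notation B := char_adj.
Local Notation NN := char_nn.

Lemma mul_char_adj : TP *m B = NN.
Proof.
have := mul_mx_adj (char_poly_mx T).
rewrite -/B /char_poly_mx mulmxBl mul_scalar_mx -/(char_poly T) /char_nn => <-.
by rewrite opprB addrC subrK.
Qed.

Lemma char_adj_mul : B *m TP = NN.
Proof.
have := mul_adj_mx (char_poly_mx T).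
rewrite -/B /char_poly_mx mulmxBr mul_mx_scalar -/(char_poly T) /char_nn => <-.
by rewrite opprB addrC subrK.
Qed.

(** Jacobi's formula for the derivative in [X] of [det (X - T)]. *)
Lemma tr_char_adj : \tr B = chi^`().
Proof.
rewrite /char_poly (derivation_det _ (@derivation_deriv A)) -[in LHS](mulmx1 B).
congr (\tr (_ *m _)); apply/matrixP => i j.
by rewrite !mxE derivB derivC subr0 derivMn derivX.
Qed.

Lemma tr_char_nn : \tr NN = 'X * chi^`() - chi *+ N.
Proof. by rewrite /char_nn raddfB /= mxtraceZ tr_char_adj mxtrace_scalar. Qed.

Lemma derivation_char_poly (d : A -> A) : derivation d ->
  map_poly d chi = - \tr (B *m map_mx polyC (map_mx d T)).
Proof.
move=> dP; rewrite /char_poly (derivation_det _ (derivation_map_poly dP)).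
rewrite -raddfN -mulmxN /=; congr (\tr (_ *m _)); apply/matrixP => i j.
rewrite !mxE (derivationB (derivation_map_poly dP)) (derivationMn (derivation_map_poly dP)).
by rewrite derivation_map_polyC // derivation_map_polyX // mul0rn sub0r.
Qed.

(** The fields [1], [T] and [T^2] generate the Moebius action of [sl_2] on the eigenvalues. On [chi]
    they act as first-order operators in [X]; only the quadratic one brings in a multiplier,
    [tr T]. *)
Lemma derivation_char_poly_id (d : A -> A) : derivation d ->
  map_mx d T = 1%:M -> map_poly d chi = - chi^`().
Proof.
move=> dP dT; rewrite derivation_char_poly // dT map_mx1 mulmx1 tr_char_adj //.
Qed.

Lemma derivation_char_poly_mul (d : A -> A) : derivation d ->
  map_mx d T = T -> map_poly d chi = chi *+ N - 'X * chi^`().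
Proof.
move=> dP dT; rewrite derivation_char_poly // dT char_adj_mul tr_char_nn opprB //.
Qed.

Lemma derivation_char_poly_sqr (d : A -> A) : derivation d ->
  map_mx d T = T *m T ->
  map_poly d chi = (\tr T)%:P * chi + ('X * chi) *+ N - 'X^2 * chi^`().
Proof.
move=> dP dT; rewrite derivation_char_poly // dT map_mxM mulmxA char_adj_mul.
rewrite /char_nn mulmxBl -scalemxAl char_adj_mul mul_scalar_mx raddfB /= !mxtraceZ.
rewrite tr_char_nn -(trace_map_mx polyC) mulrBr mulrnAr expr2; ring.
Qed.

(* Differentiating (X - T) B = chi and multiplying by B gives tr (B^2). *)
Lemma tr_char_adj2 : \tr (B *m B) = chi^`() ^+ 2 - chi * chi^`()^`().
Proof.
have dP := @derivation_deriv A.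
have E : chi *: map_mx deriv B = chi^`() *: B - B *m B.
  have := congr1 (map_mx deriv) (mul_mx_adj (char_poly_mx T)).
  rewrite -/B -/(char_poly T).
  have -> : map_mx deriv (char_poly_mx T *m B) =
            B + char_poly_mx T *m map_mx deriv B.
    apply/matrixP => i j; rewrite !mxE (derivation_sum dP).
    transitivity (\sum_k ((char_poly_mx T i k)^`() * B k j + char_poly_mx T i k * (B k j)^`())).
      by apply: eq_bigr => k _; rewrite derivM.
    rewrite big_split /=; congr (_ + _).
      rewrite (bigD1 i) //= big1 ?addr0 => [|k ki].
        by rewrite !mxE eqxx derivB derivC subr0 derivX mul1r.
      by rewrite !mxE eq_sym (negbTE ki) derivB derivC subr0 deriv0 mul0r.
    by apply: eq_bigr => k _; rewrite !mxE.
  move/(congr1 (mulmx B)); rewrite mulmxDr mulmxA mul_adj_mx -/(char_poly T) mul_scalar_mx.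
  have -> : map_mx deriv chi%:M = chi^`()%:M :> 'M_N.
    by apply/matrixP => i j; rewrite !mxE derivMn.
  by rewrite mul_mx_scalar => <-; rewrite addrC addKr.
have := congr1 mxtrace E; rewrite raddfB /= !mxtraceZ tr_char_adj.
have -> : \tr (map_mx deriv B) = chi^`()^`().
  by rewrite -tr_char_adj /mxtrace (derivation_sum dP); apply: eq_bigr => i _; rewrite mxE.
by move=> ->; ring.
Qed.

End CharPolyAdjugate.

Section Casimir.
Variables (A : comNzRingType) (N : nat) (T : 'M[A]_N) (d : 'I_N -> 'I_N -> A -> A).
Hypothesis dP : forall a b, derivation (d a b).
Hypothesis dT : forall a b, map_mx (d a b) T = delta_mx a b *m T.

Local Notation chi := (char_poly T).
Local Notation B := (char_adj T).
Local Notation NN := (char_nn T).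

Definition casimir (f : A) : A := \sum_a \sum_b d a b (d b a f).
(** The [carre du champ] of [casimir]: half of what [casimir (f g)] contains beyond
    [casimir f * g + f * casimir g]. *)
Definition carre (f g : A) : A := \sum_a \sum_b d a b f * d b a g.

Lemma mul_delta_mul n (R : pzRingType) (X Y : 'M[R]_n) i j k l :
  (X *m delta_mx i j *m Y) k l = X k i * Y j l.
Proof.
rewrite mxE (bigD1 j) //= big1 ?addr0 => [|m mj].
  rewrite mxE (bigD1 i) //= big1 ?addr0 ?mxE ?eqxx ?mulr1 // => m mi.
  by rewrite mxE (negbTE mi) mulr0.
by rewrite mxE big1 ?mul0r // => p _; rewrite mxE (negbTE mj) andbF mulr0.
Qed.

Lemma tr_mul_delta n (R : pzRingType) (X : 'M[R]_n) i j :
  \tr (X *m delta_mx i j) = X j i.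
Proof.
rewrite /mxtrace (bigD1 j) //= big1 ?addr0 => [|k kj].
  rewrite mxE (bigD1 i) //= big1 ?addr0 ?mxE ?eqxx ?mulr1 // => k ki.
  by rewrite mxE (negbTE ki) mulr0.
by rewrite mxE big1 // => l _; rewrite mxE (negbTE kj) andbF mulr0.
Qed.

Lemma dchi a b : map_poly (d a b) chi = - NN b a.
Proof.
rewrite derivation_char_poly // dT map_mxM map_delta_mx mxtrace_mulC -mulmxA.
by rewrite mul_char_adj mxtrace_mulC tr_mul_delta.
Qed.

(** Obtained by differentiating [(X - T) B = chi] and multiplying by [B]. The factor [chi] stays on
    the left, so that no inverse of [X - T] is needed. *)
Lemma dchar_adj a b :
  chi *: map_mx (map_poly (d a b)) B = B *m delta_mx a b *m NN - NN b a *: B.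
Proof.
have dPP := derivation_map_poly (dP a b).
have := congr1 (map_mx (map_poly (d a b))) (mul_mx_adj (char_poly_mx T)).
rewrite -/B -/(char_poly T).
have -> : map_mx (map_poly (d a b)) (char_poly_mx T *m B) =
   - (delta_mx a b *m NN) + char_poly_mx T *m map_mx (map_poly (d a b)) B.
  have E : map_mx (map_poly (d a b)) (char_poly_mx T) =
           - (delta_mx a b *m map_mx polyC T).
    rewrite -(map_delta_mx polyC) -map_mxM -dT.
    apply/matrixP => i j; rewrite !mxE (derivationB dPP) (derivationMn dPP).
    by rewrite derivation_map_polyC // derivation_map_polyX // mul0rn sub0r.
  rewrite -mul_char_adj mulmxA -mulNmx -E.
  apply/matrixP => i j; rewrite !mxE (derivation_sum dPP) -big_split /=.
  by apply: eq_bigr => k _; rewrite dPP.2 !mxE.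
move/(congr1 (mulmx B)); rewrite mulmxDr mulmxA mul_adj_mx -/(char_poly T) mul_scalar_mx.
have -> : map_mx (map_poly (d a b)) chi%:M = (- NN b a)%:M :> 'M_N.
  by apply/matrixP => i j; rewrite [LHS]mxE [_ i j]mxE [RHS]mxE (derivationMn dPP) dchi.
rewrite mul_mx_scalar mulmxN mulmxA => E.
apply: (addrI (- (B *m delta_mx a b *m NN))); rewrite E addrA addNr add0r scaleNr //.
Qed.

Lemma casimir_char_poly :
  \sum_a \sum_b map_poly (d a b) (map_poly (d b a) chi) =
  chi *+ N + ('X * chi^`()) *+ N - ('X * chi^`()) *+ 2 - 'X^2 * chi^`()^`().
Proof.
have S1 : \sum_a map_poly (d a a) chi = chi *+ N - 'X * chi^`().
  by rewrite (eq_bigr (fun a => - NN a a)) ?sumrN -/(\tr NN) ?tr_char_nn ?opprB // => a _; exact: dchi.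
have S2 : \sum_a \sum_b map_poly (d a b) (B a b) =
          'X * chi^`()^`() + chi^`() - chi^`() *+ N.
  (* [chi] is monic, hence not a zero divisor: the identity may be multiplied by it to make
     [dchar_adj] applicable. *)
  apply: (monic_lreg (char_poly_monic T)) => /=.
  rewrite mulr_sumr.
  transitivity (\sum_a \sum_b (B a a * NN b b - NN b a * B a b)).
    apply: eq_bigr => a _; rewrite mulr_sumr; apply: eq_bigr => b _.
    have := congr1 (fun X : 'M_N => X a b) (dchar_adj a b).
    rewrite [LHS]mxE [_ a b in LHS]mxE [RHS]mxE mul_delta_mul => ->.
    by congr (_ + _); rewrite [LHS]mxE [in LHS]mxE.
  transitivity (\tr B * \tr NN - \tr (B *m NN)).
    under eq_bigr do rewrite sumrB.
    rewrite sumrB /mxtrace mulr_suml; congr (_ - _); apply: eq_bigr => a _.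
      by rewrite mulr_sumr.
    by rewrite mxE; apply: eq_bigr => b _; rewrite mulrC.
  rewrite tr_char_nn tr_char_adj /char_nn mulmxBr -scalemxAr mul_mx_scalar.
  rewrite raddfB /= !mxtraceZ tr_char_adj2 tr_char_adj; ring.
(* Since [NN = X B - chi], each [d_ab (d_ba chi) = - d_ab (NN_ab)] splits into [d_ab chi], present
   for [a = b] only, and [- X d_ab (B_ab)]. *)
transitivity (\sum_a map_poly (d a a) chi
   - 'X * \sum_a \sum_b map_poly (d a b) (B a b)); last by rewrite S1 S2; ring.
rewrite mulr_sumr -sumrB; apply: eq_bigr => a _.
rewrite mulr_sumr [X in X - _](_ : _ = \sum_b (if b == a then map_poly (d a b) chi else 0)); last first.
  by rewrite -big_mkcond big_pred1_eq.
rewrite -sumrB; apply: eq_bigr => b _; have dPP := derivation_map_poly (dP a b).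
rewrite dchi (derivationN dPP) !mxE (derivationB dPP) dPP.2 derivation_map_polyX // mul0r add0r opprB.
rewrite (derivationMn dPP) [a == b]eq_sym; case: eqP => _; first by rewrite mulr1n.
by rewrite mulr0n.
Qed.

End Casimir.

(** * Minors of the shifts of a characteristic polynomial *)

Lemma coef_XnM_Xderiv (A : comNzRingType) (q : {poly A}) j p :
  ('X^j * ('X * q^`()))`_p = (p%:R - j%:R) * ('X^j * q)`_p.
Proof.
rewrite !coefXnM; case: ltnP => [pj|jp]; first by rewrite mulr0.
rewrite -natrB // coefXM; case: eqP => [->|/eqP]; first by rewrite mul0r.
by rewrite -lt0n => h; rewrite coef_deriv prednK // mulr_natl.
Qed.

Lemma derivation_XnM_coef (A : comNzRingType) (d : A -> A) (q : {poly A}) j p :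
  derivation d -> d ('X^j * q)`_p = ('X^j * map_poly d q)`_p.
Proof.
move=> dP; rewrite !coefXnM; case: ltnP => _; first exact: derivation0.
by rewrite coef_map_id0 ?derivation0.
Qed.

Definition upd K (m : 'I_K -> nat) (i : 'I_K) (p : nat) : 'I_K -> nat :=
  fun a => if a == i then p else m a.

Section ShiftedMinors.
Variables (A : comNzRingType) (N : nat) (T : 'M[A]_N) (K : nat).

Local Notation chi := (char_poly T).
Implicit Type m : 'I_K -> nat.

Definition char_row (j : nat) : {poly A} := 'X^j * chi.
Definition shift_mx m : 'M[A]_K := \matrix_(i, j) (char_row j)`_(m i).
(** For increasing [m] with values below [N + K] this is, up to sign, a Schur function of the
    eigenvalues of [T]: the entries are signed elementary symmetric functions [e_(N - m i + j)], as
    in the dual Jacobi-Trudi formula. *)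
Definition shift_minor m : A := \det (shift_mx m).
(* The minor with [m i] lowered by one, with value 0 instead of the truncated
   predecessor when [m i = 0]. *)
Definition shift_minor_dn m i : A :=
  \det (row_repl (shift_mx m) (\matrix_(i, j) (char_row j.+1)`_(m i)) i).

Local Notation X := shift_mx.
Local Notation S := shift_minor.

Lemma eq_shift_minor m m' : m =1 m' -> S m = S m'.
Proof. by move=> e; congr (\det _); apply/matrixP => i j; rewrite !mxE e. Qed.

Lemma shift_minor_upd m i p :
  S (upd m i p) = \det (row_repl (X m) (\matrix_(i, j) (char_row j)`_p) i).
Proof.
by congr (\det _); apply/matrixP => a b; rewrite !mxE /upd; case: eqP.
Qed.

Lemma char_rowS j p : (char_row j.+1)`_p.+1 = (char_row j)`_p.
Proof. by rewrite /char_row exprS -mulrA coefXM. Qed.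

Lemma char_rowS0 j : (char_row j.+1)`_0 = 0.
Proof. by rewrite /char_row exprS -mulrA coefXM. Qed.

Lemma shift_minor_dnS m i : (0 < m i)%N ->
  shift_minor_dn m i = S (upd m i (m i).-1).
Proof.
move=> h; rewrite shift_minor_upd; congr (\det _); apply/matrixP => a b; rewrite !mxE.
by case: eqP => // ->; rewrite -{1}(prednK h) char_rowS.
Qed.

Lemma shift_minor_dn0 m i : m i = 0%N -> shift_minor_dn m i = 0.
Proof.
move=> h; rewrite /shift_minor_dn (expand_det_row _ i) big1 // => j _.
by rewrite !mxE eqxx h char_rowS0 mul0r.
Qed.

Lemma det_row_repl_scale (Y Z : 'M[A]_K) (c : 'I_K -> A) i :
  \det (row_repl Y (\matrix_(a, b) (c a * Z a b)) i) = c i * \det (row_repl Y Z i).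
Proof.
rewrite !(expand_det_row _ i) mulr_sumr; apply: eq_bigr => j _.
rewrite !mxE eqxx -mulrA; congr (_ * (_ * _)).
rewrite /cofactor; congr (_ * \det _); apply/matrixP => a b; rewrite !mxE.
by rewrite eq_sym (negbTE (neq_lift _ _)).
Qed.

Lemma derivation_minor (d : A -> A) m : derivation d ->
  d (S m) = \tr (\adj (X m) *m \matrix_(i, j) ('X^j * map_poly d chi)`_(m i)).
Proof.
move=> dP; rewrite /S (derivation_det _ dP); congr (\tr (_ *m _)).
by apply/matrixP => i j; rewrite !mxE derivation_XnM_coef.
Qed.

Lemma tr_adj_scale m (Z : 'M[A]_K) (c : 'I_K -> A) :
  \tr (\adj (X m) *m \matrix_(a, b) (c a * Z a b)) =
  \sum_i c i * \det (row_repl (X m) Z i).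
Proof. by rewrite -sum_det_row_repl; apply: eq_bigr => i _; rewrite det_row_repl_scale. Qed.

Lemma derivation_minor_id (d : A -> A) m : derivation d -> map_mx d T = 1%:M ->
  d (S m) = - \sum_i (m i).+1%:R * S (upd m i (m i).+1).
Proof.
move=> dP dT; rewrite (derivation_minor _ dP) // derivation_char_poly_id //.
(* In [X^j chi' = (X^j chi)' - j X^(j-1) chi] the last term is [j] times the previous column. It is
   collected in the strictly triangular [Q], which has trace zero and so leaves no trace in the
   result. *)
pose Q : 'M[A]_K := \matrix_(j', j) (if (j == j'.+1 :> nat) then j%:R else 0).
have -> : \matrix_(i, j) ('X^j * - chi^`())`_(m i) =
   X m *m Q - \matrix_(i, j) ((m i).+1%:R * (\matrix_(i, j) (char_row j)`_(m i).+1) i j).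
  apply/matrixP => i j; rewrite !mxE mulrN coefN.
  have -> : ('X^j * chi^`())`_(m i) = ('X^j * ('X * chi^`()))`_(m i).+1.
    by rewrite mulrCA coefXM.
  rewrite coef_XnM_Xderiv -/(char_row j) mulrBl opprB; congr (_ - _).
  case: j => [[|j] hj] /=.
    rewrite mul0r big1 // => j' _; rewrite !mxE /= mulr0 //.
  rewrite (bigD1 (Ordinal (ltnW hj))) //= big1 ?addr0 => [|j' ne].
    by rewrite !mxE /= eqxx char_rowS mulrC.
  rewrite !mxE /= eqSS [X in if X then _ else _](_ : _ = false) ?mulr0 //.
  by apply/negbTE; apply: contraNneq ne => e; apply/eqP/val_inj.
rewrite mulmxBr raddfB /= tr_adj_scale mulmxA mul_adj_mx mul_scalar_mx mxtraceZ.
have -> : \tr Q = 0.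
  rewrite /mxtrace big1 // => i _; rewrite mxE.
  by rewrite [X in if X then _ else _](_ : _ = false) // ltn_eqF.
rewrite mulr0 sub0r; congr (- _); apply: eq_bigr => i _; congr (_ * _).
by rewrite shift_minor_upd; congr (\det _); apply/matrixP => a b; rewrite !mxE; case: eqP => // ->.
Qed.

(** Euler's identity: [S m] is homogeneous in the entries of [T], and the scalar is its degree. The
    columns contribute [N + j] each, the rows take away [m i]. *)
Lemma derivation_minor_mul (d : A -> A) m : derivation d -> map_mx d T = T ->
  d (S m) = ((N * K + \sum_(j < K) j)%:R - (\sum_i m i)%:R) * S m.
Proof.
move=> dP dT; rewrite (derivation_minor _ dP) // derivation_char_poly_mul //.
have -> : \matrix_(i, j) ('X^j * (chi *+ N - 'X * chi^`()))`_(m i) =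
   X m *m diag_mx (\row_j (N + j)%:R) - \matrix_(i, j) ((m i)%:R * X m i j).
  rewrite mul_mx_diag; apply/matrixP => i j.
  rewrite !mxE mulrBr coefB coef_XnM_Xderiv -/(char_row j).
  rewrite [_ * (chi *+ _)]mulrnAr coefMn -/(char_row j) natrD; ring.
rewrite mulmxBr raddfB /= tr_adj_scale mulmxA mul_adj_mx mul_scalar_mx mxtraceZ.
rewrite mxtrace_diag mulrBl [_ * \det _]mulrC; congr (_ * _ - _).
  rewrite (eq_bigr (fun j : 'I_K => (N + j)%:R)) => [|j _]; last by rewrite mxE.
  by rewrite -natr_sum big_split /= sum_nat_const card_ord mulnC.
rewrite natr_sum mulr_suml; apply: eq_bigr => i _; congr (_ * \det _).
by apply/matrixP => a b; rewrite !mxE; case: eqP.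
Qed.

(* Row [i0] vanishes outside its last column, [chi] being monic of degree [N]. *)
Lemma sum_shift_minor_dn m (i0 : 'I_K) : (m i0).+1 = (N + K)%N ->
  \sum_i shift_minor_dn m i = - \tr T * S m.
Proof.
move=> mi0.
have K0 : (0 < K)%N := leq_ltn_trans (leq0n i0) (ltn_ord i0).
have ltK : (K.-1 < K)%N by rewrite prednK.
pose Y : 'M[A]_K := \matrix_(i, j) (char_row j.+1)`_(m i).
pose jl : 'I_K := Ordinal ltK.
transitivity (\tr (\adj (X m) *m Y)); first by rewrite -sum_det_row_repl.
(* The sum is turned from rows to columns: replacing column [j] by the one of [X^(j+1) chi] repeats
   column [j + 1], so that only the last column [jl] survives. *)
rewrite -mxtrace_tr trmx_mul mxtrace_mulC trmx_adj -sum_det_row_repl (bigD1 jl) //=.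
have top (j : nat) : (j < K.-1)%N -> (char_row j)`_(m i0) = 0.
  move=> jK; rewrite coefXnM; case: ltnP => // h.
  by rewrite nth_default // size_char_poly; lia.
rewrite big1 ?addr0 => [|j jjl].
  have cof : cofactor (row_repl (X m)^T Y^T jl) jl i0 = cofactor (X m)^T jl i0.
    rewrite /cofactor; congr (_ * \det _); apply/matrixP => a b; rewrite !mxE.
    by rewrite eq_sym (negbTE (neq_lift _ _)).
  rewrite /shift_minor -(det_tr (X m)) !(expand_det_col _ i0).
  have jlt (j : 'I_K) : j != jl -> (j < K.-1)%N.
    by move=> h; have := ltn_ord j; have : j != K.-1 :> nat by []; lia.
  rewrite (bigD1 jl) //= [in RHS](bigD1 jl) //= cof.
  rewrite !big1 ?addr0 => [|j jjl|j jjl]; last 2 first.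
  - by rewrite !mxE top ?mul0r ?jlt.
  - by rewrite !mxE (negbTE jjl) top ?mul0r ?jlt.
  rewrite [RHS]mulrA; congr (_ * _); rewrite !mxE eqxx.
  have -> : (char_row jl)`_(m i0) = 1.
    rewrite coefXnM ltnNge [X in ~~ X](_ : _ = true) /=; last by rewrite /=; lia.
    have -> : (m i0 - jl)%N = N by rewrite /=; lia.
    by have /eqP := char_poly_monic T; rewrite lead_coefE size_char_poly.
  rewrite mulr1 /= prednK // coefXnM.
  (* [m i0 < K] forces [N = 0], where the trace is an empty sum. *)
  case: ltnP => h; first by rewrite /mxtrace big1 ?oppr0 // => -[i hi]; exfalso; lia.
  rewrite -char_poly_trace; last by lia.
  by congr (_`_ _); lia.
have jK : (j.+1 < K)%N.
  by have := ltn_ord j; have : j != K.-1 :> nat by []; lia.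
apply: (determinant_alternate (i1 := j) (i2 := Ordinal jK)).
  by apply/eqP => /(congr1 val) /=; lia.
move=> b; rewrite !mxE eqxx [X in if X then _ else _](_ : _ = false) //.
by apply/eqP => /(congr1 val) /=; lia.
Qed.

(** The derivative itself gives [K tr T S m] and the lowered minors with weights [N + K - m i]. With
    the multiplier, [tr T S m] occurs [N + L + K] times; rewriting it by [sum_shift_minor_dn] turns
    the weights into [- (L + m i)]. *)
Lemma derivation_minor_sqr (d : A -> A) (L : nat) m (i0 : 'I_K) :
  derivation d -> map_mx d T = T *m T -> (m i0).+1 = (N + K)%N ->
  (N + L)%:R * \tr T * S m + d (S m) =
  - \sum_i (L + m i)%:R * shift_minor_dn m i.
Proof.
move=> dP dT mi0; rewrite (derivation_minor _ dP) // derivation_char_poly_sqr //.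
pose Y : 'M[A]_K := \matrix_(i, j) (char_row j.+1)`_(m i).
(* The weight [N + j + 1 - m i] is split as [(N + K - m i) - (K - j - 1)]. The part depending on the
   column vanishes at [j = K - 1], the one column whose shift is not again a column, so it can be
   written as a product with a traceless [Q]. *)
pose Q : 'M[A]_K := \matrix_(j', j) (if (j' == j.+1 :> nat) then (K - j.+1)%:R else 0).
have -> : \matrix_(i, j) ('X^j * ((\tr T)%:P * chi + ('X * chi) *+ N
                                  - 'X^2 * chi^`()))`_(m i) =
   \tr T *: X m - X m *m Q + \matrix_(i, j) (((N + K)%:R - (m i)%:R) * Y i j).
  apply/matrixP => i j; rewrite !mxE mulrBr mulrDr coefB coefD.
  have -> : 'X^j * (('X * chi) *+ N) = char_row j.+1 *+ N.
    by rewrite mulrnAr mulrA -exprSr.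
  rewrite mulrCA coefCM -/(char_row j) coefMn.
  have -> : 'X^j * ('X^2 * chi^`()) = 'X^(j.+1) * ('X * chi^`()).
    by rewrite !exprS expr0 mulr1; ring.
  rewrite coef_XnM_Xderiv -/(char_row j.+1).
  have -> : \sum_j0 X m i j0 * Q j0 j = (K - j.+1)%:R * (char_row j.+1)`_(m i).
    have [jK|Kj] := ltnP j.+1 K.
      rewrite (bigD1 (Ordinal jK)) //= big1 ?addr0 => [|j' ne].
        by rewrite !mxE /= eqxx mulrC.
      rewrite !mxE /= [X in if X then _ else _](_ : _ = false) ?mulr0 //.
      by apply/negbTE; apply: contraNneq ne => e; apply/eqP/val_inj.
    rewrite (_ : K - j.+1 = 0)%N ?mul0r; last by lia.
    by rewrite big1 // => j' _; rewrite !mxE; case: eqP => [e|_]; rewrite ?mulr0 //; have := ltn_ord j'; lia.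
  rewrite -mulr_natl (natrB _ (ltn_ord j)) natrD -natr1; ring.
rewrite mulmxDr mulmxBr !raddfD raddfN /= tr_adj_scale -scalemxAr mxtraceZ mulmxA mul_adj_mx.
rewrite mul_scalar_mx mxtraceZ mxtrace_scalar.
have -> : \tr Q = 0.
  by rewrite /mxtrace big1 // => i _; rewrite mxE; case: eqP => // e; lia.
rewrite mulr0 subr0 -/(S m).
have E := sum_shift_minor_dn mi0.
rewrite (_ : \sum_i _ = \sum_i ((N + K)%:R - (m i)%:R) * shift_minor_dn m i); last by rewrite natrD.
transitivity ((N + L + K)%:R * (\tr T * S m) +
              \sum_i ((N + K)%:R - (m i)%:R) * shift_minor_dn m i).
  by rewrite addrA; congr (_ + _); rewrite !natrD; ring.
have -> : \tr T * S m = - \sum_i shift_minor_dn m i by rewrite E mulNr opprK.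
rewrite mulrN mulr_sumr -!sumrN -big_split /=; apply: eq_bigr => i _.
by rewrite !natrD; ring.
Qed.

End ShiftedMinors.

Lemma map_shift_minor (A B : comNzRingType) (phi : {rmorphism A -> B}) N (T : 'M[A]_N)
    K (m : 'I_K -> nat) :
  phi (shift_minor T m) = shift_minor (map_mx phi T) m.
Proof.
rewrite /shift_minor -det_map_mx; congr (\det _); apply/matrixP => i j; rewrite !mxE.
by rewrite -coef_map /= rmorphM /= map_polyXn map_char_poly.
Qed.

(** * The Casimir operator on minors *)

Section CasimirLeibniz.
Variables (A : comNzRingType) (N : nat) (d : 'I_N -> 'I_N -> A -> A).
Hypothesis dP : forall a b, derivation (d a b).

Lemma casimir_sum I (r : seq I) (F : I -> A) :
  casimir d (\sum_(i <- r) F i) = \sum_(i <- r) casimir d (F i).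
Proof.
rewrite /casimir exchange_big /=.
under [RHS]eq_bigr do rewrite exchange_big /=.
rewrite [RHS]exchange_big /=; apply: eq_bigr => b _.
rewrite [RHS]exchange_big /=; apply: eq_bigr => a _.
by rewrite !derivation_sum.
Qed.

Lemma casimir_sign (b : bool) x : casimir d ((-1) ^+ b * x) = (-1) ^+ b * casimir d x.
Proof.
rewrite /casimir mulr_sumr; apply: eq_bigr => i _; rewrite mulr_sumr.
by apply: eq_bigr => j _; rewrite !derivation_sign.
Qed.

Lemma carreC f g : carre d f g = carre d g f.
Proof.
rewrite /carre exchange_big /=; apply: eq_bigr => b _; apply: eq_bigr => a _.
exact: mulrC.
Qed.

Lemma casimir_prod (I : finType) (F : I -> A) :
  casimir d (\prod_i F i) =
  \sum_i casimir d (F i) * \prod_(k | k != i) F k +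
  \sum_i \sum_(j | j != i) carre d (F i) (F j) * \prod_(k | (k != i) && (k != j)) F k.
Proof.
have exch (P : pred I) (f : I -> 'I_N -> 'I_N -> A) :
    \sum_(i | P i) \sum_a \sum_b f i a b = \sum_a \sum_b \sum_(i | P i) f i a b.
  rewrite exchange_big; apply: eq_bigr => a _ /=.
  by rewrite exchange_big.
have suml2 (f : 'I_N -> 'I_N -> A) x :
    (\sum_a \sum_b f a b) * x = \sum_a \sum_b f a b * x.
  by rewrite mulr_suml; apply: eq_bigr => a _; rewrite mulr_suml.
under [X in _ = X + _]eq_bigr do rewrite /casimir suml2.
rewrite exch.
under [X in _ = _ + X]eq_bigr => i _.
  under eq_bigr do rewrite carreC /carre suml2.
  rewrite exch.
  over.
rewrite /= exch -big_split /=; apply: eq_bigr => a _.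
rewrite -big_split /=; apply: eq_bigr => b _.
rewrite -big_split /= (derivation_prod (dP b a)) (derivation_sum (dP a b)); apply: eq_bigr => i _.
rewrite (dP a b).2 (derivation_prod (dP a b)); congr (_ + _).
rewrite mulr_sumr; apply: eq_bigr => j ji.
by rewrite mulrA [d b a _ * _]mulrC.
Qed.

End CasimirLeibniz.

Section CasimirMinor.
Variables (A : comNzRingType) (N : nat) (T : 'M[A]_N) (d : 'I_N -> 'I_N -> A -> A).
Hypothesis dP : forall a b, derivation (d a b).
Hypothesis dT : forall a b, map_mx (d a b) T = delta_mx a b *m T.
Variables (K : nat) (m : 'I_K -> nat).

Local Notation chi := (char_poly T).
Local Notation r := (char_row T).
Local Notation NN := (char_nn T).

(** Up to sign and transposition, the gradient of the coefficient of [X^p] in [X^j chi] along the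
    [d a b]; see [d_char_row]. *)
Definition nn_coef (j p : nat) : 'M[A]_N := map_mx (fun q : {poly A} => q`_p) ('X^j *: NN).

Lemma nn_coefE j p a b : nn_coef j p a b = ('X^j * NN a b)`_p.
Proof. by rewrite [LHS]mxE [('X^j *: NN) a b]mxE. Qed.

Lemma d_char_row a b j p : d a b (r j)`_p = - nn_coef j p b a.
Proof. by rewrite (derivation_XnM_coef _ _ _ (dP a b)) (dchi dP dT) mulrN coefN nn_coefE. Qed.

Definition G (j l p q : nat) : A := \tr (nn_coef j p *m nn_coef l q).

Lemma carre_char_row j l p q : carre d (r j)`_p (r l)`_q = G j l p q.
Proof.
rewrite /G /mxtrace /carre exchange_big; apply: eq_bigr => b _ /=.
rewrite mxE; apply: eq_bigr => a _; by rewrite !d_char_row mulrNN.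
Qed.

Lemma G_sym j l p q : G j l p q = G l j q p.
Proof. by rewrite /G mxtrace_mulC. Qed.

Lemma map_mx_coefM (X : 'M[{poly A}]_N) p :
  T *m map_mx (fun q : {poly A} => q`_p) X =
  map_mx (fun q : {poly A} => q`_p) (map_mx polyC T *m X).
Proof.
apply/matrixP => i j; rewrite !mxE coef_sum; apply: eq_bigr => k _.
by rewrite !mxE coefCM.
Qed.

Lemma map_mx_coefMr (X : 'M[{poly A}]_N) p :
  map_mx (fun q : {poly A} => q`_p) X *m T =
  map_mx (fun q : {poly A} => q`_p) (X *m map_mx polyC T).
Proof.
apply/matrixP => i j; rewrite !mxE coef_sum; apply: eq_bigr => k _.
by rewrite !mxE coefMC.
Qed.

(** From [NN = X B - chi] and [T B = NN] one has [T NN = X NN - chi T]: multiplication by [T] raises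
    [j], up to a multiple of [T]. *)
Lemma nn_coefS j p : nn_coef j.+1 p =
  map_mx (fun q : {poly A} => q`_p) (('X^j * chi) *: map_mx polyC T + 'X^j *: (map_mx polyC T *m NN)).
Proof.
rewrite /nn_coef; congr (map_mx _ _).
have -> : map_mx polyC T *m NN = 'X *: NN - chi *: map_mx polyC T.
  by rewrite {1}/char_nn mulmxBr -scalemxAr mul_char_adj mul_mx_scalar.
rewrite [RHS]addrC [X in _ = X + _]scalerBr [X in _ = X - _ + _]scalerA [X in _ = _ - X + _]scalerA subrK exprSr. by [].
Qed.

Lemma map_coefD (X Y : 'M[{poly A}]_N) p :
  map_mx (fun q : {poly A} => q`_p) (X + Y) =
  map_mx (fun q : {poly A} => q`_p) X + map_mx (fun q : {poly A} => q`_p) Y.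
Proof. by apply/matrixP => i j; rewrite !mxE coefD. Qed.

Lemma map_coefZC (q : {poly A}) p :
  map_mx (fun q : {poly A} => q`_p) (q *: map_mx polyC T) = q`_p *: T.
Proof. by apply/matrixP => i j; rewrite !mxE coefMC. Qed.

Lemma mul_nn_coef j p : T *m nn_coef j p = nn_coef j.+1 p - (r j)`_p *: T.
Proof.
by rewrite nn_coefS map_coefD map_coefZC addrC addKr /nn_coef map_mx_coefM scalemxAr.
Qed.

Lemma nn_coef_mul j p : nn_coef j p *m T = nn_coef j.+1 p - (r j)`_p *: T.
Proof.
have comm : NN *m map_mx polyC T = map_mx polyC T *m NN.
  by rewrite -[X in X *m _]mul_char_adj -mulmxA char_adj_mul.
by rewrite nn_coefS map_coefD map_coefZC addrC addKr /nn_coef map_mx_coefMr -scalemxAl comm.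
Qed.

Lemma tr_nn_coef j p : \tr (nn_coef j p) = (p%:R - j%:R - N%:R) * (r j)`_p.
Proof.
transitivity (('X^j * \tr NN)`_p).
  rewrite /mxtrace mulr_sumr coef_sum; apply: eq_bigr => i _; rewrite [LHS]mxE.
  by congr (_`_ _); rewrite mxE.
rewrite tr_char_nn mulrBr coefB coef_XnM_Xderiv mulrnAr coefMn -/(char_row T j).
by rewrite -mulr_natl; ring.
Qed.

(** The trace of [nn_coef j p *m T *m nn_coef l q] is evaluated twice, [T] being absorbed into the
    right or the left factor. The quadratic terms cancel in the difference, and traces linear in
    [NN] remain. *)
Lemma G_step j l p q :
  G j l.+1 p q - G j.+1 l p q =
  (p%:R - j.+1%:R - N%:R) * (r j.+1)`_p * (r l)`_q -
  (q%:R - l.+1%:R - N%:R) * (r j)`_p * (r l.+1)`_q.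
Proof.
have E1 : nn_coef l.+1 q = T *m nn_coef l q + (r l)`_q *: T by rewrite mul_nn_coef subrK.
have E2 : nn_coef j.+1 p = nn_coef j p *m T + (r j)`_p *: T by rewrite nn_coef_mul subrK.
rewrite /G {1}E1 {1}E2 mulmxDr mulmxDl mulmxA -scalemxAr -scalemxAl !raddfD /= !mxtraceZ.
rewrite nn_coef_mul mul_nn_coef !raddfB /= !mxtraceZ !tr_nn_coef; ring.
Qed.

(** A Leibniz expansion in which columns [j] and [l] are merged into one function of their two rows.
    The cross terms of the Casimir operator have this shape; only the antisymmetric part of [f]
    counts. *)
Definition pairsum (j l : 'I_K) (f : 'I_K -> 'I_K -> A) : A :=
  \sum_(s : 'S_K) (-1) ^+ s *
    (f (s j) (s l) * \prod_(k | (k != j) && (k != l)) (r k)`_(m (s k))).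

Lemma eq_pairsum j l f g : f =2 g -> pairsum j l f = pairsum j l g.
Proof. by move=> e; apply: eq_bigr => s _; rewrite e. Qed.

Lemma pairsumB j l f g :
  pairsum j l (fun a b => f a b - g a b) = pairsum j l f - pairsum j l g.
Proof. by rewrite /pairsum -sumrB; apply: eq_bigr => s _; rewrite mulrBl mulrBr. Qed.

Lemma pairsum_swap j l f : j != l ->
  pairsum j l f = - pairsum j l (fun a b => f b a).
Proof.
move=> jl; rewrite /pairsum (reindex_inj (mulgI (tperm j l))) /= -sumrN.
apply: eq_bigr => s _; rewrite odd_permM odd_tperm jl signr_addb expr1 !mulN1r mulNr.
rewrite !permM tpermL tpermR; congr (- (_ * (_ * _))).
by apply: eq_bigr => k /andP[kj kl]; rewrite permM tpermD // eq_sym.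
Qed.

(* Two of the columns of the underlying determinant coincide. *)
Lemma pairsum_alt (j l u : 'I_K) (f : 'I_K -> A) : j != l -> u != j -> u != l ->
  pairsum j l (fun a b => f a * (r u)`_(m b)) = 0.
Proof.
move=> jl uj ul.
pose Y : 'M[A]_K := \matrix_(k, i) (if k == j then f i else
                       if k == l then (r u)`_(m i) else (r k)`_(m i)).
transitivity (\det Y).
  apply: eq_bigr => s _; congr (_ * _).
  rewrite [RHS](bigD1 j) //= [in RHS](bigD1 l) 1?eq_sym //= -mulrA.
  rewrite !mxE eqxx [l == j]eq_sym (negbTE jl) eqxx; congr (_ * (_ * _)).
  by apply: eq_bigr => k /andP[kj kl]; rewrite mxE (negbTE kj) (negbTE kl).
apply: (determinant_alternate (i1 := l) (i2 := u)); first by rewrite eq_sym.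
by move=> i; rewrite !mxE (negbTE uj) (negbTE ul) [l == j]eq_sym (negbTE jl) eqxx.
Qed.

Lemma pairsum_altl (j l u : 'I_K) (f : 'I_K -> A) : j != l -> u != j -> u != l ->
  pairsum j l (fun a b => f b * (r u)`_(m a)) = 0.
Proof. by move=> jl uj ul; rewrite pairsum_swap // pairsum_alt // oppr0. Qed.

Lemma pairsum_diag (j l : 'I_K) (f : 'I_K -> A) : j != l ->
  pairsum j l (fun a b => f b * ((r j)`_(m a) * (r l)`_(m b))) =
  \sum_(s : 'S_K) (-1) ^+ s * (f (s l) * \prod_(k < K) (r k)`_(m (s k))).
Proof.
move=> jl; apply: eq_bigr => s _; congr (_ * _); rewrite -mulrA; congr (_ * _).
by rewrite [RHS](bigD1 j) //= [in RHS](bigD1 l) 1?eq_sym //= mulrA.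
Qed.

(* By [G_step] the sums over [G j l], [G j.+1 l.-1], ..., [G l j] telescope; the last is
   minus the first, and only two of the increments survive antisymmetrization. *)
Lemma pairsum_G (j l : 'I_K) : (j < l)%N ->
  pairsum j l (fun a b => G j l (m a) (m b)) *+ 2 =
  - (\sum_(s : 'S_K) (-1) ^+ s *
     (((m (s l))%:R - l%:R - N%:R) * \prod_(k < K) (r k)`_(m (s k)))) *+ 2.
Proof.
move=> lt_jl; have jl : j != l by apply: contraTneq lt_jl => ->; rewrite ltnn.
pose t v := pairsum j l (fun a b => G v (j + l - v) (m a) (m b)).
pose z1 v := pairsum j l (fun a b => ((m a)%:R - v.+1%:R - N%:R) * (r v.+1)`_(m a) * (r (j + l - v.+1))`_(m b)).
pose z2 v := pairsum j l (fun a b => ((m b)%:R - (j + l - v)%:R - N%:R) * (r v)`_(m a) * (r (j + l - v))`_(m b)).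
have tj : t j = pairsum j l (fun a b => G j l (m a) (m b)) by rewrite /t addKn.
have tl : t l = - t j.
  rewrite tj [in RHS]pairsum_swap // opprK /t addnK.
  by apply: eq_pairsum => a b; rewrite G_sym.
have tv v : (j <= v < l)%N -> t v - t v.+1 = z1 v - z2 v.
  move=> /andP[jv vl]; rewrite /t /z1 /z2 -!pairsumB; apply: eq_pairsum => a b.
  have -> : (j + l - v = (j + l - v.+1).+1)%N by lia.
  by rewrite G_step.
have z1v v : (j <= v < l.-1)%N -> z1 v = 0.
  move=> h; have hu : (j + l - v.+1 < K)%N by have := ltn_ord l; lia.
  apply: (@pairsum_alt j l (Ordinal hu) (fun a => ((m a)%:R - v.+1%:R - N%:R) * (r v.+1)`_(m a))) => //.
  by apply/eqP => /(congr1 val) /=; lia.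
  by apply/eqP => /(congr1 val) /=; lia.
have z2v v : (j < v < l)%N -> z2 v = 0.
  move=> h; have hu : (v < K)%N by have := ltn_ord l; lia.
  rewrite -[RHS](@pairsum_altl j l (Ordinal hu) (fun b => ((m b)%:R - (j + l - v)%:R - N%:R) * (r (j + l - v))`_(m b))) //.
  - by apply: eq_pairsum => a b /=; rewrite mulrAC.
  - by apply/eqP => /(congr1 val) /=; lia.
  by apply/eqP => /(congr1 val) /=; lia.
have E : t j - t l = z1 l.-1 - z2 j.
  have <- : \sum_(j <= v < l) (t v - t v.+1) = t j - t l.
    by rewrite -opprB -telescope_sumr ?(ltnW lt_jl) // -sumrN; apply: eq_bigr => v _; rewrite opprB.
  rewrite big_nat (eq_bigr (fun v => z1 v - z2 v)) // -big_nat sumrB; congr (_ - _).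
    have -> : nat_of_ord l = l.-1.+1 by lia.
    rewrite big_nat_recr /=; last by lia.
    by rewrite big_nat big1 ?add0r // => v h; apply: z1v; lia.
  rewrite big_ltn // big_nat big1 ?addr0 // => v h; apply: z2v; lia.
have Z2 : z2 j = \sum_(s : 'S_K) (-1) ^+ s *
     (((m (s l))%:R - l%:R - N%:R) * \prod_(k < K) (r k)`_(m (s k))).
  rewrite -(pairsum_diag (fun b => (m b)%:R - l%:R - N%:R) jl) /z2 addKn; apply: eq_pairsum => a b; exact/esym/mulrA.
have Z1 : z1 l.-1 = - z2 j.
  rewrite /z1 pairsum_swap // /z2 addKn prednK; last by lia.
  by congr (- _); apply: eq_pairsum => a b; rewrite addnK mulrAC.
by rewrite -Z2 -tj; move: E; rewrite tl Z1 opprK -mulr2n => ->; ring.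
Qed.

Lemma casimir_char_row j p :
  casimir d (r j)`_p =
  (N%:R - p%:R + j%:R) * (p%:R - j%:R + 1) * (r j)`_p.
Proof.
transitivity ('X^j * \sum_a \sum_b map_poly (d a b) (map_poly (d b a) chi))`_p.
  rewrite mulr_sumr coef_sum; apply: eq_bigr => a _.
  rewrite mulr_sumr coef_sum; apply: eq_bigr => b _.
  rewrite (derivation_XnM_coef _ _ _ (dP b a)) (derivation_XnM_coef _ _ _ (dP a b)) //.
rewrite (casimir_char_poly dP dT).
have -> : 'X^2 * chi^`()^`() = 'X * ('X * chi^`())^`() - 'X * chi^`().
  by rewrite derivM derivX; ring.
rewrite !(mulrBr, mulrDr) !(coefB, coefD) !mulrnAr !coefMn !coef_XnM_Xderiv -/(char_row T j).
rewrite -[X in X + _ - _ - _]mulr_natl -[X in _ + X - _ - _]mulr_natl; ring.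
Qed.

(** When column [l] meets the row value [p], the diagonal term gives [(N - p + l) (p - l + 1)] and
    the cross terms give [- 2 l (p - l - N)]. The mixed products [2 l p] cancel, so the total weight
    is the same for all permutations and the minor is an eigenvector. *)
Lemma casimir_minor :
  casimir d (shift_minor T m) =
  (\sum_i ((N%:R - 1) * (m i)%:R - (m i)%:R ^+ 2)
   + \sum_(l < K) (N%:R + N%:R * l%:R + l%:R ^+ 2 + l%:R)) * shift_minor T m.
Proof.
have detE : shift_minor T m = \sum_(s : 'S_K) (-1) ^+ s * \prod_(k < K) (r k)`_(m (s k)).
  rewrite /shift_minor -det_tr; apply: eq_bigr => s _; congr (_ * _).
  by apply: eq_bigr => k _; rewrite !mxE.
rewrite {1}detE (casimir_sum dP).
under eq_bigr do rewrite (casimir_sign dP) (casimir_prod dP) mulrDr.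
rewrite big_split /=.
have -> : \sum_(s : 'S_K) (-1) ^+ s * (\sum_(i < K) \sum_(j < K | j != i)
      carre d (r i)`_(m (s i)) (r j)`_(m (s j)) *
       \prod_(k | (k != i) && (k != j)) (r k)`_(m (s k))) =
   \sum_(s : 'S_K) (-1) ^+ s *
     ((\sum_(l < K) (l%:R *- 2) * ((m (s l))%:R - l%:R - N%:R)) *
      \prod_(k < K) (r k)`_(m (s k))).
  transitivity (\sum_(i < K) \sum_(j < K | j != i) pairsum i j (fun a b => G i j (m a) (m b))).
    under eq_bigr do rewrite mulr_sumr.
    rewrite exchange_big /=; apply: eq_bigr => i _.
    under eq_bigr do rewrite mulr_sumr.
    rewrite exchange_big /=; apply: eq_bigr => j _; apply: eq_bigr => s _.
    by rewrite carre_char_row.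
  have Gsw (i j : 'I_K) : j != i -> pairsum i j (fun a b => G i j (m a) (m b)) =
         pairsum j i (fun a b => G j i (m a) (m b)).
    move=> ji; apply: eq_bigr => s _; rewrite G_sym; congr (_ * (_ * _)).
    by apply: eq_bigl => k; rewrite andbC.
  (* Each pair of columns is charged to its larger member [l], which has [l] smaller partners; this
     is the origin of the factor [l *- 2]. *)
  transitivity (\sum_(l < K) \sum_(j < K | (j < l)%N) pairsum j l (fun a b => G j l (m a) (m b)) *+ 2).
    transitivity (\sum_(i < K) \sum_(j < K | (j < i)%N) pairsum j i (fun a b => G j i (m a) (m b)) +
        \sum_(i < K) \sum_(j < K | (i < j)%N) pairsum i j (fun a b => G i j (m a) (m b))).
      rewrite -big_split /=; apply: eq_bigr => i _.
      rewrite (bigID (fun j : 'I_K => (j < i)%N)) /=; congr (_ + _).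
        rewrite (eq_bigl (fun j : 'I_K => (j < i)%N)) => [|j].
          by apply: eq_bigr => j ji; rewrite Gsw //; apply: contraTneq ji => ->; rewrite ltnn.
        by case: ltngtP => //; rewrite ?andbF // andbT => h; apply/eqP => e; rewrite e ltnn in h.
      apply: eq_bigl => j; rewrite -leqNgt ltn_neqAle; congr (_ && _).
      by rewrite eq_sym.
    rewrite [X in _ + X](exchange_big_dep xpredT) //= -big_split; apply: eq_bigr => l _.
    by rewrite -big_split /=; apply: eq_bigr => j _; rewrite mulr2n.
  transitivity (\sum_(l < K) (l%:R *- 2) * \sum_(s : 'S_K) (-1) ^+ s *
     (((m (s l))%:R - l%:R - N%:R) * \prod_(k < K) (r k)`_(m (s k)))).
    apply: eq_bigr => l _.
    rewrite (eq_bigr _ (fun j jl => pairsum_G jl)) sumr_const.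
    have -> : #|[pred j : 'I_K | (j < l)%N]| = l.
      rewrite -sum1_card /= -[RHS]card_ord -sum1_card.
      by rewrite (big_ord_widen _ (fun=> 1%N) (ltnW (ltn_ord l))).
    by rewrite -mulr_natl; ring.
  under eq_bigr do rewrite mulr_sumr.
  rewrite exchange_big /=; apply: eq_bigr => s _.
  rewrite [in RHS]mulr_suml [in RHS]mulr_sumr.
  apply: eq_bigr => l _. by rewrite mulrCA !mulrA.
rewrite -big_split /= detE mulr_sumr; apply: eq_bigr => s _.
rewrite [RHS]mulrCA -mulrDr; congr (_ * _).
under [X in X + _]eq_bigr => i _.
  rewrite casimir_char_row -(mulrA (_ * _) (r i)`_(m (s i))).
  have -> : (r i)`_(m (s i)) * \prod_(j < K | j != i) (r j)`_(m (s j)) =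
     \prod_(k < K) (r k)`_(m (s k)) by rewrite [RHS](bigD1 i).
  over.
rewrite -mulr_suml -mulrDl; congr (_ * _).
rewrite [X in _ = X + _](reindex_inj (@perm_inj _ s)) /= -!big_split /=.
by apply: eq_bigr => l _; ring.
Qed.

End CasimirMinor.

(** * The Gram matrix of the minors *)

Section MinorSymmetries.
Variables (A : comNzRingType) (N : nat) (T : 'M[A]_N) (K : nat).
Implicit Type m : 'I_K -> nat.
Local Notation S := (shift_minor T).

Lemma shift_minor_eq0 m i j : i != j -> m i = m j -> S m = 0.
Proof.
move=> ij mij; apply: (determinant_alternate ij) => a.
by rewrite !mxE mij.
Qed.

Lemma shift_minor_large m i : (N + K <= m i)%N -> S m = 0.
Proof.
move=> h; rewrite /shift_minor (expand_det_row _ i) big1 // => j _.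
rewrite !mxE coefXnM; case: ltnP => _; first by rewrite mul0r.
by rewrite nth_default ?mul0r // size_char_poly; have := ltn_ord j; lia.
Qed.

(** On the rows [N, ..., N + K - 1] the coefficient matrix is unitriangular, [chi] being monic. *)
Lemma shift_minor_max m (t : 'S_K) : (forall i, m i = N + t i)%N -> S m = (-1) ^+ t.
Proof.
move=> mE; pose b (i : 'I_K) := (N + i)%N.
have -> : S m = (-1) ^+ t * S b.
  rewrite /shift_minor -[(-1) ^+ t](@det_perm A) -det_mulmx -row_permE; congr (\det _).
  by apply/matrixP => i j; rewrite !mxE mE.
suff -> : S b = 1 by rewrite mulr1.
rewrite /shift_minor -det_tr det_trig; last first.
  apply/is_trig_mxP => i j ij; rewrite !mxE coefXnM.
  by case: ltnP => // _; rewrite nth_default // size_char_poly /b; lia.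
rewrite big1 // => i _; rewrite !mxE coefXnM /b ltnNge leq_addl /= addnK.
by have /eqP := char_poly_monic T; rewrite lead_coefE size_char_poly.
Qed.

End MinorSymmetries.

Section MatchingDeterminant.
Variables (C : numFieldType) (K : nat).
Implicit Type m : 'I_K -> nat.

(** For injective maps this is the sign of the permutation carrying one to the other, or zero if
    there is none. The determinant expresses orthogonality of antisymmetric families without sorting
    their indices. *)
Definition match_det m m' : C := \det (\matrix_(i, j) (m i == m' j)%:R).

Lemma match_det_sum m m' : match_det m m' =
  \sum_(s : 'S_K) (-1) ^+ s * ([forall i, m i == m' (s i)])%:R.
Proof.
apply: eq_bigr => s _; congr (_ * _).
case: (boolP [forall i, _]) => [/forallP h|/forallPn[i h]].
  by rewrite big1 // => i _; rewrite mxE h.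
by rewrite (bigD1 i) //= mxE (negbTE h) mul0r.
Qed.

Lemma match_det_eql m m' i j : i != j -> m i = m j -> match_det m m' = 0.
Proof. by move=> ij e; apply: (determinant_alternate ij) => a; rewrite !mxE e. Qed.

Lemma match_det_eqr m m' i j : i != j -> m' i = m' j -> match_det m m' = 0.
Proof.
move=> ij e; rewrite /match_det -det_tr; apply: (determinant_alternate ij) => a.
by rewrite !mxE e.
Qed.

Lemma match_det0 m m' : ~ (exists s : 'S_K, forall i, m i = m' (s i)) -> match_det m m' = 0.
Proof.
move=> h; rewrite match_det_sum big1 // => s _; case: (boolP [forall i, _]) => [/forallP e|]; last by rewrite mulr0.
by case: h; exists s => i; apply/eqP.
Qed.

Lemma match_det_perm m m' (s t : 'S_K) (b : nat -> nat) : injective b ->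
  (forall i, m i = b (s i)) -> (forall i, m' i = b (t i)) ->
  match_det m m' = (-1) ^+ s * (-1) ^+ t.
Proof.
move=> bI ms mt; rewrite match_det_sum (bigD1 (s * t^-1)%g) //= big1 ?addr0 => [|u us].
  have -> : [forall i, m i == m' ((s * t^-1)%g i)].
    by apply/forallP => i; rewrite ms mt permM permKV.
  by rewrite mulr1 odd_permM odd_permV signr_addb.
case: (boolP [forall i, _]) => [/forallP e|]; last by rewrite mulr0.
case/eqP: us; apply/permP => i; rewrite permM.
have := e i; rewrite ms mt => /eqP /bI/val_inj ->; by rewrite permK.
Qed.

(** The raised value occurs only at [j] in the raised [m']. In the term of a permutation [s] it can
    thus be matched only at [i = s^-1 j], and it is exactly when [s] matched the original maps. *)
Lemma match_det_step m m' (j : 'I_K) : (forall a, m' a != (m' j).+1) ->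
  \sum_(i | m i == m' j) match_det (upd m i (m' j).+1) (upd m' j (m' j).+1) =
  match_det m m'.
Proof.
move=> h; under eq_bigr do rewrite match_det_sum.
rewrite exchange_big match_det_sum; apply: eq_bigr => s _ /=.
rewrite -mulr_sumr; congr (_ * _).
pose i0 := (s^-1)%g j; have si0 : s i0 = j by rewrite /i0 permKV.
have off i : i != i0 -> [forall a, upd m i (m' j).+1 a == upd m' j (m' j).+1 (s a)] = false.
  move=> ii0; apply/negbTE/forallPn; exists i; rewrite /upd eqxx.
  by case: (s i =P j) => [e|_]; [rewrite /i0 -e permK eqxx in ii0|rewrite eq_sym].
have at0 : (m i0 == m' j) && [forall a, upd m i0 (m' j).+1 a == upd m' j (m' j).+1 (s a)]
         = [forall a, m a == m' (s a)].
  apply/andP/forallP => [[e0 /forallP e] a|e].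
    have := e a; rewrite /upd; case: (a =P i0) => [->|ne]; first by rewrite si0.
    by case: (s a =P j) => // e'; case: ne; rewrite /i0 -e' permK.
  split; first by have := e i0; rewrite si0.
  apply/forallP => a; rewrite /upd; case: (a =P i0) => [->|ne]; first by rewrite si0 eqxx.
  by case: (s a =P j) => // e'; case: ne; rewrite /i0 -e' permK.
rewrite -at0; case: (boolP (m i0 == m' j)) => [e0|e0] /=.
  by rewrite (bigD1 i0) //= big1 ?addr0 // => i /andP[_ ii0]; rewrite off.
by rewrite big1 // => i ei; rewrite off //; apply: contraNneq e0 => <-.
Qed.

End MatchingDeterminant.

(** The sum is the largest possible. If [A] is the set of values and [B] the top interval, [A] minus
    [B] and [B] minus [A] have equal size and sum, but lie below [N] and from [N] on respectively;
    so both are empty. *)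
Lemma sum_injective_max (N K : nat) (m : 'I_K -> nat) : injective m ->
  (forall i, m i < N + K)%N -> (\sum_i m i = \sum_(i < K) (N + i))%N ->
  forall i, (N <= m i)%N.
Proof.
move=> mI mlt deg.
pose M i : 'I_(N + K) := Ordinal (mlt i).
have MI : injective M by move=> i j [/mI].
pose A := [set M i | i in 'I_K]; pose B := [set x : 'I_(N + K) | (N <= x)%N].
pose R i : 'I_(N + K) := rshift N i.
have RI : injective R by exact: rshift_inj.
have BE : B = [set R i | i in 'I_K].
  apply/setP => x; rewrite inE; apply/idP/imsetP => [Nx|[i _ ->] /=]; last exact: leq_addr.
  have h : (x - N < K)%N by have := ltn_ord x; lia.
  by exists (Ordinal h) => //; apply/val_inj => /=; lia.
have cA : #|A| = K by rewrite card_imset // card_ord.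
have cB : #|B| = K by rewrite BE card_imset // card_ord.
have sA : (\sum_(x in A) x = \sum_(x in B) x :> nat)%N.
  rewrite /A BE !big_imset /=; first exact: deg.
    by move=> i j _ _; exact: RI.
  by move=> i j _ _; exact: MI.
have q : #|A :\: B| = #|B :\: A|.
  by have := cardsID B A; have := cardsID A B; rewrite cA cB setIC; lia.
have lA : (\sum_(x in A :\: B) x + #|A :\: B| <= #|A :\: B| * N)%N.
  rewrite -[X in (_ + X)%N]sum1_card -big_split -sum_nat_const leq_sum // => x.
  by rewrite !inE => /andP[h _] /=; lia.
have lB : (#|B :\: A| * N <= \sum_(x in B :\: A) x)%N.
  by rewrite -sum_nat_const leq_sum // => x; rewrite !inE => /andP[_ h].
rewrite (big_setID B) [RHS](big_setID A) /= [B :&: A]setIC in sA.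
move: sA => /addnI sA; rewrite -q in lB.
have : #|A :\: B| == 0%N by rewrite -sA in lB; move: lA lB; set a := (\sum_(x in _) _)%N; set b := (_ * N)%N; lia.
rewrite cards_eq0 setD_eq0 => /subsetP AB i.
by have := AB (M i); rewrite imset_f // inE => /(_ isT).
Qed.

Lemma injective_interval_perm (N K : nat) (m : 'I_K -> nat) : injective m ->
  (forall i, N <= m i < N + K)%N -> exists t : 'S_K, forall i, m i = (N + t i)%N.
Proof.
move=> mI mb; have h i : (m i - N < K)%N by have := mb i; lia.
have I : injective (fun i => Ordinal (h i)).
  by move=> i j [] e; apply: mI; have := mb i; have := mb j; lia.
by exists (perm I) => i; rewrite permE /=; have := mb i; lia.
Qed.

(** Otherwise the values fill the whole interval from [m j0 < N] to [N + K - 1], which has more than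
    [K] elements. *)
Lemma exists_gap (N K : nat) (m : 'I_K -> nat) (i0 j0 : 'I_K) :
  (m i0).+1 = (N + K)%N -> (forall j, m j < N + K)%N -> (m j0 < N)%N ->
  exists2 j, j != i0 & forall a, m a != (m j).+1.
Proof.
move=> mi0 mlt mj0.
case: (pickP (fun j => (j != i0) && [forall a, m a != (m j).+1])) => [j /andP[ji /forallP h]|no].
  by exists j.
have all v : (m j0 + v < N + K)%N -> exists a, m a = (m j0 + v)%N.
  elim: v => [|v IH] vlt; first by exists j0; rewrite addn0.
  have [|a ma] := IH; first by lia.
  have ai0 : a != i0 by apply: contraTneq vlt => e; move: mi0; rewrite -e ma; lia.
  have := no a; rewrite ai0 /= => /negbT/forallPn[b]; rewrite negbK => /eqP mb.
  by exists b; rewrite mb ma addnS.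
have : (size (iota (m j0) K.+1) <= size (codom m))%N.
  apply: uniq_leq_size; first exact: iota_uniq.
  move=> v; rewrite mem_iota => hv.
  have [|a ma] := all (v - m j0)%N; first by lia.
  by apply/codomP; exists a; lia.
by rewrite size_iota size_codom card_ord ltnn.
Qed.

Section UpdSums.
Variables (K : nat).
Implicit Type m : 'I_K -> nat.

Lemma sum_upd (F : nat -> nat) m i p :
  (\sum_a F (upd m i p a) + F (m i) = \sum_a F (m a) + F p)%N.
Proof.
rewrite (bigD1 i) //= [X in _ = (X + _)%N](bigD1 i) //= /upd eqxx.
rewrite (eq_bigr (fun a => F (m a))); last by move=> a /negbTE ->.
by lia.
Qed.

End UpdSums.

Section Recursion.
Variables (C : numFieldType) (A : comNzRingType) (N L : nat) (T : 'M[A]_N).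
Variables (d : 'I_N -> 'I_N -> A -> A) (D Q : A -> A) (H : A -> A -> C).
(* [H] stands for the form <f, g> = E[f g^*]; [D] and [Q] for the generators of
   T |-> T + t and of T |-> T + t T^2. *)
Hypothesis dP : forall a b, derivation (d a b).
Hypothesis dT : forall a b, map_mx (d a b) T = delta_mx a b *m T.
Hypothesis DP : derivation D.
Hypothesis DT : map_mx D T = 1%:M.
Hypothesis QP : derivation Q.
Hypothesis QT : map_mx Q T = T *m T.
Hypothesis HDl : forall x y z, H (x + y) z = H x z + H y z.
Hypothesis HDr : forall x y z, H x (y + z) = H x y + H x z.
Hypothesis H11 : H 1 1 = 1.
Hypothesis Hd : forall a b f g, H (d a b f) g = H f (d b a g).
Hypothesis HD : forall f g, H (D f) g = H f ((N + L)%:R * \tr T * g + Q g).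

Let H0l z : H 0 z = 0.
Proof. by apply: (addrI (H 0 z)); rewrite -HDl !addr0. Qed.
Let H0r z : H z 0 = 0.
Proof. by apply: (addrI (H z 0)); rewrite -HDr !addr0. Qed.
Let HNl x z : H (- x) z = - H x z.
Proof. by apply: (addrI (H x z)); rewrite -HDl !subrr H0l. Qed.
Let HNr x z : H x (- z) = - H x z.
Proof. by apply: (addrI (H x z)); rewrite -HDr !subrr H0r. Qed.
Let HMl n x z : H (n%:R * x) z = n%:R * H x z.
Proof. by elim: n => [|n IH]; rewrite ?mul0r ?H0l // -!natr1 !mulrDl !mul1r HDl IH. Qed.
Let HMr n x z : H x (n%:R * z) = n%:R * H x z.
Proof. by elim: n => [|n IH]; rewrite ?mul0r ?H0r // -!natr1 !mulrDl !mul1r HDr IH. Qed.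
Let Hsuml (I : finType) (F : I -> A) z : H (\sum_i F i) z = \sum_i H (F i) z.
Proof. exact: (big_morph (H^~ z) (fun x y => HDl x y z) (H0l z)). Qed.
Let Hsumr (I : finType) (F : I -> A) z : H z (\sum_i F i) = \sum_i H z (F i).
Proof. exact: (big_morph (H z) (fun x y => HDr z x y) (H0r z)). Qed.

Variable K : nat.
Implicit Type m : 'I_K -> nat.
Local Notation S := (shift_minor T).
Local Notation c m m' := (H (S m) (S m')).

(* Both minors are eigenvectors of the self-adjoint Euler operator. *)
Lemma minor_gram_deg m m' : c m m' != 0 -> (\sum_i m i = \sum_i m' i)%N.
Proof.
move=> c0.
pose E f := \sum_a d a a f.
have EP : derivation E.
  split=> x y; rewrite /E; first by rewrite -big_split; apply: eq_bigr => a _; exact: (dP a a).1.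
  by rewrite mulr_suml mulr_sumr -big_split; apply: eq_bigr => a _; exact: (dP a a).2.
have ET : map_mx E T = T.
  rewrite -[RHS]mul1mx mx1_sum_delta mulmx_suml; apply/matrixP => i j.
  by rewrite mxE summxE; apply: eq_bigr => a _; rewrite -dT mxE.
have HE : H (E (S m)) (S m') = H (S m) (E (S m')).
  by rewrite Hsuml Hsumr; apply: eq_bigr => a _; rewrite Hd.
move: HE; rewrite !(derivation_minor_mul _ EP ET) !mulrBl HDl HDr HNl HNr !HMl !HMr.
move/addrI/oppr_inj/(mulIf c0)/eqP; rewrite eqr_nat => /eqP //.
Qed.

(** The Casimir operator is self-adjoint, and once the sums agree its eigenvalues differ by the sums
    of squares only. *)
Lemma minor_gram_sq m m' : c m m' != 0 -> (\sum_i m i ^ 2 = \sum_i m' i ^ 2)%N.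
Proof.
move=> c0; have dg := minor_gram_deg c0.
have HE : H (casimir d (S m)) (S m') = H (S m) (casimir d (S m')).
  rewrite /casimir Hsuml Hsumr; apply: eq_bigr => a _.
  by rewrite Hsuml Hsumr; apply: eq_bigr => b _; rewrite !Hd.
(* The eigenvalue is written as a difference of natural multiples, which pass through the biadditive
   [H]. *)
have casE (p : 'I_K -> nat) : casimir d (S p) =
    (N * \sum_i p i + \sum_(l < K) (N + N * l + l ^ 2 + l))%:R * S p
    - ((\sum_i p i)%:R * S p + (\sum_i p i ^ 2)%:R * S p).
  rewrite (casimir_minor dP dT) -mulrDl -mulrBl; congr (_ * _).
  have -> : \sum_i ((N%:R - 1) * (p i)%:R - (p i)%:R ^+ 2) =
     N%:R * (\sum_i p i)%:R - (\sum_i p i)%:R - (\sum_i p i ^ 2)%:R :> A.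
    rewrite !natr_sum mulr_sumr -!sumrB; apply: eq_bigr => i _; rewrite natrX; ring.
  have -> : \sum_(l < K) (N%:R + N%:R * l%:R + l%:R ^+ 2 + l%:R) =
     (\sum_(l < K) (N + N * l + l ^ 2 + l))%:R :> A.
    by rewrite natr_sum; apply: eq_bigr => l _; rewrite !natrD natrM natrX.
  rewrite natrD natrM; ring.
move: HE; rewrite !casE !HDl !HDr !HNl !HNr !HDl !HDr !HMl !HMr dg.
move/addrI/oppr_inj/addrI/(mulIf c0)/eqP; rewrite eqr_nat => /eqP //.
Qed.

(* [HD] at [S m] and at the minor raised from [m'] at [j]: among the lowered minors on
   the right, only [S m'] has the sum of squares of [m]. *)
Lemma minor_gram_step m m' (i0 j : 'I_K) : (m' i0).+1 = (N + K)%N -> j != i0 ->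
  (forall a, m' a != (m' j).+1) ->
  (\sum_i m i = \sum_i m' i)%N -> (\sum_i m i ^ 2 = \sum_i m' i ^ 2)%N ->
  (L + (m' j).+1)%:R * c m m' =
  (m' j).+1%:R * \sum_(i | m i == m' j) c (upd m i (m' j).+1) (upd m' j (m' j).+1).
Proof.
move=> mi0 ji0 gap dg sq; set v := m' j; pose p := upd m' j v.+1.
have pi0 : (p i0).+1 = (N + K)%N by rewrite /p /upd eq_sym (negbTE ji0).
have sqp : (\sum_a p a ^ 2 = \sum_a m a ^ 2 + 2 * v + 1)%N.
  by have := sum_upd (fun x => x ^ 2)%N m' j v.+1; rewrite -/p -/v sq; lia.
have := HD (S m) (S p).
rewrite (derivation_minor_sqr _ QP QT pi0) (derivation_minor_id _ DP DT) HNl HNr.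
move/oppr_inj; rewrite Hsuml Hsumr.
rewrite [RHS](bigD1 j) //= [X in _ = _ + X]big1 ?addr0 => [|i ij]; last first.
  have [z|nz] := posnP (p i); first by rewrite shift_minor_dn0 // mulr0 H0r.
  rewrite shift_minor_dnS // HMr; apply/eqP; rewrite mulf_eq0; apply/orP; right.
  (* Lowering [p i] decreases the sum of squares by [2 p i - 1]. For a nonzero pairing this must be
     [2 v + 1], so [p i = v + 1], the value excluded by [gap]. *)
  apply: contraT => /minor_gram_sq e.
  have := sum_upd (fun x => x ^ 2)%N p i (p i).-1.
  have := gap i; have -> : m' i = p i by rewrite /p /upd (negbTE ij).
  by rewrite sqp -e -/v -{2 3}(prednK nz) => /eqP; nia.
rewrite HMr shift_minor_dnS; last by rewrite /p /upd eqxx.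
have -> : S (upd p j (p j).-1) = S m'.
  by apply: eq_shift_minor => a; rewrite /p /upd eqxx /=; case: eqP => [->|].
have -> : p j = v.+1 by rewrite /p /upd eqxx.
move=> <-; rewrite mulr_sumr [RHS]big_mkcond; apply: eq_bigr => i _; rewrite HMl.
case: eqP => [->//|ne]; apply/eqP; rewrite mulf_eq0; apply/orP; right.
(* Raising [m i] adds [2 m i + 1], which must be [2 v + 1]; hence [m i = v]. *)
apply: contraT => /minor_gram_sq; rewrite -/p sqp.
have := sum_upd (fun x => x ^ 2)%N m i (m i).+1.
by move=> /= e1 e2; case: ne; rewrite -/v; nia.
Qed.

(** A solution of the first-order recursion [fact_ratioS], which is the one that the coefficients of
    the ladder step impose on the norms. *)
Definition fact_ratio (p : nat) : C := ((L + p)`!)%:R / (p`!)%:R.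

Lemma fact_ratio_neq0 p : fact_ratio p != 0.
Proof. by rewrite mulf_neq0 ?invr_eq0 // pnatr_eq0 -lt0n fact_gt0. Qed.

Lemma fact_ratioS p : p.+1%:R * fact_ratio p.+1 = (L + p.+1)%:R * fact_ratio p.
Proof.
rewrite /fact_ratio addnS !factS !natrM.
have : (p`!)%:R != 0 :> C by rewrite pnatr_eq0 -lt0n fact_gt0.
have : p.+1%:R != 0 :> C by rewrite pnatr_eq0.
by move: (_.+1%:R) (_ `!%:R) => a b a0 b0; field; rewrite a0 b0.
Qed.

(* As long as the values of [m'] are not [N], ..., [N + K - 1] there is a gap above one
   of them, and the ladder step brings [m'] closer. *)
Lemma minor_gram_top m m' (i0 : 'I_K) : (m' i0).+1 = (N + K)%N ->
  (forall j, m' j < N + K)%N ->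
  c m m' * \prod_(i < K) fact_ratio (N + i) =
  \prod_i fact_ratio (m' i) * match_det C m m'.
Proof.
have [n] := ubnP (\sum_i (N + K - m' i))%N.
elim: n m m' => // n IH m m' le_n mi0 mlt.
have zero : c m m' = 0 -> match_det C m m' = 0 -> c m m' * \prod_(i < K) fact_ratio (N + i) =
  \prod_i fact_ratio (m' i) * match_det C m m' by move=> -> ->; rewrite mul0r mulr0.
have [/injectiveP m'I|/injectivePn[i [j ij e]]] := boolP (injectiveb m'); last first.
  apply: zero; first by rewrite (shift_minor_eq0 _ ij e) H0r.
  exact: match_det_eqr ij e.
have [/injectiveP mI|/injectivePn[i [j ij e]]] := boolP (injectiveb m); last first.
  apply: zero; first by rewrite (shift_minor_eq0 _ ij e) H0l.
  exact: match_det_eql ij e.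
have mE (F : nat -> nat) : (\sum_i F (m i) != \sum_i F (m' i))%N -> match_det C m m' = 0.
  move=> ne; apply: match_det0 => -[s es]; case/eqP: ne.
  by rewrite [RHS](reindex_inj (@perm_inj _ s)); apply: eq_bigr => i _; rewrite es.
have [dg|/eqP dg] := altP (\sum_i m i =P \sum_i m' i)%N; last first.
  apply: zero; last by apply: (mE id); apply/eqP.
  by apply/eqP; apply: contraT => /minor_gram_deg.
have [sq|/eqP sq] := altP (\sum_i m i ^ 2 =P \sum_i m' i ^ 2)%N; last first.
  apply: zero; last by apply: (mE (fun x => x ^ 2)%N); apply/eqP.
  by apply/eqP; apply: contraT => /minor_gram_sq.
have [/forallP ge|/forallPn[j0]] := boolP [forall j, (N <= m' j)%N]; last first.
  rewrite -ltnNge => j0N.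
  have [j ji0 gap] := exists_gap mi0 mlt j0N.
  have st := minor_gram_step mi0 ji0 gap dg sq.
  have v1 : ((m' j).+1 < N + K)%N.
    rewrite ltn_neqAle mlt andbT; apply/eqP => e; case/eqP: ji0.
    by apply: m'I; lia.
  have L0 : (L + (m' j).+1)%:R != 0 :> C by rewrite pnatr_eq0 addnS.
  apply: (mulfI L0); rewrite mulrA st -mulrA mulr_suml.
  pose m'' := upd m' j (m' j).+1.
  transitivity ((m' j).+1%:R * \sum_(i | m i == m' j)
      \prod_a fact_ratio (m'' a) * match_det C (upd m i (m' j).+1) m'').
    congr (_ * _); apply: eq_bigr => i _; apply: IH.
    - have := sum_upd (fun x => N + K - x)%N m' j (m' j).+1.
      move=> /= e; rewrite ltnS in le_n; apply: leq_trans le_n.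
      by rewrite -(ltn_add2r (N + K - m' j)) [X in (X < _)%N]e ltn_add2l; have := mlt j; lia.
    - by rewrite /m'' /upd eq_sym (negbTE ji0).
    - by move=> a; rewrite /m'' /upd; case: eqP.
  rewrite -mulr_sumr match_det_step // [LHS]mulrA [RHS]mulrA; congr (_ * _).
  rewrite (bigD1 j) //= [in RHS](bigD1 j) //= [LHS]mulrA [RHS]mulrA.
  have -> : m'' j = (m' j).+1 by rewrite /m'' /upd eqxx.
  rewrite fact_ratioS; congr (_ * _); apply: eq_bigr => a aj.
  by rewrite /m'' /upd (negbTE aj).
(* Here [m'] permutes [N, ..., N + K - 1]. Equality of the sums forces the same for [m], so both
   minors are signs and [H 1 1 = 1] decides. *)
have [t tE] := injective_interval_perm m'I (fun i => introT andP (conj (ge i) (mlt i))).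
have [/forallP mlt'|/forallPn[i]] := boolP [forall i, (m i < N + K)%N]; last first.
  rewrite -leqNgt => h; apply: zero; first by rewrite (shift_minor_large _ h) H0l.
  by apply: match_det0 => -[s /(_ i) e]; move: (mlt (s i)); rewrite -e ltnNge h.
have m'sum : (\sum_i m' i = \sum_(i < K) (N + i))%N.
  by rewrite [RHS](reindex_inj (@perm_inj _ t)); apply: eq_bigr => i _; rewrite tE.
have mge := sum_injective_max mI mlt' (etrans dg m'sum).
have [s sE] := injective_interval_perm mI (fun i => introT andP (conj (mge i) (mlt' i))).
have addNI : injective (addn N) by move=> x y /addnI.
rewrite (shift_minor_max _ sE) (shift_minor_max _ tE).
rewrite (@match_det_perm C K m m' s t (addn N) addNI sE tE) mulrC; congr (_ * _).
  by rewrite [LHS](reindex_inj (@perm_inj _ t)); apply: eq_bigr => i _; rewrite tE.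
by case: (odd_perm s); case: (odd_perm t); rewrite ?expr1 ?expr0 ?HNl ?HNr H11; ring.
Qed.

End Recursion.

(** * Bordered minors, the expansion of the power of [chi], and its Gram determinant *)

Definition rcons_fun k (m : 'I_k -> nat) (p : nat) (i : 'I_k.+1) : nat :=
  if unlift ord_max i is Some j then m j else p.

Lemma rcons_fun_lift k (m : 'I_k -> nat) p j : rcons_fun m p (lift ord_max j) = m j.
Proof. by rewrite /rcons_fun liftK. Qed.

Lemma rcons_fun_max k (m : 'I_k -> nat) p : rcons_fun m p ord_max = p.
Proof. by rewrite /rcons_fun unlift_none. Qed.

Lemma det_last_row (A : comNzRingType) k (X : 'M[A]_k.+1) :
  (forall j, X ord_max j = (j == ord_max)%:R) ->
  \det X = \det (\matrix_(i, j) X (lift ord_max i) (lift ord_max j)).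
Proof.
move=> h; rewrite (expand_det_row _ ord_max) (bigD1 ord_max) //= big1 ?addr0 => [|j jm].
  rewrite h eqxx mul1r /cofactor -signr_odd oddD addbb expr0 mul1r.
  by congr (\det _); apply/matrixP => i j; rewrite !mxE.
by rewrite h (negbTE jm) mul0r.
Qed.

(** The new row is zero except for a final 1, the leading coefficient of [chi]. It supplies the top
    row that the ladder relation requires. *)
Lemma shift_minor_rcons (A : comNzRingType) N (T : 'M[A]_N) k (m : 'I_k -> nat) :
  shift_minor T (rcons_fun m (N + k)) = shift_minor T m.
Proof.
rewrite /shift_minor det_last_row => [|j].
  congr (\det _); apply/matrixP => i j.
  by rewrite !mxE rcons_fun_lift lift_max.
rewrite mxE rcons_fun_max coefXnM; have := ltn_ord j; rewrite ltnS => jk.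
rewrite ltnNge (leq_trans jk (leq_addl _ _)) /=.
have [->|jm] := eqVneq j ord_max.
  rewrite addnK; have /eqP := char_poly_monic T.
  by rewrite lead_coefE size_char_poly.
rewrite nth_default // size_char_poly.
have : j != k :> nat by []; lia.
Qed.

Lemma match_det_rcons (C : numFieldType) k (f g : 'I_k -> nat) p :
  (forall i, g i != p) ->
  match_det C (rcons_fun f p) (rcons_fun g p) = match_det C f g.
Proof.
move=> gp; rewrite /match_det det_last_row => [|j].
  by congr (\det _); apply/matrixP => i j; rewrite !mxE !rcons_fun_lift.
rewrite mxE rcons_fun_max; case: (unliftP ord_max j) => [j' ->|->].
  by rewrite rcons_fun_lift eq_sym (negbTE (gp _)) eq_sym (negbTE (neq_lift _ _)).
by rewrite rcons_fun_max !eqxx.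
Qed.

(** Cauchy-Binet before grouping terms: the sum runs over all maps, not only increasing ones, and
    needs only multilinearity in the rows. *)
Lemma det_mulmx_ffun (R : comNzRingType) k n (Y : 'M[R]_(k, n)) (Z : 'M[R]_(n, k)) :
  \det (Y *m Z) = \sum_(f : {ffun 'I_k -> 'I_n})
    (\prod_i Y i (f i)) * \det (\matrix_(i, j) Z (f i) j).
Proof.
rewrite /determinant.
transitivity (\sum_(s : 'S_k) \sum_(f : {ffun 'I_k -> 'I_n})
    (-1) ^+ s * \prod_i (Y i (f i) * Z (f i) (s i))).
  apply: eq_bigr => s _; rewrite -mulr_sumr; congr (_ * _).
  under eq_bigr do rewrite mxE.
  by rewrite bigA_distr_bigA.
rewrite exchange_big; apply: eq_bigr => f _ /=; rewrite mulr_sumr.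
apply: eq_bigr => s _; rewrite big_split /= mulrCA; congr (_ * (_ * _)).
by apply: eq_bigr => i _; rewrite mxE.
Qed.

Lemma coef_XaddC_exp (R : comNzRingType) (z : R) m i :
  (('X + z%:P) ^+ m)`_i = 'C(m, i)%:R * z ^+ (m - i).
Proof.
elim: m i => [|m IH] [|i].
- by rewrite expr0 coef1 bin0 mul1r.
- by rewrite expr0 coef1 bin0n mul0r.
- by rewrite exprS mulrDl coefD coefXM coefCM IH !bin0 !subn0 add0r mul1r mul1r exprS.
rewrite exprS mulrDl coefD coefXM coefCM !IH binS natrD subSS /= mulrDl addrC; congr (_ + _).
have [im|mi] := ltnP i m; last by rewrite bin_small // !mul0r mulr0.
by rewrite mulrCA -exprS -subSn.
Qed.

Section CharPolyPower.
Variables (R : comNzRingType) (N : nat) (T : 'M[R]_N) (k : nat) (z : R).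

(** Row [i] is the functional taking the [i]-th Taylor coefficient at [z]. For [p < i] the binomial
    coefficient vanishes, so the truncated exponent does no harm. *)
Definition taylor_mx n : 'M[R]_(k, n) := \matrix_(i, p) ('C(p, i)%:R * z ^+ (p - i)).

(** The first [k] Taylor coefficients at [z] of the polynomials [X^j chi] form [Q *m P], with [Q]
    triangular of diagonal [chi(z)] and [P] unitriangular. The same matrix is [taylor_mx] times the
    coefficient matrix. *)
Lemma char_poly_expn :
  (char_poly T).[z] ^+ k = \sum_(f : {ffun 'I_k -> 'I_(N + k)})
    (\prod_i taylor_mx (N + k) i (f i)) * shift_minor T (fun i => f i).
Proof.
pose q := char_poly T \Po ('X + z%:P).
pose Q : 'M[R]_k := \matrix_(i, a) (if (a <= i)%N then q`_(i - a) else 0).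
pose P : 'M[R]_k := \matrix_(a, j) (('X + z%:P) ^+ j)`_a.
pose Z : 'M[R]_(N + k, k) := \matrix_(p, j) (char_row T j)`_p.
have detQ : \det Q = (char_poly T).[z] ^+ k.
  rewrite det_trig; last by apply/is_trig_mxP => i j ij; rewrite mxE leqNgt ij.
  rewrite (eq_bigr (fun=> (char_poly T).[z])) ?prodr_const ?card_ord // => i _.
  rewrite mxE leqnn subnn -horner_coef0 horner_comp; congr (_.[_]).
  by rewrite hornerD hornerX hornerC add0r.
have detP : \det P = 1.
  rewrite -det_tr det_trig ?big1 // => [i _|].
    by rewrite !mxE coef_XaddC_exp binn subnn mulr1.
  apply/is_trig_mxP => i j ij; rewrite !mxE coef_XaddC_exp bin_small ?mul0r //.
have E : Q *m P = taylor_mx (N + k) *m Z.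
  apply/matrixP => i j.
  transitivity ((char_row T j \Po ('X + z%:P))`_i).
    rewrite /char_row comp_polyM comp_Xn_poly mulrC -/q coefMr mxE.
    rewrite (big_ord_widen _ (fun a => q`_(i - a) * (('X + z%:P) ^+ j)`_a) (ltn_ord i)).
    rewrite [RHS]big_mkcond; apply: eq_bigr => a _ /=; rewrite !mxE ltnS.
    by case: ifP => // _; rewrite mul0r.
  have sz : (size (char_row T j) <= N + k)%N.
    rewrite (leq_trans (size_polyMleq _ _)) // size_polyXn size_char_poly.
    by have := ltn_ord j; lia.
  rewrite comp_polyE (big_ord_widen _ (fun p => (char_row T j)`_p *: ('X + z%:P) ^+ p) sz).
  rewrite big_mkcond coef_sum [RHS]mxE; apply: eq_bigr => p _; rewrite !mxE.
  case: ltnP => h; first by rewrite coefZ coef_XaddC_exp mulrC.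
  by rewrite [(char_row T j)`_p]nth_default // coef0 mulr0.
rewrite -detQ -[LHS]mulr1 -[X in _ * X = _]detP -det_mulmx E det_mulmx_ffun; apply: eq_bigr => f _.
congr (_ * _).
rewrite /shift_minor; congr (\det _); apply/matrixP => i j; by rewrite !mxE.
Qed.

End CharPolyPower.

Section GramSum.
Variables (C : numFieldType) (n k : nat) (Y Y' : 'M[C]_(k, n)) (w : 'I_n -> C).

(** [det_mulmx_ffun] read backwards twice: for fixed [g] the sum over [f] gives the minor of [Y] on
    the columns [g], and the sum over [g] then assembles a product of matrices. *)
Lemma sum_match_det :
  \sum_(f : {ffun 'I_k -> 'I_n}) \sum_(g : {ffun 'I_k -> 'I_n})
    (\prod_i Y i (f i)) * (\prod_i Y' i (g i)) *
    ((\prod_i w (g i)) * match_det C (fun i => f i) (fun i => g i)) =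
  \det (\matrix_(l, i) \sum_p w p * Y' l p * Y i p).
Proof.
rewrite exchange_big /=.
have -> : \matrix_(l, i) (\sum_p w p * Y' l p * Y i p) =
    (\matrix_(l, p) (w p * Y' l p)) *m Y^T.
  by apply/matrixP => l i; rewrite !mxE; apply: eq_bigr => p _; rewrite !mxE.
rewrite det_mulmx_ffun; apply: eq_bigr => g _.
transitivity ((\prod_i w (g i)) * (\prod_i Y' i (g i)) *
    \sum_(f : {ffun 'I_k -> 'I_n}) (\prod_i Y i (f i)) * match_det C (fun i => f i) (fun i => g i)).
  by rewrite mulr_sumr; apply: eq_bigr => f _; ring.
rewrite -big_split /=; congr (_ * _); first by apply: eq_bigr => i _; rewrite mxE.
pose Z : 'M[C]_(n, k) := \matrix_(p, j) (p == g j)%:R.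
transitivity (\det (Y *m Z)).
  by rewrite det_mulmx_ffun; apply: eq_bigr => f _; congr (_ * _); rewrite /match_det; congr (\det _); apply/matrixP => i j; rewrite !mxE.
rewrite -det_tr; congr (\det _); apply/matrixP => j i; rewrite !mxE.
rewrite (bigD1 (g j)) //= big1 ?addr0 => [|p pg]; first by rewrite mxE eqxx mulr1.
by rewrite mxE (negbTE pg) mulr0.
Qed.

End GramSum.

Section MinorGram.
Variables (C : numFieldType) (A : comNzRingType) (N L : nat) (T : 'M[A]_N).
Variables (d : 'I_N -> 'I_N -> A -> A) (D Q : A -> A) (H : A -> A -> C).
Hypothesis dP : forall a b, derivation (d a b).
Hypothesis dT : forall a b, map_mx (d a b) T = delta_mx a b *m T.
Hypothesis DP : derivation D.
Hypothesis DT : map_mx D T = 1%:M.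
Hypothesis QP : derivation Q.
Hypothesis QT : map_mx Q T = T *m T.
Hypothesis HDl : forall x y z, H (x + y) z = H x z + H y z.
Hypothesis HDr : forall x y z, H x (y + z) = H x y + H x z.
Hypothesis H11 : H 1 1 = 1.
Hypothesis Hd : forall a b f g, H (d a b f) g = H f (d b a g).
Hypothesis HD : forall f g, H (D f) g = H f ((N + L)%:R * \tr T * g + Q g).

(** [minor_gram_top] in size [k + 1], both families being bordered by the value [N + k]. The factor
    [fact_ratio (N + k)] appears on both sides and cancels. *)
Lemma minor_gram k (f g : 'I_k -> 'I_(N + k)) :
  H (shift_minor T (fun i => f i)) (shift_minor T (fun i => g i)) =
  (\prod_(i < k) fact_ratio C L (N + i))^-1 *
  (\prod_i fact_ratio C L (g i) * match_det C (fun i => f i) (fun i => g i)).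
Proof.
have Z0 : \prod_(i < k) fact_ratio C L (N + i) != 0.
  by apply/prodf_neq0 => i _; exact: fact_ratio_neq0.
pose m := rcons_fun (fun i : 'I_k => nat_of_ord (f i)) (N + k).
pose m' := rcons_fun (fun i : 'I_k => nat_of_ord (g i)) (N + k).
have top : (m' ord_max).+1 = (N + k.+1)%N by rewrite /m' rcons_fun_max addnS.
have lt j : (m' j < N + k.+1)%N.
  case: (unliftP ord_max j) => [i ->|->]; last by rewrite top.
  by rewrite /m' rcons_fun_lift addnS ltnS ltnW.
have := minor_gram_top dP dT DP DT QP QT HDl HDr H11 Hd HD m top lt.
rewrite /m /m' !shift_minor_rcons match_det_rcons => [|i]; last by rewrite ltn_eqF.
rewrite !big_ord_recr /= rcons_fun_max.
rewrite [X in _ = X * _ * _](eq_bigr (fun i => fact_ratio C L (g i))); last first.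
  by move=> i _; rewrite (_ : widen_ord _ i = lift ord_max i) ?rcons_fun_lift //; exact/val_inj/esym/lift_max.
rewrite [LHS]mulrA [RHS]mulrAC => /(mulIf (fact_ratio_neq0 C L (N + k))) <-.
by rewrite mulrC mulfK.
Qed.

End MinorGram.

Section GramDeterminant.
Variables (C : numFieldType) (L n k : nat).

Definition gram_mx (y z : C) : 'M[C]_k :=
  \matrix_(l, i) \sum_(p < n) fact_ratio C L p * taylor_mx k y n l p * taylor_mx k z n i p.

(* By homogeneity only the product of the two points matters. *)
Lemma det_gram_mx y z : \det (gram_mx y z) = \det (gram_mx 1 (y * z)).
Proof.
have E y1 z1 : \det (gram_mx y1 z1) = \sum_(f : {ffun 'I_k -> 'I_n})
  (\prod_i fact_ratio C L (f i)) * ((\prod_i taylor_mx k y1 n i (f i)) *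
   \sum_(s : 'S_k) (-1) ^+ s * \prod_i taylor_mx k z1 n (s i) (f i)).
  have -> : gram_mx y1 z1 = (\matrix_(l, p) (fact_ratio C L p * taylor_mx k y1 n l p))
        *m (taylor_mx k z1 n)^T.
    by apply/matrixP => l i; rewrite !mxE; apply: eq_bigr => p _; rewrite !mxE.
  rewrite det_mulmx_ffun; apply: eq_bigr => f _.
  rewrite mulrA -big_split /=; congr (_ * _); first by apply: eq_bigr => i _; rewrite mxE.
  apply: eq_bigr => s _; congr (_ * _); apply: eq_bigr => i _; by rewrite !mxE.
rewrite !E; apply: eq_bigr => f _; congr (_ * _); rewrite !mulr_sumr.
apply: eq_bigr => s _; rewrite !(mulrCA _ ((-1) ^+ s)); congr (_ * _).
(* If a truncated difference would spoil the count of exponents, a binomial coefficient vanishes on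
   both sides. *)
have [/forallP h1|/forallPn[i]] := boolP [forall i : 'I_k, (i <= f i)%N]; last first.
  rewrite -ltnNge => h; rewrite (bigD1 i) //= mxE bin_small // !mul0r.
  by rewrite [X in _ = X * _](bigD1 i) //= mxE bin_small // !mul0r.
have [/forallP h2|/forallPn[i]] := boolP [forall i : 'I_k, (s i <= f i)%N]; last first.
  rewrite -ltnNge => h; rewrite [X in _ * X](bigD1 i) //= mxE bin_small // !mul0r mulr0.
  by rewrite [X in _ = _ * X](bigD1 i) //= mxE bin_small // !mul0r mulr0.
have sumE : (\sum_(i < k) (f i - s i) = \sum_(i < k) (f i - i))%N.
  have e1 : (\sum_(i < k) (f i - s i) + \sum_(i < k) i = \sum_(i < k) f i)%N.
    rewrite [X in (_ + X)%N](reindex_inj (@perm_inj _ s)) -big_split /=.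
    by apply: eq_bigr => i _; rewrite subnK.
  have e2 : (\sum_(i < k) (f i - i) + \sum_(i < k) i = \sum_(i < k) f i)%N.
    by rewrite -big_split /=; apply: eq_bigr => i _; rewrite subnK.
  by apply/eqP; rewrite -(eqn_add2r (\sum_(i < k) i)) e1 e2.
under eq_bigr do rewrite mxE.
under [X in _ * X = _]eq_bigr do rewrite mxE.
under [X in _ = X * _]eq_bigr do rewrite mxE expr1n mulr1.
under [X in _ = _ * X]eq_bigr do rewrite mxE.
by rewrite !big_split /= !prodrXr sumE exprMn; ring.
Qed.

End GramDeterminant.

Lemma map_taylor_mx (F F' : comNzRingType) (phi : {rmorphism F -> F'}) k z n :
  map_mx phi (taylor_mx k z n) = taylor_mx k (phi z) n.
Proof. by apply/matrixP => i p; rewrite !mxE rmorphM rmorphXn rmorph_nat. Qed.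

Lemma map_fact_ratio (F F' : numFieldType) (phi : {rmorphism F -> F'}) L p :
  phi (fact_ratio F L p) = fact_ratio F' L p.
Proof. by rewrite /fact_ratio rmorphM fmorphV !rmorph_nat. Qed.

Lemma map_gram_mx (F F' : numFieldType) (phi : {rmorphism F -> F'}) L n k y z :
  map_mx phi (gram_mx L n k y z) = gram_mx L n k (phi y) (phi z).
Proof.
apply/matrixP => l i; rewrite !mxE rmorph_sum; apply: eq_bigr => p _.
rewrite !mxE rmorphM rmorphM (map_fact_ratio phi).
by congr (_ * _ * _); rewrite rmorphM rmorphXn rmorph_nat.
Qed.

(** * Hankel determinants of truncated Beta integrals *)

Section PolyIntegral.
Variable F : numFieldType.
Implicit Types p q : {poly F}.

(** Integration over [[0, 1]] as a functional on coefficients; [Rintegral_horner] links it to the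
    Lebesgue integral. *)
Definition poly_int01 p : F := \sum_(i < size p) p`_i / i.+1%:R.

Lemma poly_int01_widen n p : (size p <= n)%N ->
  poly_int01 p = \sum_(i < n) p`_i / i.+1%:R.
Proof.
move=> sz; rewrite /poly_int01 (big_ord_widen _ (fun i => p`_i / i.+1%:R) sz) big_mkcond.
by apply: eq_bigr => i _; case: ltnP => // h; rewrite nth_default // mul0r.
Qed.

Lemma poly_int01D p q : poly_int01 (p + q) = poly_int01 p + poly_int01 q.
Proof.
have sz := size_polyD p q.
rewrite (poly_int01_widen sz) (poly_int01_widen (leq_maxl (size p) (size q))).
rewrite (poly_int01_widen (leq_maxr (size p) (size q))) -big_split /=.
by apply: eq_bigr => i _; rewrite coefD mulrDl.
Qed.

Lemma poly_int01Z a p : poly_int01 (a *: p) = a * poly_int01 p.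
Proof.
rewrite (poly_int01_widen (size_scale_leq a p)) /poly_int01 mulr_sumr.
by apply: eq_bigr => i _; rewrite coefZ mulrA.
Qed.

Lemma poly_int010 : poly_int01 0 = 0.
Proof. by rewrite /poly_int01 size_poly0 big_ord0. Qed.

Lemma poly_int01_sum (I : Type) (r : seq I) (P : pred I) (G : I -> {poly F}) :
  poly_int01 (\sum_(i <- r | P i) G i) = \sum_(i <- r | P i) poly_int01 (G i).
Proof. exact: (big_morph poly_int01 poly_int01D poly_int010). Qed.

Lemma poly_int01_Xn n : poly_int01 'X^n = n.+1%:R^-1.
Proof.
rewrite (@poly_int01_widen n.+1) ?size_polyXn // big_ord_recr /= coefXn eqxx mul1r.
by rewrite big1 ?add0r // => i _; rewrite coefXn ltn_eqF // mul0r.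
Qed.

Lemma poly_int01_deriv p : poly_int01 p^`() = p.[1] - p.[0].
Proof.
have sz : (size p^`() <= (size p).-1)%N by exact: size_poly.
rewrite (poly_int01_widen sz) horner_coef0 horner_coef.
case sp : (size p) => [|n] /=.
  by rewrite !big_ord0 nth_default ?sp // subrr.
rewrite big_ord_recl expr1n mulr1 addrC addKr.
apply: eq_bigr => i _.
by rewrite coef_deriv expr1n mulr1 -(mulr_natr p`_i.+1) mulfK ?pnatr_eq0.
Qed.

(** Integration by parts: [X^(a+1) (1 - X)^(b+1)] vanishes at both ends. *)
Lemma poly_int01_beta a b :
  poly_int01 ('X^a * (1 - 'X) ^+ b) = (a`! * b`!)%:R / ((a + b).+1`!)%:R.
Proof.
elim: b a => [|b IH] a.
  rewrite expr0 mulr1 poly_int01_Xn fact0 muln1 addn0 factS natrM invfM mulrCA mulfV ?mulr1 //.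
  by rewrite pnatr_eq0 -lt0n fact_gt0.
have := poly_int01_deriv ('X^(a.+1) * (1 - 'X) ^+ b.+1).
rewrite !(hornerM, hornerXn, horner_exp, hornerD, hornerN, hornerC, hornerX) subrr !expr0n /= mulr0 mul0r subr0.
have -> : ('X^(a.+1) * (1 - 'X) ^+ b.+1)^`() =
   a.+1%:R *: ('X^a * (1 - 'X) ^+ b.+1) + (- b.+1%:R) *: ('X^(a.+1) * (1 - 'X) ^+ b) :> {poly F}.
  have e1 : ((1 - 'X) ^+ b.+1)^`() = - ((1 - 'X) ^+ b *+ b.+1) :> {poly F}.
    by rewrite deriv_exp !derivE sub0r mulN1r mulNrn.
  rewrite derivM e1 derivXn -!mul_polyC polyCN !polyC_natr /=; ring.
rewrite poly_int01D !poly_int01Z IH mulNr => /eqP; rewrite subr_eq0 => /eqP e.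
apply: (@mulfI _ a.+1%:R); first by rewrite pnatr_eq0.
by rewrite e addSnnS factS [b.+1`!]factS !natrM; ring.
Qed.

(** For [s > 0] this is the incomplete Beta integral over [[0, s]] divided by [s^(a+1)]; rescaled to
    [[0, 1]] it is a polynomial in [s]. *)
Definition beta_trunc a N (s : F) : F := poly_int01 ('X^a * (1 - s *: 'X) ^+ N).

(** A truncated negative binomial series is an incomplete Beta integral: expand
    [1 - (1 - x) X = (1 - X) + x X] by the binomial theorem and integrate each term as a complete
    Beta integral. *)
Lemma sum_fact_ratio a n (x : F) : (0 < n)%N ->
  \sum_(m < n) ((a + m)`!)%:R / (m`!)%:R * x ^+ m =
  ((a + n)`!)%:R / ((n.-1)`!)%:R * beta_trunc a n.-1 (1 - x).
Proof.
move=> n0; rewrite /beta_trunc.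
have -> : 1 - (1 - x) *: 'X = (1 - 'X) + x *: 'X :> {poly F}.
  by rewrite scalerBl scale1r opprB addrA addrAC.
rewrite exprDn [X in poly_int01 X]mulr_sumr poly_int01_sum mulr_sumr prednK //; apply: eq_bigr => m _.
have mn : (m <= n.-1)%N by rewrite -ltnS prednK.
have -> : 'X^a * ((1 - 'X) ^+ (n.-1 - m) * (x *: 'X) ^+ m *+ 'C(n.-1, m)) =
   ('C(n.-1, m)%:R * x ^+ m) *: ('X^(a + m) * (1 - 'X) ^+ (n.-1 - m)) :> {poly F}.
  by rewrite exprZn exprD -!mul_polyC polyCM polyC_natr; ring.
rewrite poly_int01Z poly_int01_beta.
have -> : (a + m + (n.-1 - m)).+1 = (a + n)%N by lia.
rewrite -(bin_fact mn) !natrM.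
have : (m`!)%:R != 0 :> F by rewrite pnatr_eq0 -lt0n fact_gt0.
have : ((n.-1 - m)`!)%:R != 0 :> F by rewrite pnatr_eq0 -lt0n fact_gt0.
have : ((a + n)`!)%:R != 0 :> F by rewrite pnatr_eq0 -lt0n fact_gt0.
have : 'C(n.-1, m)%:R != 0 :> F by rewrite pnatr_eq0 -lt0n bin_gt0.
move: (x ^+ m) ((a + m)`!%:R) (m`!%:R) ((n.-1 - m)`!%:R) ((a + n)`!%:R) ('C(n.-1, m)%:R).
by move=> X1 X2 X3 X4 X5 X6 h1 h2 h3 h4; field; rewrite h1 h2 h3 h4.
Qed.

End PolyIntegral.

Section GramHankel.
Variables (F : numFieldType) (L N k : nat).

Definition hankel_det (s : F) : F := \det (\matrix_(i < k, j < k) beta_trunc (L + i + j) N s).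

(* Vandermonde's identity makes the change from the binomial basis 'C(p, l)
   to the rising one 'C(L + l + p, l) unitriangular. *)
Lemma det_gram_rising (x : F) : \det (gram_mx L (N + k) k 1 x) =
  \det (\matrix_(i < k, l < k) \sum_(p < N + k)
     fact_ratio F L p * taylor_mx k x (N + k) i p * 'C(L + l + p, l)%:R).
Proof.
pose V : 'M[F]_k := \matrix_(a, l) (if (a <= l)%N then 'C(L + l, l - a)%:R else 0).
have detV : \det V = 1.
  rewrite -det_tr det_trig ?big1 // => [i _|]; first by rewrite !mxE leqnn subnn bin0.
  by apply/is_trig_mxP => i j ij; rewrite !mxE leqNgt ij.
rewrite -det_tr -[LHS]mulr1 -[X in _ * X = _]detV -det_mulmx; congr (\det _).
apply/matrixP => i l; rewrite !mxE.
under eq_bigr => a _ do rewrite !mxE mulr_suml.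
rewrite exchange_big /=; apply: eq_bigr => p _; rewrite !mxE.
transitivity (fact_ratio F L p * ('C(p, i)%:R * x ^+ (p - i)) *
   \sum_(a < k) 'C(p, a)%:R * (if (a <= l)%N then 'C(L + l, l - a)%:R else 0)).
  rewrite mulr_sumr; apply: eq_bigr => a _; rewrite !mxE expr1n.
  by move: (if _ then _ else _) (fact_ratio F L p) => u v; ring.
congr (_ * _); rewrite [(L + l + p)%N]addnC -binomial.Vandermonde natr_sum.
rewrite (big_ord_widen _ (fun a => ('C(p, a) * 'C(L + l, l - a))%:R) (ltn_ord l)) [RHS]big_mkcond.
by apply: eq_bigr => a _ /=; rewrite ltnS; case: ifP; rewrite ?mulr0 // natrM.
Qed.

Definition gram_const : F :=
  (\prod_(i < k) ((i`!)%:R * ((N + k - i).-1`!)%:R)^-1) *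
  (\prod_(l < k) (((L + l + (N + k))`!)%:R / (l`!)%:R)).

(** Summation over [p] leaves at [(i, l)] the integral of [X^(L+i+l) (1 - s X)^(N+k-i-1)], whose
    second exponent still depends on the row. With [(1 - s X)^N] set aside, the rest
    [X^i (1 - s X)^(k-1-i)] has degree below [k] and lowest term [X^i], so its coefficients form the
    unitriangular [P]. *)
Lemma det_gram_hankel (x : F) :
  \det (gram_mx L (N + k) k 1 x) = gram_const * hankel_det (1 - x).
Proof.
rewrite det_gram_rising.
pose s := 1 - x.
pose P : 'M[F]_k := \matrix_(i, j) ('X^i * (1 - s *: 'X) ^+ (k.-1 - i))`_j.
have detP : \det P = 1.
  rewrite -det_tr det_trig ?big1 // => [i _|].
    rewrite !mxE coefXnM ltnn subnn -horner_coef0 horner_exp !hornerE.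
    by rewrite subr0 expr1n.
  by apply/is_trig_mxP => i j ij; rewrite !mxE coefXnM ij.
have E : \matrix_(i < k, l < k) \sum_(p < N + k)
     fact_ratio F L p * taylor_mx k x (N + k) i p * 'C(L + l + p, l)%:R =
   diag_mx (\row_(i < k) ((i`!)%:R * ((N + k - i).-1`!)%:R)^-1) *m
   (P *m \matrix_(i < k, j < k) beta_trunc (L + i + j) N s) *m
   diag_mx (\row_(l < k) (((L + l + (N + k))`!)%:R / (l`!)%:R)).
  rewrite mul_diag_mx mul_mx_diag; apply/matrixP => i l; rewrite !mxE.
  have ik : (i < N + k)%N by rewrite (leq_trans (ltn_ord i)) ?leq_addl.
  have -> : \sum_j P i j * (\matrix_(i < k, j < k) beta_trunc (L + i + j) N s) j l =
     beta_trunc (L + i + l) (N + k - i).-1 s.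
    rewrite /beta_trunc.
    have -> : (N + k - i).-1 = (k.-1 - i + N)%N by have := ltn_ord i; lia.
    have sz : (size ('X^i * (1 - s *: 'X) ^+ (k.-1 - i))%R <= k)%N.
      rewrite (leq_trans (size_polyMleq _ _)) // size_polyXn.
      have s2 : (size (1 - s *: 'X : {poly F})%R <= 2)%N.
        rewrite (leq_trans (size_polyD _ _)) // size_poly1 size_polyN geq_max /=.
        by rewrite (leq_trans (size_scale_leq _ _)) // size_polyX.
      have : (size ((1 - s *: 'X) ^+ (k.-1 - i))%R <= (k.-1 - i).+1)%N.
        rewrite (leq_trans (size_poly_exp_leq _ _)) // ltnS -[X in (_ <= X)%N]mul1n.
        by rewrite leq_mul2r; apply/orP; right; move: s2; case: (size _) => [|[|[|?]]].
      by move: (size _) => e; have := ltn_ord i; lia.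
    have -> : 'X^(L + i + l) * (1 - s *: 'X) ^+ (k.-1 - i + N) =
        \sum_(j < k) P i j *: ('X^(L + j + l) * (1 - s *: 'X) ^+ N).
      rewrite !exprD; have pE := coefK ('X^i * (1 - s *: 'X) ^+ (k.-1 - i)).
      transitivity ('X^i * (1 - s *: 'X) ^+ (k.-1 - i) * ('X^L * 'X^l * (1 - s *: 'X) ^+ N)).
        by ring.
      rewrite -{1}pE poly_def (big_ord_widen _ (fun j => ('X^i * (1 - s *: 'X) ^+ (k.-1 - i))`_j *: 'X^j) sz) big_mkcond mulr_suml.
      apply: eq_bigr => j _; rewrite mxE; case: ltnP => h.
        by rewrite -scalerAl !exprD; congr (_ *: _); ring.
      by rewrite mul0r nth_default // scale0r.
    by rewrite poly_int01_sum; apply: eq_bigr => j _; rewrite poly_int01Z !mxE.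
  (* In the rising basis the product of the weight and both binomial coefficients collapses to
     [(L + l + p)! / (i! l! (p - i)!)]. Terms with [p < i] vanish, and [p = i + m]. *)
  transitivity ((i`!)%:R^-1 * (l`!)%:R^-1 * \sum_(m < N + k - i) ((L + i + l + m)`!)%:R / (m`!)%:R * x ^+ m).
    pose G p : F := fact_ratio F L p * ('C(p, i)%:R * x ^+ (p - i)) * 'C(L + l + p, l)%:R.
    transitivity (\sum_(0 <= p < N + k) G p).
      by rewrite big_mkord; apply: eq_bigr => p _; rewrite mxE.
    rewrite (big_cat_nat (n := i)) ?(ltnW ik) //= big_nat big1 ?add0r => [|p /andP[_ pi]]; last first.
      by rewrite /G bin_small // mul0r mulr0 mul0r.
    rewrite -{1}[val i]add0n big_addn big_mkord mulr_sumr; apply: eq_bigr => m _.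
    rewrite /G addnK /fact_ratio.
    have n0 n : (n`!)%:R != 0 :> F by rewrite pnatr_eq0 -lt0n fact_gt0.
    have e1 : ((m + i)`!)%:R = 'C(m + i, i)%:R * ((i`!)%:R * (m`!)%:R) :> F.
      by rewrite -(bin_fact (leq_addl m i)) addnK !natrM.
    have e2 : ((L + i + l + m)`!)%:R =
              'C(L + l + (m + i), l)%:R * ((l`!)%:R * ((L + (m + i))`!)%:R) :> F.
      have -> : (L + i + l + m = L + l + (m + i))%N by lia.
      have h : (l <= L + l + (m + i))%N by lia.
      have -> : (L + (m + i) = L + l + (m + i) - l)%N by lia.
      by rewrite -(bin_fact h) !natrM.
    have b0 : 'C(m + i, i)%:R != 0 :> F by rewrite pnatr_eq0 -lt0n bin_gt0 leq_addl.
    rewrite e1 e2; have := n0 i; have := n0 m; have := n0 l; move: b0.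
    move: ('C(m + i, i)%:R) ('C(L + l + (m + i), l)%:R) ((L + (m + i))`!%:R) (x ^+ m).
    move: (i`!%:R) (m`!%:R) (l`!%:R) => X1 X2 X3 X4 X5 X6 X7 h1 h2 h3 h4.
    by field; rewrite h1 h2 h3 h4.
  rewrite sum_fact_ratio ?subn_gt0 //.
  have -> : (L + i + l + (N + k - i) = L + l + (N + k))%N by lia.
  by rewrite -/s invfM; ring.
rewrite E !det_mulmx !det_diag detP mul1r /gram_const mulrAC.
by congr (_ * _ * _); apply: eq_bigr => i _; rewrite mxE.
Qed.

(** A power of zero leaves only [p = i], so the matrix is triangular. Through [det_gram_hankel] this
    evaluates [hankel_det 1] and takes the place of Selberg's integral. *)
Lemma det_gram0 : \det (gram_mx L (N + k) k 1 (0 : F)) = \prod_(i < k) fact_ratio F L i.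
Proof.
have E (i l : 'I_k) : (gram_mx L (N + k) k 1 (0 : F))^T i l = fact_ratio F L i * 'C(i, l)%:R.
  have ik : (i < N + k)%N by rewrite (leq_trans (ltn_ord i)) ?leq_addl.
  rewrite !mxE (bigD1 (Ordinal ik)) //= big1 ?addr0 => [|p pi].
    by rewrite !mxE /= expr1n binn subnn expr0 !mulr1.
  rewrite !mxE expr0n; have [pi'|pi'] := ltnP p i; first by rewrite (bin_small pi') mul0r mulr0.
  have : p != i :> nat by []; rewrite subn_eq0 => h.
  by rewrite leqNgt ltn_neqAle eq_sym h pi' !mulr0.
rewrite -det_tr det_trig; first by apply: eq_bigr => i _; rewrite E binn mulr1.
by apply/is_trig_mxP => i j ij; rewrite E bin_small // mulr0.
Qed.

Lemma hankel_det1_neq0 : hankel_det 1 != 0.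
Proof.
have := det_gram0; rewrite det_gram_hankel subr0 => e.
have : gram_const * hankel_det 1 != 0.
  by rewrite e; apply/prodf_neq0 => i _; exact: fact_ratio_neq0.
by rewrite mulf_eq0 negb_or => /andP[].
Qed.

Lemma det_gram_ratio (x : F) : \det (gram_mx L (N + k) k 1 x) =
  \prod_(i < k) fact_ratio F L i * (hankel_det (1 - x) / hankel_det 1).
Proof.
rewrite -det_gram0 !det_gram_hankel subr0 -mulrA; congr (_ * _).
by rewrite mulrCA mulfV ?mulr1 // hankel_det1_neq0.
Qed.

End GramHankel.

(** * Polynomials in the entries of a matrix *)

Section EntryPolynomials.
Variables (C : comNzRingType) (M : nat).

Definition epoly : comNzRingType := {mpoly C[M * M]}.

Definition gen_mx : 'M[epoly]_M := \matrix_(a, j) ('X_(mxvec_index a j) : {mpoly C[M * M]}).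

Definition epolyC (c : C) : epoly := c%:MP.

(* Locked: otherwise unification unfolds polynomial evaluation when it fails. *)
Definition epoly_eval (U : 'M[C]_M) : epoly -> C :=
  locked (fun p => p.@[fun i => mxvec U ord0 i]).

Definition partial (a j : 'I_M) : epoly -> epoly := locked (mderiv (mxvec_index a j)).

(** The derivative along the vector field [U |-> X U]. *)
Definition left_deriv (X : 'M[C]_M) : epoly -> epoly :=
  locked (fun p => \sum_a \sum_j (map_mx epolyC X *m gen_mx) a j * partial a j p).

Lemma left_derivE X p :
  left_deriv X p = \sum_a \sum_j (map_mx epolyC X *m gen_mx) a j * partial a j p.
Proof. by rewrite /left_deriv -lock. Qed.

Lemma epoly_ind (P : epoly -> Prop) :
  (forall c, P (epolyC c)) -> (forall a j, P (gen_mx a j)) ->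
  (forall p q, P p -> P q -> P (p + q)) -> (forall p q, P p -> P q -> P (p * q)) ->
  forall p, P p.
Proof.
move=> PC PX PD PM p; elim/mpolyind: p => [|c m p _ _ Pp]; first by rewrite -(mpolyC0 _ C); exact: PC.
apply: (PD (c *: 'X_[m] : {mpoly C[M * M]})) => //.
rewrite -mul_mpolyC; apply: (PM (c%:MP) ('X_[m])); first exact: PC.
rewrite mpolyXE_id; apply: (@big_ind epoly P 1 *%R).
- by rewrite -(mpolyC1 _ C); exact: PC.
- exact: PM.
move=> i _; elim: (m i) => [|e IH]; first by rewrite expr0 -(mpolyC1 _ C); exact: PC.
rewrite exprS; apply: PM => //.
by case/mxvec_indexP: i {IH} => a j; have := PX a j; rewrite mxE.
Qed.

Lemma epoly_evalD U p q : epoly_eval U (p + q) = epoly_eval U p + epoly_eval U q.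
Proof. by rewrite /epoly_eval -lock; exact: mevalD. Qed.
Lemma epoly_evalM U p q : epoly_eval U (p * q) = epoly_eval U p * epoly_eval U q.
Proof. by rewrite /epoly_eval -lock; exact: mevalM. Qed.
Lemma epoly_evalC U c : epoly_eval U (epolyC c) = c.
Proof. by rewrite /epoly_eval -lock; exact: mevalC. Qed.
Lemma epoly_eval0 U : epoly_eval U 0 = 0.
Proof. by rewrite /epoly_eval -lock; exact: meval0. Qed.
Lemma epoly_eval1 U : epoly_eval U 1 = 1.
Proof. by rewrite /epoly_eval -lock; exact: meval1. Qed.
Lemma epoly_evalX U a j : epoly_eval U (gen_mx a j) = U a j.
Proof. by rewrite /epoly_eval -lock mxE mevalXU mxvecE. Qed.
Lemma epoly_eval_sum U (I : Type) (r : seq I) (P : pred I) (F : I -> epoly) :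
  epoly_eval U (\sum_(i <- r | P i) F i) = \sum_(i <- r | P i) epoly_eval U (F i).
Proof. exact: (big_morph (epoly_eval U) (@epoly_evalD U) (epoly_eval0 U)). Qed.

Lemma epoly_eval_zmod U : zmod_morphism (epoly_eval U).
Proof. by move=> p q; rewrite /epoly_eval -lock; exact: mevalB. Qed.
Lemma epoly_eval_monoid U : monoid_morphism (epoly_eval U).
Proof. by split; [exact: epoly_eval1|exact: epoly_evalM]. Qed.

HB.instance Definition _ U := GRing.isZmodMorphism.Build epoly C (epoly_eval U) (epoly_eval_zmod U).
HB.instance Definition _ U := GRing.isMonoidMorphism.Build epoly C (epoly_eval U) (epoly_eval_monoid U).

Lemma partial_derivation a j : derivation (partial a j).
Proof. by split=> x y; rewrite /partial -lock; [exact: mderivD|exact: mderivM]. Qed.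

Lemma partialC a j c : partial a j (epolyC c) = 0.
Proof. by rewrite /partial -lock; exact: mderivC. Qed.

Lemma partialX a j b l : partial a j (gen_mx b l) = ((a == b) && (j == l))%:R.
Proof.
have E : (mxvec_index b l == mxvec_index a j) = (a == b) && (j == l).
  by rewrite /mxvec_index (inj_eq (@cast_ord_inj _ _ _)) (inj_eq enum_rank_inj) xpair_eqE eq_sym [l == j]eq_sym.
rewrite /partial -lock mxE mderivX mnm1E E; case: (boolP (_ && _)) => h; last by rewrite scale0r.
have /eqP -> : mxvec_index b l == mxvec_index a j by rewrite E.
rewrite scale1r -[RHS](mpolyX0 _ C); congr ('X_[_]); apply/mnmP => i.
by rewrite mnmBE subnn mnm0E.
Qed.

Lemma sum_derivation (A : comNzRingType) (I : finType) (d : I -> A -> A) (w : I -> A) :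
  (forall i, derivation (d i)) -> derivation (fun p => \sum_i w i * d i p).
Proof.
move=> dP; split=> x y.
  by rewrite -big_split; apply: eq_bigr => i _; rewrite (dP i).1 mulrDr.
rewrite mulr_suml mulr_sumr -big_split; apply: eq_bigr => i _.
by rewrite (dP i).2 /=; ring.
Qed.

Lemma left_deriv_derivation X : derivation (left_deriv X).
Proof.
split=> x y; rewrite !left_derivE.
  rewrite -big_split; apply: eq_bigr => a _; rewrite -big_split; apply: eq_bigr => j _.
  by rewrite (partial_derivation a j).1 mulrDr.
rewrite mulr_suml mulr_sumr -big_split; apply: eq_bigr => a _.
rewrite /= mulr_suml mulr_sumr -big_split; apply: eq_bigr => j _.
by rewrite (partial_derivation a j).2 /=; ring.
Qed.

Lemma left_derivC X c : left_deriv X (epolyC c) = 0.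
Proof. by rewrite left_derivE big1 // => a _; rewrite big1 // => j _; rewrite partialC mulr0. Qed.

Lemma left_derivX X b l : left_deriv X (gen_mx b l) = (map_mx epolyC X *m gen_mx) b l.
Proof.
rewrite left_derivE (bigD1 b) //= [X in _ + X]big1 ?addr0 => [|a ab]; last first.
  by rewrite big1 // => j _; rewrite partialX (negbTE ab) mulr0.
rewrite (bigD1 l) //= big1 ?addr0 => [|j jl]; first by rewrite partialX !eqxx mulr1.
by rewrite partialX (negbTE jl) andbF mulr0.
Qed.

Lemma map_epolyC_delta a b : map_mx epolyC (delta_mx a b) = delta_mx a b :> 'M[epoly]_M.
Proof.
apply/matrixP => i j; rewrite !mxE.
by case: (_ && _); [exact: mpolyC1|exact: mpolyC0].
Qed.

Lemma delta_mul_entry (a b c j : 'I_M) : (delta_mx a b *m gen_mx) c j = (c == a)%:R * gen_mx b j.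
Proof.
rewrite mxE (bigD1 b) //= big1 ?addr0 => [|i ib]; first by rewrite [delta_mx _ _ _ _]mxE eqxx andbT.
by rewrite [delta_mx _ _ _ _]mxE (negbTE ib) andbF mul0r.
Qed.

Lemma left_deriv_delta a b p :
  left_deriv (delta_mx a b) p = \sum_j gen_mx b j * partial a j p.
Proof.
rewrite left_derivE map_epolyC_delta.
have E := delta_mul_entry a b.
rewrite (bigD1 a) //= [X in _ + X]big1 ?addr0 => [|c ca]; last first.
  by rewrite big1 // => j _; rewrite E (negbTE ca) !mul0r.
by apply: eq_bigr => j _; rewrite E eqxx mul1r.
Qed.

Lemma left_deriv_eval_lin U X p : epoly_eval U (left_deriv X p) =
  \sum_a \sum_j (X *m U) a j * epoly_eval U (partial a j p).
Proof.
rewrite left_derivE epoly_eval_sum; apply: eq_bigr => a _.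
rewrite epoly_eval_sum; apply: eq_bigr => j _.
rewrite epoly_evalM; congr (_ * _); rewrite !mxE epoly_eval_sum.
by apply: eq_bigr => b _; rewrite epoly_evalM mxE epoly_evalC epoly_evalX.
Qed.

Lemma left_deriv_evalD U X Y p : epoly_eval U (left_deriv (X + Y) p) =
  epoly_eval U (left_deriv X p) + epoly_eval U (left_deriv Y p).
Proof.
apply: etrans (left_deriv_eval_lin U (X + Y) p) _; apply/esym.
apply: etrans (congr2 +%R (left_deriv_eval_lin U X p) (left_deriv_eval_lin U Y p)) _.
rewrite -big_split; apply: eq_bigr => a _ /=.
by rewrite -big_split; apply: eq_bigr => j _ /=; apply/esym; rewrite mulmxDl mxE mulrDl.
Qed.

Lemma left_deriv_evalZ U c X p : epoly_eval U (left_deriv (c *: X) p) =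
  c * epoly_eval U (left_deriv X p).
Proof.
apply: etrans (left_deriv_eval_lin U (c *: X) p) _; apply/esym.
apply: etrans (congr1 ( *%R c) (left_deriv_eval_lin U X p)) _.
rewrite mulr_sumr; apply: eq_bigr => a _ /=.
by rewrite mulr_sumr; apply: eq_bigr => j _ /=; apply/esym; rewrite -scalemxAl mxE mulrA.
Qed.

(* With [h = 1/2], [w w' = 1] and [w' = w^*] this is the orthogonal projection on
   the line spanned by [e_a + w e_b]. *)
Definition line_proj (h w w' : C) (a b : 'I_M) : 'M[C]_M :=
  h *: (delta_mx a a + delta_mx b b + (w' *: delta_mx a b + w *: delta_mx b a)).

Lemma line_proj_idem h w w' a b : a != b -> h + h = 1 -> w * w' = 1 ->
  line_proj h w w' a b *m line_proj h w w' a b = line_proj h w w' a b.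
Proof.
move=> ab hh ww; have ba : b != a by rewrite eq_sym.
rewrite /line_proj; set Y := (X in h *: X).
have YY : Y *m Y = Y + Y.
  rewrite /Y !(mulmxDl, mulmxDr) -!scalemxAl -!scalemxAr.
  rewrite !mul_delta_mx_cond !eqxx (negbTE ab) (negbTE ba) !mulr1n !mulr0n !scaler0 !addr0 !add0r.
  rewrite !scalerA [w' * w]mulrC ww !scale1r.
  move: (delta_mx a a) (delta_mx b b) (w' *: _) (w *: _) => x y z t.
  by apply/matrixP => i j; rewrite !mxE; ring.
rewrite -scalemxAl -scalemxAr YY scalerA scalerDr -scalerDl; congr (_ *: _).
by rewrite -mulrDr hh mulr1.
Qed.

Lemma line_proj_eval U h w w' a b p : epoly_eval U (left_deriv (line_proj h w w' a b) p) =
  h * (epoly_eval U (left_deriv (delta_mx a a) p) + epoly_eval U (left_deriv (delta_mx b b) p)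
   + (w' * epoly_eval U (left_deriv (delta_mx a b) p)
      + w * epoly_eval U (left_deriv (delta_mx b a) p))).
Proof.
apply: etrans (left_deriv_evalZ _ _ _ _) _; congr (_ * _).
apply: etrans (left_deriv_evalD _ _ _ _) _; congr (_ + _); first exact: left_deriv_evalD.
by apply: etrans (left_deriv_evalD _ _ _ _) _; congr (_ + _); exact: left_deriv_evalZ.
Qed.

End EntryPolynomials.

Section BlockDerivations.
Variables (C : comNzRingType) (N L : nat).
Local Notation A := (epoly C (N + L)).
Local Notation W := (gen_mx C (N + L)).

Definition gen_block : 'M[A]_N := @ulsubmx _ N L N L W.

Definition block_left (a b : 'I_N) : A -> A :=
  @left_deriv C (N + L) (delta_mx (lshift L a) (lshift L b)).
Definition block_transl (p : A) : A :=
  \sum_(a < N) 1 * @partial C (N + L) (lshift L a) (lshift L a) p.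
(** The vector field [U |-> U Pi U], with [Pi] the projection on the first [N] coordinates; its
    upper-left block is [T^2]. The index [b] runs over all rows because [gram_partial] contracts
    full columns of [U]. *)
Definition block_sqr (p : A) : A :=
  \sum_(a < N) \sum_(b < N + L) W b (lshift L a) * @left_deriv C (N + L) (delta_mx b (lshift L a)) p.

Lemma block_left_derivation a b : derivation (block_left a b).
Proof. exact: left_deriv_derivation. Qed.

Lemma block_transl_derivation : derivation block_transl.
Proof. by apply: (sum_derivation (fun=> 1)) => a; exact: partial_derivation. Qed.

Lemma block_sqr_derivation : derivation block_sqr.
Proof.
split=> x y; rewrite /block_sqr.
  rewrite -big_split; apply: eq_bigr => a _; rewrite -big_split; apply: eq_bigr => j _.
  by rewrite (left_deriv_derivation _).1 mulrDr.
rewrite mulr_suml mulr_sumr -big_split; apply: eq_bigr => a _.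
rewrite /= mulr_suml mulr_sumr -big_split; apply: eq_bigr => j _.
by rewrite (left_deriv_derivation _).2 /=; ring.
Qed.

Lemma delta_mul_gen (a b c j : 'I_(N + L)) :
  (map_mx (@epolyC C (N + L)) (delta_mx a b) *m W) c j = (c == a)%:R * W b j.
Proof. by rewrite map_epolyC_delta delta_mul_entry. Qed.

Lemma map_block_left a b : map_mx (block_left a b) gen_block = delta_mx a b *m gen_block.
Proof.
apply/matrixP => c j; rewrite [LHS]mxE /gen_block /block_left [ulsubmx _ _ _]mxE [usubmx _ _ _]mxE.
rewrite left_derivX delta_mul_gen [RHS]mxE (bigD1 b) //= big1 ?addr0 => [|i ib].
  rewrite [delta_mx _ _ _ _]mxE eqxx andbT (inj_eq (@lshift_inj _ _)); congr (_ * _).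
  by rewrite [ulsubmx _ _ _]mxE [usubmx _ _ _]mxE.
by rewrite [delta_mx _ _ _ _]mxE (negbTE ib) andbF mul0r.
Qed.

Lemma map_block_transl : map_mx block_transl gen_block = 1%:M.
Proof.
apply/matrixP => c j; rewrite [LHS]mxE [gen_block _ _]mxE [usubmx _ _ _]mxE /block_transl.
under eq_bigr do rewrite mul1r partialX !(inj_eq (@lshift_inj _ _)).
rewrite mxE; have [<-|cj] := eqVneq c j.
  rewrite (bigD1 c) //= big1 ?addr0 ?eqxx // => a ac; by rewrite (negbTE ac).
rewrite big1 // => a _; have [->|//] := eqVneq a c; by rewrite (negbTE cj).
Qed.

Lemma map_block_sqr : map_mx block_sqr gen_block = gen_block *m gen_block.
Proof.
apply/matrixP => c j; rewrite [LHS]mxE [gen_block _ _]mxE [usubmx _ _ _]mxE /block_sqr.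
rewrite [RHS]mxE; apply: eq_bigr => a _.
rewrite (bigD1 (lshift L c)) //= big1 ?addr0 => [|b bc].
  by rewrite left_derivX delta_mul_gen eqxx mul1r /gen_block !mxE.
by rewrite left_derivX delta_mul_gen eq_sym (negbTE bc) mul0r mulr0.
Qed.

End BlockDerivations.

From mathcomp Require Import complex.
From mathcomp Require Import all_classical all_reals all_analysis.
From mathcomp Require Import measurable_realfun.
Import Order.TTheory GRing.Theory Num.Theory.
Import numFieldNormedType.Exports.
Local Open Scope ring_scope.
Local Open Scope classical_set_scope.

(** * Expectations under the Haar measure *)

Section ComplexNorm.
Variable R : realType.
Implicit Types z w : R[i].

Lemma normc_cmod z : `|z| = (cmod z)%:C%C.
Proof. exact: normc_def. Qed.

Lemma cReD z w : complex.Re (z + w) = complex.Re z + complex.Re w.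
Proof. by case: z w => [a b] [c d]. Qed.
Lemma cImD z w : complex.Im (z + w) = complex.Im z + complex.Im w.
Proof. by case: z w => [a b] [c d]. Qed.
Lemma cReM z w : complex.Re (z * w) =
  complex.Re z * complex.Re w - complex.Im z * complex.Im w.
Proof. by case: z w => [a b] [c d]. Qed.
Lemma cImM z w : complex.Im (z * w) =
  complex.Re z * complex.Im w + complex.Im z * complex.Re w.
Proof. by case: z w => [a b] [c d]. Qed.
Lemma cRe_conj z : complex.Re (z^*) = complex.Re z.
Proof. by case: z. Qed.
Lemma cIm_conj z : complex.Im (z^*) = - complex.Im z.
Proof. by case: z. Qed.

Lemma normc_Re_le z (K : R) : `|z| <= K%:C%C -> `|complex.Re z| <= K.
Proof. by move=> h; rewrite -lecR (le_trans (normc_ge_Re z)). Qed.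

Lemma normc_Im_le z (K : R) : `|z| <= K%:C%C -> `|complex.Im z| <= K.
Proof.
move=> h; have := @normc_Re_le (z * (- 'i%C)) K.
rewrite mulrN normrN normrM.
have -> : `|'i%C : R[i]| = 1 by rewrite normc_def /= expr0n expr1n add0r sqrtr1.
rewrite mulr1 => /(_ h); case: z {h} => a b /=.
by rewrite mulr0 mulr1 sub0r opprK.
Qed.

Lemma normc_le_ReIm (x y K : R) : `|x| <= K -> `|y| <= K -> `|(x +i* y)%C| <= (K + K)%:C%C.
Proof.
move=> hx hy; have -> : (x +i* y)%C = x%:C%C + 'i%C * y%:C%C by rewrite [LHS]complexE.
rewrite (le_trans (ler_normD _ _)) // rmorphD lerD //.
  by rewrite normc_def /= expr0n addr0 sqrtr_sqr lecR.
rewrite normrM.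
have -> : `|'i%C : R[i]| = 1 by rewrite normc_def /= expr0n expr1n add0r sqrtr1.
by rewrite mul1r normc_def /= expr0n addr0 sqrtr_sqr lecR.
Qed.

Lemma complex_bound (K : R[i]) (T : Type) (P : T -> Prop) (f : T -> R[i]) :
  (forall x, P x -> `|f x| <= K) -> exists K' : R, forall x, P x -> `|f x| <= K'%:C%C.
Proof.
move=> h; exists (cmod K) => x Px; rewrite -normc_cmod (le_trans (h _ Px)) //.
have K0 : 0 <= K := le_trans (normr_ge0 _) (h _ Px).
by rewrite ger0_norm.
Qed.

End ComplexNorm.

Section MeasurableComplex.
Context d (T : measurableType d) (R : realType).
Implicit Types (f g : T -> R[i]).

Definition cmeasurable f : Prop :=
  measurable_fun [set: T] (fun x => complex.Re (f x)) /\
  measurable_fun [set: T] (fun x => complex.Im (f x)).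

Lemma cmeasurable_cst c : cmeasurable (fun=> c).
Proof. by split; exact: measurable_cst. Qed.

Lemma cmeasurableD f g : cmeasurable f -> cmeasurable g -> cmeasurable (fun x => f x + g x).
Proof.
move=> [fr fi] [gr gi]; split.
  by under eq_fun do rewrite cReD; exact: measurable_funD.
by under eq_fun do rewrite cImD; exact: measurable_funD.
Qed.

Lemma cmeasurableM f g : cmeasurable f -> cmeasurable g -> cmeasurable (fun x => f x * g x).
Proof.
move=> [fr fi] [gr gi]; split.
  under eq_fun do rewrite cReM.
  by apply: measurable_funB; apply: measurable_funM.
under eq_fun do rewrite cImM.
by apply: measurable_funD; apply: measurable_funM.
Qed.

Lemma cmeasurable_conj f : cmeasurable f -> cmeasurable (fun x => (f x)^*).
Proof.
move=> [fr fi]; split; first by under eq_fun do rewrite cRe_conj.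
by under eq_fun do rewrite cIm_conj; exact: measurableT_comp.
Qed.

Lemma cmeasurable_sum (I : finType) (F : I -> T -> R[i]) :
  (forall i, cmeasurable (F i)) -> cmeasurable (fun x => \sum_i F i x).
Proof.
move=> mF; elim: (index_enum I) => [|i r IH].
  by under eq_fun do rewrite big_nil; exact: cmeasurable_cst.
by under eq_fun do rewrite big_cons; exact: cmeasurableD.
Qed.

End MeasurableComplex.

Section NiceFunctions.
Variables (R : realType) (M : nat).
Local Notation Om := (cmatrix R M).
Local Notation C := R[i].
Implicit Types (f g : Om -> C) (U : Om).

Definition unit_set : set Om := [set U | unitary U].

(** The bound is asked on the unitary matrices, which have full measure and on which every
    polynomial in the entries is bounded. *)
Definition nice f : Prop :=
  cmeasurable f /\ exists K : C, forall U, unitary U -> `|f U| <= K.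

Definition coords (U : Om) : (M * M).-tuple (R * R)%type := mx_coords U.

Lemma measurable_mx_coords : measurable_fun [set: Om] coords.
Proof. by move=> _ B mB; rewrite setTI; exists B => //; rewrite setTI. Qed.

Lemma cmeasurable_entry (a j : 'I_M) : cmeasurable (fun U : Om => U a j).
Proof.
have mc := (measurable_fun_tnthP coords).1 measurable_mx_coords (mxvec_index a j).
split.
  have -> : (fun U : Om => complex.Re (U a j)) =
            fst \o ((@tnth _ _ ^~ (mxvec_index a j)) \o coords).
    by apply/funext => U /=; rewrite tnth_mktuple mxvecE.
  exact: measurableT_comp.
have -> : (fun U : Om => complex.Im (U a j)) =
          snd \o ((@tnth _ _ ^~ (mxvec_index a j)) \o coords).
  by apply/funext => U /=; rewrite tnth_mktuple mxvecE.
exact: measurableT_comp.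
Qed.

Lemma measurable_cmatrix_fun (F : Om -> Om) :
  (forall a j, cmeasurable (fun U => F U a j)) -> measurable_fun [set: Om] F.
Proof.
move=> h; have mF : measurable_fun [set: Om] (coords \o F).
  apply/measurable_fun_tnthP => i; case/mxvec_indexP: i => a j.
  have [hr hi] := h a j.
  have -> : (@tnth _ _ ^~ (mxvec_index a j)) \o (coords \o F) =
    (fun U => (complex.Re (F U a j), complex.Im (F U a j))).
    by apply/funext => U /=; rewrite tnth_mktuple mxvecE.
  exact: measurable_fun_pair.
move=> _ B [B' mB' <-]; rewrite !setTI.
by rewrite -comp_preimage -[X in measurable X]setTI; apply: mF.
Qed.

Lemma measurable_left_mul (V : 'M[C]_M) : measurable_fun [set: Om] (fun U : Om => (V *m U : Om)).
Proof.
apply: measurable_cmatrix_fun => a j.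
under eq_fun do rewrite mxE.
apply: cmeasurable_sum => i; apply: cmeasurableM; first exact: cmeasurable_cst.
exact: cmeasurable_entry.
Qed.

Lemma measurable_unit_set : measurable unit_set.
Proof.
pose e (a b : 'I_M) (U : Om) : C := (U *m adjmx U) a b - (a == b)%:R.
have me a b : cmeasurable (e a b).
  apply: cmeasurableD; last exact: cmeasurable_cst.
  under eq_fun do rewrite mxE.
  apply: cmeasurable_sum => i; apply: cmeasurableM; first exact: cmeasurable_entry.
  under eq_fun do rewrite !mxE.
  exact/cmeasurable_conj/cmeasurable_entry.
have -> : unit_set = \big[setI/setT]_(a < M) \big[setI/setT]_(b < M)
   ((fun U => complex.Re (e a b U)) @^-1` [set 0] `&` (fun U => complex.Im (e a b U)) @^-1` [set 0]).
  apply/seteqP; split => U.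
    move=> uU; rewrite -bigcap_seq => a _; rewrite -bigcap_seq => b _ /=.
    by rewrite /e uU mxE subrr.
  rewrite -bigcap_seq => h; apply/matrixP => a b.
  have := h a; rewrite /= mem_index_enum => /(_ isT).
  rewrite -bigcap_seq => /(_ b) /=; rewrite mem_index_enum => /(_ isT) [hr hi].
  rewrite [RHS]mxE; apply/eqP; rewrite -subr_eq0 -/(e a b U).
  by rewrite [e a b U]complexE hr hi mulr0 addr0.
apply: bigsetI_measurable => a _; apply: bigsetI_measurable => b _.
have [mr mi] := me a b.
by apply: measurableI; rewrite -[X in measurable X]setTI; [apply: mr|apply: mi].
Qed.

Lemma nice_cst (c : C) : nice (fun=> c).
Proof. by split; [exact: cmeasurable_cst|exists `|c|]. Qed.

Lemma niceD f g : nice f -> nice g -> nice (fun U => f U + g U).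
Proof.
move=> [mf [K hK]] [mg [K' hK']]; split; first exact: cmeasurableD.
by exists (K + K') => U uU; rewrite (le_trans (ler_normD _ _)) // lerD ?hK ?hK'.
Qed.

Lemma niceM f g : nice f -> nice g -> nice (fun U => f U * g U).
Proof.
move=> [mf [K hK]] [mg [K' hK']]; split; first exact: cmeasurableM.
by exists (K * K') => U uU; rewrite normrM ler_pM ?hK ?hK'.
Qed.

Lemma niceZ (c : C) f : nice f -> nice (fun U => c * f U).
Proof. by move=> nf; apply: niceM => //; exact: nice_cst. Qed.

Lemma niceB f g : nice f -> nice g -> nice (fun U => f U - g U).
Proof.
move=> nf ng; have := niceD nf (niceZ (-1) ng).
by under eq_fun do rewrite mulN1r.
Qed.

Lemma nice_conj f : nice f -> nice (fun U => (f U)^*).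
Proof.
move=> [mf [K hK]]; split; first exact: cmeasurable_conj.
by exists K => U uU; rewrite norm_conjC hK.
Qed.

Lemma unitary_entry_le U a j : unitary U -> `|U a j| <= 1.
Proof.
move=> uU; have := congr1 (fun X : 'M[C]_M => X a a) uU.
rewrite !mxE eqxx mulr1n (bigD1 j) //= !mxE -normCK => e.
rewrite -(@expr_le1 _ 2) // -e lerDl sumr_ge0 // => i _.
by rewrite !mxE -normCK exprn_ge0.
Qed.

Lemma nice_entry a j : nice (fun U : Om => U a j).
Proof.
by split; [exact: cmeasurable_entry|exists 1 => U; exact: unitary_entry_le].
Qed.

Lemma unitary_mul (V U : 'M[C]_M) : unitary V -> unitary U -> unitary (V *m U).
Proof.
move=> uV uU; rewrite /unitary.
have -> : adjmx (V *m U) = adjmx U *m adjmx V by rewrite /adjmx map_mxM trmx_mul.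
by rewrite mulmxA -(mulmxA V) uU mulmx1.
Qed.

Lemma nice_left_mul (V : 'M[C]_M) f : unitary V -> nice f ->
  nice (fun U : Om => f (V *m U)).
Proof.
move=> uV [[fr fi] [K hK]]; split; last by exists K => U uU; apply: hK; exact: unitary_mul.
by split; [apply: (measurableT_comp fr)|apply: (measurableT_comp fi)]; exact: measurable_left_mul.
Qed.

End NiceFunctions.

Section Expectation.
Variables (R : realType) (M : nat) (P : probability (cmatrix R M) R).
Hypothesis hP : haar_unitary P.
Local Notation Om := (cmatrix R M).
Local Notation C := R[i].
Local Notation D := (@unit_set R M).
Implicit Types (f g : Om -> C) (U : Om).

Lemma P_unit_set : P D = 1%E.
Proof. exact: hP.1. Qed.

Definition Ex f : C :=
  (Rintegral P D (fun U => complex.Re (f U)) +i* Rintegral P D (fun U => complex.Im (f U)))%C.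

Lemma bounded_integrable (h : Om -> R) (K : R) :
  measurable_fun [set: Om] h -> (forall U, unitary U -> `|h U| <= K) ->
  P.-integrable D (EFin \o h).
Proof.
move=> mh hK; apply: measurable_bounded_integrable.
- exact: measurable_unit_set.
- by rewrite (le_lt_trans (probability_le1 P (measurable_unit_set R M))) ?ltry.
- exact: measurable_funTS.
exists K; split; first exact: num_real.
by move=> x Kx U DU; exact: le_trans (hK U DU) (ltW Kx).
Qed.

Lemma nice_integrable f : nice f ->
  P.-integrable D (EFin \o (fun U => complex.Re (f U))) /\
  P.-integrable D (EFin \o (fun U => complex.Im (f U))).
Proof.
move=> [[mr mi] [K /complex_bound [K' hK]]]; split.
  by apply: (@bounded_integrable _ K') => // U uU; apply: normc_Re_le; exact: hK.
by apply: (@bounded_integrable _ K') => // U uU; apply: normc_Im_le; exact: hK.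
Qed.

Lemma eq_Ex f g : (forall U, unitary U -> f U = g U) -> Ex f = Ex g.
Proof.
move=> e; rewrite /Ex; congr (_ +i* _)%C; apply: eq_Rintegral => U;
by rewrite inE => /e ->.
Qed.

Lemma ExD f g : nice f -> nice g -> Ex (fun U => f U + g U) = Ex f + Ex g.
Proof.
move=> /nice_integrable[fr fi] /nice_integrable[gr gi].
rewrite /Ex; under eq_Rintegral do rewrite cReD.
under [X in (_ +i* X)%C]eq_Rintegral do rewrite cImD.
by rewrite !RintegralD //; exact: measurable_unit_set.
Qed.

Lemma ExZ (c : C) f : nice f -> Ex (fun U => c * f U) = c * Ex f.
Proof.
move=> /nice_integrable[fr fi]; have mD := @measurable_unit_set R M.
have iZ (h : Om -> R) (a : R) : P.-integrable D (EFin \o h) ->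
    P.-integrable D (EFin \o (fun U => a * h U)).
  by move=> ih; under [_ \o _]eq_fun do rewrite /= EFinM; exact: integrableZl.
rewrite [LHS]/Ex.
under eq_Rintegral do rewrite cReM.
under [X in (_ +i* X)%C]eq_Rintegral do rewrite cImM.
rewrite RintegralB ?RintegralD ?RintegralZl //; try exact: iZ.
by case: c.
Qed.

Lemma Rintegral_unit_cst (r : R) : Rintegral P D (fun=> r) = r.
Proof.
rewrite Rintegral_cst; last exact: measurable_unit_set.
rewrite -[RHS]mulr1; congr (_ * _); rewrite -[RHS]/(fine 1%E); congr fine.
exact: P_unit_set.
Qed.

Lemma Ex_cst (c : C) : Ex (fun=> c) = c.
Proof. by rewrite /Ex !Rintegral_unit_cst; case: c. Qed.

Lemma ExB f g : nice f -> nice g -> Ex (fun U => f U - g U) = Ex f - Ex g.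
Proof.
move=> nf ng; rewrite -[- Ex g]mulN1r -ExZ // -ExD //; last exact: niceZ.
by apply: eq_Ex => U _; rewrite mulN1r.
Qed.

Lemma Ex_sum (I : finType) (F : I -> Om -> C) : (forall i, nice (F i)) ->
  Ex (fun U => \sum_i F i U) = \sum_i Ex (F i).
Proof.
move=> nF; suff H : forall r : seq I, nice (fun U => \sum_(i <- r) F i U) /\
    Ex (fun U => \sum_(i <- r) F i U) = \sum_(i <- r) Ex (F i) by have [_ ->] := H (index_enum I).
elim=> [|i r [IHn IH]].
  split; first by under eq_fun do rewrite big_nil; exact: nice_cst.
  by under eq_Ex do rewrite big_nil; rewrite Ex_cst big_nil.
split; first by under eq_fun do rewrite big_cons; exact: niceD.
by under eq_Ex do rewrite big_cons; rewrite ExD // IH big_cons.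
Qed.

(** Real and imaginary parts are bounded separately; the lost factor 2 is harmless in the limit
    taken in [gram_rot_deriv]. *)
Lemma Ex_bound f (K : R) : nice f -> (forall U, unitary U -> `|f U| <= K%:C%C) ->
  `|Ex f| <= (K + K)%:C%C.
Proof.
move=> nf hK; have [ir ii] := nice_integrable nf.
have mD := @measurable_unit_set R M.
have [[mr mi] _] := nf.
have B (h : Om -> R) : measurable_fun [set: Om] h -> (forall U, unitary U -> `|h U| <= K) ->
   `|Rintegral P D h| <= K.
  move=> mh hh; have ih := bounded_integrable mh hh.
  rewrite (le_trans (le_normr_Rintegral mD ih)) //.
  rewrite -[leRHS]Rintegral_unit_cst.
  apply: le_Rintegral => //.
    exact: (integrable_norm ih).
  by apply: (@bounded_integrable _ `|K|) => //; exact: measurable_cst.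
apply: normc_le_ReIm; apply: B => // U uU; [apply: normc_Re_le|apply: normc_Im_le]; exact: hK.
Qed.

Lemma unitary_adj (V : 'M[C]_M) : unitary V -> adjmx V *m V = 1%:M.
Proof. exact: mulmx1C. Qed.

Lemma unitary_mulE (V U : 'M[C]_M) : unitary V -> unitary (V *m U) -> unitary U.
Proof.
move=> uV uVU.
have uV' : unitary (adjmx V).
  rewrite /unitary; have -> : adjmx (adjmx V) = V; last exact: unitary_adj.
  by apply/matrixP => i j; rewrite !mxE conjCK.
by have := unitary_mul uV' uVU; rewrite mulmxA unitary_adj // mul1mx.
Qed.

Lemma Rintegral_left_mul (V : 'M[C]_M) (h : Om -> R) (K : R) : unitary V ->
  measurable_fun [set: Om] h -> (forall U, unitary U -> `|h U| <= K) ->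
  Rintegral P D (fun U => h (V *m U)) = Rintegral P D h.
Proof.
move=> uV mh hK; pose phi (U : Om) : Om := V *m U.
have mphi : measurable_fun [set: Om] phi by exact: measurable_left_mul.
have mD := @measurable_unit_set R M.
have phiD : phi @^-1` D = D.
  by apply/seteqP; split => U /=; [exact: unitary_mulE|exact: unitary_mul].
rewrite /Rintegral; congr fine.
have := @integral_pushforward _ _ _ _ _ phi mphi P D (EFin \o h).
rewrite phiD => <- //.
- apply: eq_measure_integral => A mA _; exact: (hP.2 V uV A mA).
- exact/measurable_EFinP.
apply: (@bounded_integrable _ K); first exact: measurableT_comp.
by move=> U uU; apply: hK; exact: unitary_mul.
Qed.

Lemma Ex_left_mul (V : 'M[C]_M) f : unitary V -> nice f ->
  Ex (fun U => f (V *m U)) = Ex f.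
Proof.
move=> uV [[mr mi] [K /complex_bound [K' hK]]]; rewrite /Ex; congr (_ +i* _)%C.
  apply: (@Rintegral_left_mul V (fun U => complex.Re (f U)) K') => // U uU.
  by apply: normc_Re_le; exact: hK.
apply: (@Rintegral_left_mul V (fun U => complex.Im (f U)) K') => // U uU.
by apply: normc_Im_le; exact: hK.
Qed.

End Expectation.

(** * Infinitesimal invariance and adjoint derivations *)

Section LeftInvariance.
Variables (R : realType) (M : nat) (P : probability (cmatrix R M) R).
Hypothesis hP : haar_unitary P.
Local Notation Om := (cmatrix R M).
Local Notation C := (R[i] : comNzRingType).
Local Notation A := (epoly C M).
Local Notation ev := (@epoly_eval C M).
Implicit Types (p q : A).

Lemma nice_epoly p : nice (fun U : Om => ev U p).
Proof.
elim/epoly_ind: p => [c|a j|p q np nq|p q np nq].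
- by under eq_fun do rewrite epoly_evalC; exact: nice_cst.
- by under eq_fun do rewrite epoly_evalX; exact: nice_entry.
- by under eq_fun do rewrite epoly_evalD; exact: niceD.
by under eq_fun do rewrite epoly_evalM; exact: niceM.
Qed.

Definition gram (p q : A) : R[i] := Ex P (fun U => ev U p * (ev U q)^*).

Lemma nice_gram p q : nice (fun U : Om => ev U p * (ev U q)^*).
Proof. by apply: niceM; [|apply: nice_conj]; exact: nice_epoly. Qed.

Lemma unitary1 : unitary (1%:M : 'M[R[i]]_M).
Proof.
rewrite /unitary mul1mx; apply/matrixP => i j; rewrite !mxE eq_sym.
by rewrite conjC_nat.
Qed.

Lemma Ex_boundC (f : Om -> R[i]) (K : R[i]) : nice f ->
  (forall U, unitary U -> `|f U| <= K) -> `|Ex P f| <= K + K.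
Proof.
move=> nf hK; have K0 : 0 <= K := le_trans (normr_ge0 _) (hK _ unitary1).
have KE : K = (complex.Re K)%:C%C by rewrite RRe_real // ger0_real.
rewrite KE -rmorphD; apply: Ex_bound => //; by rewrite -KE.
Qed.

Lemma ler_norm4 (a b c d x y z w : R[i]) : `|a| <= x -> `|b| <= y -> `|c| <= z -> `|d| <= w ->
  `|a + b + c + d| <= x + y + z + w.
Proof.
move=> ha hb hc hd; apply: le_trans (ler_normD _ _) _; apply: lerD => //.
apply: le_trans (ler_normD _ _) _; apply: lerD => //.
by apply: le_trans (ler_normD _ _) _; apply: lerD.
Qed.

Lemma sum_remainder (e X Y a b a' b' : R[i]) :
  X - a - e * a' + (Y - b - e * b') = X + Y - (a + b) - e * (a' + b').
Proof. ring. Qed.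

Lemma conj_remainder (x y z w : R[i]) : x^* - y^* - z^* * w^* = (x - y - z * w)^*.
Proof. by rewrite !rmorphB rmorphM. Qed.

(** First-order product rule with quadratic remainder. [f] is [e] or its conjugate, so the estimate
    serves both a product of polynomials and a product with a conjugate. *)
Lemma mul_taylor_bound (e f X Y a b a' b' K K' Ka Kb Ka' Kb' : R[i]) :
  `|e| <= 2 -> `|f| = `|e| ->
  `|X - a - e * a'| <= K * `|e| ^+ 2 -> `|Y - b - f * b'| <= K' * `|e| ^+ 2 ->
  `|a| <= Ka -> `|Y| <= Kb -> `|a'| <= Ka' -> `|b'| <= Kb' ->
  `|X * Y - a * b - e * (a' * b) - f * (a * b')| <=
  (K * Kb + Ka * K' + Ka' * Kb' + 2 * Ka' * K') * `|e| ^+ 2.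
Proof.
move=> e2 fe hr hs ha hY ha' hb'.
have -> : X * Y - a * b - e * (a' * b) - f * (a * b') =
   (X - a - e * a') * Y + a * (Y - b - f * b') + e * f * (a' * b') +
   e * a' * (Y - b - f * b') by ring.
apply: (@le_trans _ _ (K * `|e| ^+ 2 * Kb + Ka * (K' * `|e| ^+ 2)
   + `|e| ^+ 2 * (Ka' * Kb') + 2 * Ka' * (K' * `|e| ^+ 2))); last first.
  by rewrite le_eqVlt; apply/orP; left; apply/eqP; ring.
apply: ler_norm4.
- by rewrite normrM ler_pM.
- by rewrite normrM ler_pM.
- rewrite normrM [`|e * f|]normrM fe -expr2 ler_pM ?exprn_ge0 // normrM ler_pM //.
by rewrite normrM ler_pM // normrM ler_pM.
Qed.

Section Rotation.
Variable Q : 'M[R[i]]_M.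
Hypothesis QQ : Q *m Q = Q.
Hypothesis Qadj : adjmx Q = Q.

(** Multiplication by [u] on the range of [Q], the identity on its kernel: a unitary group that is
    affine in [u], with no matrix exponential. *)
Definition rot (u : R[i]) : 'M[R[i]]_M := 1%:M + (u - 1) *: Q.

Lemma unitary_rot u : `|u| = 1 -> unitary (rot u).
Proof.
move=> u1; have uu : u * u^* = 1 by rewrite -normCK u1 expr1n.
have adjE : adjmx (rot u) = 1%:M + (u^* - 1) *: Q.
  rewrite /rot -{2}Qadj; apply/matrixP => i j; rewrite !mxE rmorphD rmorphM rmorphB rmorph1 /=.
  by rewrite eq_sym conjC_nat.
rewrite /unitary adjE /rot mulmxDl mul1mx mulmxDr mulmx1 -scalemxAl -scalemxAr QQ.
rewrite scalerA -addrA -!scalerDl.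
have -> : u^* - 1 + (u - 1 + (u - 1) * (u^* - 1)) = 0 by rewrite -[RHS](subrr (u * u^*)) {2}uu; ring.
by rewrite scale0r addr0.
Qed.

(** The bound is uniform in the unitary [U], so it can be integrated. Entries are exactly affine in
    [u]; products use [mul_taylor_bound]. *)
Lemma taylor p : exists K : R[i], forall U u, unitary U -> `|u| = 1 ->
  `|ev (rot u *m U) p - ev U p - (u - 1) * ev U (left_deriv Q p)| <= K * `|u - 1| ^+ 2.
Proof.
elim/epoly_ind: p => [c|a j|p q [K hK] [K' hK']|p q [K hK] [K' hK']].
- exists 0 => U u _ _; rewrite left_derivC epoly_eval0 !epoly_evalC mulr0 subrr subr0 normr0.
  by rewrite mul0r.
- exists 0 => U u _ _; rewrite left_derivX !epoly_evalX.
  have -> : ev U ((map_mx (@epolyC C M) Q *m gen_mx C M) a j) = (Q *m U) a j.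
    rewrite !mxE epoly_eval_sum; apply: eq_bigr => b _.
    by rewrite epoly_evalM mxE epoly_evalC epoly_evalX.
  have E (X Y : 'M[R[i]]_M) : (X + (u - 1) *: Y) a j = X a j + (u - 1) * Y a j by rewrite !mxE.
  rewrite /rot mulmxDl mul1mx -scalemxAl E.
  by rewrite [X in X - _ - _]addrC addrK subrr normr0 mul0r.
- exists (K + K') => U u uU u1; rewrite (left_deriv_derivation _).1 !epoly_evalD [leRHS]mulrDl.
  apply: le_trans (lerD (hK U u uU u1) (hK' U u uU u1)).
  by apply: le_trans (ler_normD _ _); rewrite sum_remainder.
have [_ [Ka hKa]] := nice_epoly p; have [_ [Kb hKb]] := nice_epoly q.
have [_ [Ka' hKa']] := nice_epoly (left_deriv Q p).
have [_ [Kb' hKb']] := nice_epoly (left_deriv Q q).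
exists (K * Kb + Ka * K' + Ka' * Kb' + 2 * Ka' * K') => U u uU u1.
rewrite (left_deriv_derivation _).2 epoly_evalD !epoly_evalM mulrDr opprD addrA.
have e2 : `|u - 1| <= 2 by rewrite (le_trans (ler_normB _ _)) // u1 normr1.
exact: (mul_taylor_bound e2 erefl (hK U u uU u1) (hK' U u uU u1) (hKa _ uU)
  (hKb _ (unitary_mul (unitary_rot u1) uU)) (hKa' _ uU) (hKb' _ uU)).
Qed.

Lemma small_rotation (t : R) : 0 < t ->
  exists u : R[i], [/\ `|u| = 1, u != 1 & `|u - 1| <= (2 * t)%:C%C].
Proof.
(* The witness [w] over its conjugate has modulus 1 without trigonometry, and [u - 1] is [2 i t]
   over the conjugate of [w], where [|w| >= 1]. *)
move=> t0; pose w : R[i] := (1 +i* t)%C.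
have nw : `|w^*| = `|w| by rewrite norm_conjC.
have w1 : 1 <= `|w|.
  rewrite normc_def lecR /= -[leLHS]sqrtr1 ler_wsqrtr // expr1n lerDl sqr_ge0 //.
have w0 : `|w| != 0 by apply: lt0r_neq0; exact: lt_le_trans ltr01 w1.
have wc0 : w^* != 0 by rewrite -normr_eq0 nw.
have d : w - w^* = (0 +i* (2 * t))%C.
  by apply/eqP; rewrite eq_complex /= subrr eqxx /= opprK mulr2n mulrDl mul1r.
have u1 : w / w^* - 1 = (w - w^*) / w^* by rewrite mulrBl mulfV.
exists (w / w^*); split.
- by rewrite normrM normfV nw mulfV.
- rewrite -subr_eq0 u1 mulf_neq0 ?invr_eq0 // d eq_complex /= eqxx /=.
  by rewrite mulf_neq0 // lt0r_neq0.
rewrite u1 d normrM normfV nw ler_pdivrMr ?lt_def ?w0 ?normr_ge0 //.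
have -> : `|(0 +i* (2 * t))%C| = (2 * t)%:C%C.
  by rewrite normc_def /= expr0n add0r sqrtr_sqr ger0_norm // mulr_ge0 // ltW.
by rewrite ler_peMr // lecR mulr_ge0 // ltW.
Qed.

(** By invariance the form does not change when both arguments are rotated, so
    [(u - 1) al + conj (u - 1) be] is [O(|u - 1|^2)]. On the circle
    [conj (u - 1) = - conj u (u - 1)]; dividing by [u - 1] and letting [u] tend to 1 gives
    [al = be]. *)
Lemma gram_rot_deriv p q : gram (left_deriv Q p) q = gram p (left_deriv Q q).
Proof.
have [K hK] := taylor p; have [K' hK'] := taylor q.
have [_ [Ka hKa]] := nice_epoly p; have [_ [Kb hKb]] := nice_epoly q.
have [_ [Ka' hKa']] := nice_epoly (left_deriv Q p).
have [_ [Kb' hKb']] := nice_epoly (left_deriv Q q).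
pose K0 := K * Kb + Ka * K' + Ka' * Kb' + 2 * Ka' * K'.
set al := gram _ _; set be := gram _ _.
have B u : `|u| = 1 -> u != 1 -> `|al - be| <= (K0 + K0 + `|be|) * `|u - 1|.
  move=> u1 une.
  have uu : u * u^* = 1 by rewrite -normCK u1 expr1n.
  have e0 : 0 < `|u - 1| by rewrite normr_gt0 subr_eq0.
  pose rho (U : Om) := ev (rot u *m U) p * (ev (rot u *m U) q)^* - ev U p * (ev U q)^*
     - (u - 1) * (ev U (left_deriv Q p) * (ev U q)^*)
     - (u - 1)^* * (ev U p * (ev U (left_deriv Q q))^*).
  have nVU : nice (fun U : Om => ev (rot u *m U) p * (ev (rot u *m U) q)^*).
    exact: (nice_left_mul (unitary_rot u1) (nice_gram p q)).
  have n1 := niceB nVU (nice_gram p q).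
  have n2 := niceZ (u - 1) (nice_gram (left_deriv Q p) q).
  have n3 := niceZ (u - 1)^* (nice_gram p (left_deriv Q q)).
  have n12 := niceB n1 n2.
  have nrho : nice rho := niceB n12 n3.
  have rhoE : Ex P rho = - ((u - 1) * al) - (u - 1)^* * be.
    rewrite (ExB P n12 n3) (ExB P n1 n2) (ExB P nVU (nice_gram p q)).
    rewrite (Ex_left_mul hP (unitary_rot u1) (nice_gram p q)) subrr sub0r.
    by rewrite (ExZ P (u - 1) (nice_gram (left_deriv Q p) q)) (ExZ P (u - 1)^* (nice_gram p (left_deriv Q q))).
  have rhoB : `|Ex P rho| <= K0 * `|u - 1| ^+ 2 + K0 * `|u - 1| ^+ 2.
    apply: Ex_boundC => // U uU; rewrite /rho.
    have e2 : `|u - 1| <= 2 by rewrite (le_trans (ler_normB _ _)) // u1 normr1.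
    have hc : `|(ev (rot u *m U) q)^* - (ev U q)^* - (u - 1)^* * (ev U (left_deriv Q q))^*| <=
              K' * `|u - 1| ^+ 2.
      by rewrite conj_remainder norm_conjC; exact: hK'.
    have hKc : `|(ev (rot u *m U) q)^*| <= Kb.
      by rewrite norm_conjC; exact: hKb _ (unitary_mul (unitary_rot u1) uU).
    have hKc' : `|(ev U (left_deriv Q q))^*| <= Kb' by rewrite norm_conjC; exact: hKb'.
    exact: (mul_taylor_bound e2 (norm_conjC _) (hK U u uU u1) hc (hKa _ uU) hKc (hKa' _ uU) hKc').
  have ce : (u - 1)^* = - u^* * (u - 1).
    by rewrite rmorphB rmorph1 /= mulrBr mulNr mulrC uu; ring.
  have h1 : `|al - u^* * be| <= (K0 + K0) * `|u - 1|.
    rewrite -(ler_pM2r e0) -mulrA -expr2 mulrDl -normrM.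
    rewrite (le_trans _ rhoB) // rhoE ce -normrN le_eqVlt; apply/orP; left; apply/eqP.
    by congr `|_|; ring.
  have -> : al - be = (al - u^* * be) + (u - 1)^* * be by rewrite rmorphB rmorph1 /=; ring.
  rewrite (le_trans (ler_normD _ _)) // [leRHS]mulrDl lerD //.
  by rewrite normrM norm_conjC mulrC.
apply/eqP; rewrite -subr_eq0 -normr_eq0; apply: contraT => ne.
have d0 : 0 < `|al - be| by rewrite lt_def ne normr_ge0.
have c0 : 0 <= K0 + K0 + `|be|.
  have [u [u1 une _]] := small_rotation ltr01.
  have e0 : 0 < `|u - 1| by rewrite normr_gt0 subr_eq0.
  by rewrite -(pmulr_lge0 _ e0) (le_trans _ (B u u1 une)).
pose c := complex.Re (K0 + K0 + `|be|).
have cE : K0 + K0 + `|be| = c%:C%C by rewrite /c RRe_real // ger0_real.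
clearbody c.
have c0' : 0 <= c by rewrite -lecR -cE.
have c1 : 0 < c + 1 by rewrite ltr_wpDl.
have d0' : 0 < cmod (al - be) by rewrite -ltcR -normc_cmod.
(* With this [t] the bound [c * 2 t] is less than half of [|al - be|], a contradiction. *)
pose t := cmod (al - be) / (4 * (c + 1)).
have t0 : 0 < t by rewrite divr_gt0 // mulr_gt0.
have [u [u1 une ut]] := small_rotation t0.
have := B u u1 une; rewrite cE normc_cmod => h.
have : (cmod (al - be))%:C%C <= (c * (2 * t))%:C%C.
  by rewrite (le_trans h) // rmorphM ler_wpM2l // lecR.
rewrite lecR /t; move: (cmod (al - be)) d0' => x x0.
have -> : c * (2 * (x / (4 * (c + 1)))) = x * (c / (2 * (c + 1))).
  by field; rewrite lt0r_neq0.
rewrite ler_pMr // ler_pdivlMr ?mulr_gt0 // mul1r; lra.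
Qed.

End Rotation.

End LeftInvariance.

Section LeftAdjoint.
Variables (R : realType) (M : nat) (P : probability (cmatrix R M) R).
Hypothesis hP : haar_unitary P.
Local Notation Om := (cmatrix R M).
Local Notation C := (R[i] : comNzRingType).
Local Notation A := (epoly C M).
Local Notation ev := (@epoly_eval C M).
Local Notation gram := (gram P).
Implicit Types (p q : A) (X Y : 'M[R[i]]_M).

Lemma gram_line_proj_l (h w w' : R[i]) a b p q :
  gram (left_deriv (line_proj h w w' a b) p) q =
  h * (gram (left_deriv (delta_mx a a) p) q + gram (left_deriv (delta_mx b b) p) q
   + (w' * gram (left_deriv (delta_mx a b) p) q + w * gram (left_deriv (delta_mx b a) p) q)).
Proof.
pose f a b (U : Om) : R[i] := ev U (left_deriv (delta_mx a b) p) * (ev U q)^*.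
have nf a' b' : nice (f a' b') by exact: nice_gram.
have pure (x y z t v : R[i]) : h * (x + y + (w' * z + w * t)) * v =
    h * (x * v + y * v + (w' * (z * v) + w * (t * v))) by ring.
transitivity (Ex P (fun U => h * (f a a U + f b b U + (w' * f a b U + w * f b a U)))).
  apply: eq_Ex => U _.
  exact: etrans (congr1 (fun x => x * (ev U q)^*) (line_proj_eval U h w w' a b p)) (pure _ _ _ _ _).
have n1 := niceD (nf a a) (nf b b); have n3 := niceZ w' (nf a b); have n4 := niceZ w (nf b a).
apply: etrans (ExZ P h (niceD n1 (niceD n3 n4))) _; congr (h * _).
apply: etrans (ExD P n1 (niceD n3 n4)) _; congr (_ + _); first exact: (ExD P (nf a a) (nf b b)).
apply: etrans (ExD P n3 n4) _.
by congr (_ + _); [exact: (ExZ P w' (nf a b))|exact: (ExZ P w (nf b a))].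
Qed.

Lemma gram_line_proj_r (h w w' : R[i]) a b p q :
  gram p (left_deriv (line_proj h w w' a b) q) =
  h^* * (gram p (left_deriv (delta_mx a a) q) + gram p (left_deriv (delta_mx b b) q)
   + (w'^* * gram p (left_deriv (delta_mx a b) q) + w^* * gram p (left_deriv (delta_mx b a) q))).
Proof.
pose f a b (U : Om) : R[i] := ev U p * (ev U (left_deriv (delta_mx a b) q))^*.
have nf a' b' : nice (f a' b') by exact: nice_gram.
have pure (x y z t v : R[i]) : v * (h * (x + y + (w' * z + w * t)))^* =
    h^* * (v * x^* + v * y^* + (w'^* * (v * z^*) + w^* * (v * t^*))).
  by rewrite !(rmorphM, rmorphD) /=; ring.
transitivity (Ex P (fun U => h^* * (f a a U + f b b U + (w'^* * f a b U + w^* * f b a U)))).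
  apply: eq_Ex => U _.
  exact: etrans (congr1 (fun x => ev U p * x^*) (line_proj_eval U h w w' a b q)) (pure _ _ _ _ _).
have n1 := niceD (nf a a) (nf b b); have n3 := niceZ w'^* (nf a b); have n4 := niceZ w^* (nf b a).
apply: etrans (ExZ P h^* (niceD n1 (niceD n3 n4))) _; congr (h^* * _).
apply: etrans (ExD P n1 (niceD n3 n4)) _; congr (_ + _); first exact: (ExD P (nf a a) (nf b b)).
apply: etrans (ExD P n3 n4) _.
by congr (_ + _); [exact: (ExZ P w'^* (nf a b))|exact: (ExZ P w^* (nf b a))].
Qed.

Lemma line_proj_adj (w : R[i]) (a b : 'I_M) :
  adjmx (line_proj (2^-1 : C) w w^* a b) = line_proj (2^-1 : C) w w^* a b.
Proof.
apply/matrixP => i j; rewrite !mxE !(rmorphD, rmorphM) /= !conjCK !rmorph_nat fmorphV rmorph_nat.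
rewrite [(j == a) && (i == a)]andbC [(j == b) && (i == b)]andbC.
rewrite [(j == a) && (i == b)]andbC [(j == b) && (i == a)]andbC.
by congr (_ * (_ + _)); rewrite addrC.
Qed.

(* Polarization over the projections on [e_a + w e_b], with [w = 1] and [w = 'i]. *)
Lemma gram_delta_adj a b p q :
  gram (left_deriv (delta_mx a b) p) q = gram p (left_deriv (delta_mx b a) q).
Proof.
have diag c : gram (left_deriv (delta_mx c c) p) q = gram p (left_deriv (delta_mx c c) q).
  apply: (gram_rot_deriv hP); first exact: mul_delta_mx.
  apply/matrixP => i j; rewrite !mxE conjC_nat; by rewrite andbC.
have [->|ab] := eqVneq a b; first exact: diag.
have E (w : R[i]) : `|w| = 1 ->
  w^* * gram (left_deriv (delta_mx a b) p) q + w * gram (left_deriv (delta_mx b a) p) q =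
  w * gram p (left_deriv (delta_mx a b) q) + w^* * gram p (left_deriv (delta_mx b a) q).
  move=> w1.
  have idem : line_proj (2^-1 : C) w w^* a b *m line_proj (2^-1 : C) w w^* a b =
              line_proj (2^-1 : C) w w^* a b.
    apply: line_proj_idem => //; last by rewrite -normCK w1 expr1n.
    have hh : (2^-1 : R[i]) + 2^-1 = 1 by rewrite -[LHS]mulr2n -[LHS]mulr_natr mulVf // pnatr_eq0.
    exact: hh.
  have pure (u v u' v' x y z t : R[i]) : u = u' -> v = v' ->
      2^-1 * (u + v + (w^* * x + w * y)) = 2^-1^* * (u' + v' + (w^*^* * z + w^* * t)) ->
      w^* * x + w * y = w * z + w^* * t.
    move=> -> ->; rewrite fmorphV rmorph_nat conjCK.
    have h0 : (2^-1 : R[i]) != 0 by rewrite invr_eq0 pnatr_eq0.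
    by move/(mulfI h0)/addrI.
  apply: (pure _ _ _ _ _ _ _ _ (diag a) (diag b)).
  exact: etrans (esym (gram_line_proj_l 2^-1 w w^* a b p q))
    (etrans (gram_rot_deriv hP idem (line_proj_adj w a b) p q)
            (gram_line_proj_r 2^-1 w w^* a b p q)).
(* The cases [w = 'i] and [w = 1] read [y - x = z - t] and [x + y = z + t], whence [2 x = 2 t]. *)
have pure (x y z t : R[i]) : 'i^* * x + 'i * y = 'i * z + 'i^* * t ->
    1^* * x + 1 * y = 1 * z + 1^* * t -> x = t.
  rewrite conjCi rmorph1 !mul1r => h1 h2; have i0 : ('i : R[i]) != 0 by exact: neq0Ci.
  have h3 : y - x = z - t by apply: (mulfI i0); rewrite !mulrBr addrC -mulNr h1 mulNr.
  have : x + x = t + t.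
    have -> : x + x = (x + y) - (y - x) by ring.
    by rewrite h2 h3; ring.
  by rewrite -[LHS]mulr2n -[RHS]mulr2n => /eqP; rewrite eqr_pMn2r // => /eqP.
exact: (pure _ _ _ _ (E 'i (normCi _)) (E 1 (normr1 _))).
Qed.

End LeftAdjoint.

Section GramPartial.
Variables (R : realType) (M : nat) (P : probability (cmatrix R M) R).
Hypothesis hP : haar_unitary P.
Local Notation Om := (cmatrix R M).
Local Notation C := (R[i] : comNzRingType).
Local Notation A := (epoly C M).
Local Notation W := (gen_mx C M).
Local Notation ev := (@epoly_eval C M).
Local Notation gram := (gram P).
Implicit Types (p q r : A).

Lemma gramDl p q r : gram (p + q) r = gram p r + gram q r.
Proof.
apply/esym; apply: etrans (esym (ExD P (nice_gram p r) (nice_gram q r))) _; apply: eq_Ex => U _.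
have pure (x y z : R[i]) : x * z + y * z = (x + y) * z by rewrite mulrDl.
exact: etrans (pure _ _ _) (congr1 (fun x => x * (ev U r)^*) (esym (epoly_evalD U p q))).
Qed.

Lemma gramDr p q r : gram p (q + r) = gram p q + gram p r.
Proof.
apply/esym; apply: etrans (esym (ExD P (nice_gram p q) (nice_gram p r))) _; apply: eq_Ex => U _.
have pure (x y z : R[i]) : x * y^* + x * z^* = x * (y + z)^* by rewrite rmorphD mulrDr.
exact: etrans (pure _ _ _) (congr1 (fun x => ev U p * x^*) (esym (epoly_evalD U q r))).
Qed.

Lemma gram0l r : gram 0 r = 0.
Proof. by apply: (addrI (gram 0 r)); rewrite -gramDl !addr0. Qed.
Lemma gram0r r : gram r 0 = 0.
Proof. by apply: (addrI (gram r 0)); rewrite -gramDr !addr0. Qed.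

Lemma gram_suml (I : finType) (F : I -> A) r : gram (\sum_i F i) r = \sum_i gram (F i) r.
Proof. exact: (big_morph (fun p => gram p r) (fun p q => gramDl p q r) (gram0l r)). Qed.
Lemma gram_sumr (I : finType) (F : I -> A) r : gram r (\sum_i F i) = \sum_i gram r (F i).
Proof. exact: (big_morph (gram r) (gramDr r) (gram0r r)). Qed.

Lemma gram11 : gram 1 1 = 1.
Proof.
rewrite -[RHS](Ex_cst hP (1 : R[i])); apply: eq_Ex => U _.
have pure (x : R[i]) : x = 1 -> x * x^* = 1 by move=> ->; rewrite rmorph1 mulr1.
exact: pure (epoly_eval1 U).
Qed.

(* Contracting with U^* U = 1 turns the left-invariant fields into partial derivatives. *)
Lemma gram_partial a i p q :
  gram (partial a i p) q =
  gram p (\sum_b (W a i * q + W b i * left_deriv (delta_mx b a) q)).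
Proof.
rewrite gram_sumr.
(* By Leibniz [d_ba (W_bi q) = W_ai q + W_bi d_ba q], so each summand is one derivation that can be
   moved to the left. *)
have E b : gram p (W a i * q + W b i * left_deriv (delta_mx b a) q) =
           gram (left_deriv (delta_mx a b) p) (W b i * q).
  rewrite (gram_delta_adj hP); congr (gram p _).
  by rewrite (left_deriv_derivation _).2 left_derivX map_epolyC_delta delta_mul_entry eqxx mul1r.
rewrite (eq_bigr _ (fun b _ => E b)).
apply/esym; apply: etrans (esym (Ex_sum hP (fun b => nice_gram (left_deriv (delta_mx a b) p) (W b i * q)))) _.
apply: eq_Ex => U uU.
have UU : adjmx U *m U = 1%:M by exact: unitary_adj.
have e b : ev U (left_deriv (delta_mx a b) p) = \sum_j U b j * ev U (partial a j p).
  rewrite left_deriv_delta epoly_eval_sum; apply: eq_bigr => j _.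
  by rewrite epoly_evalM epoly_evalX.
have pure (V : 'M[R[i]]_M) (y : 'I_M -> R[i]) (z : R[i]) : adjmx V *m V = 1%:M ->
    \sum_b (\sum_j V b j * y j) * (V b i * z)^* = y i * z^*.
  move=> VV; transitivity (\sum_j (adjmx V *m V) i j * (y j * z^*)).
    under eq_bigr do rewrite mulr_suml.
    rewrite exchange_big; apply: eq_bigr => j _ /=; rewrite mxE mulr_suml.
    apply: eq_bigr => b _; rewrite !mxE rmorphM /=; ring.
  rewrite VV (bigD1 i) //= big1 ?addr0 => [|j ji]; first by rewrite mxE eqxx mul1r.
  by rewrite mxE eq_sym (negbTE ji) mul0r.
apply: etrans _ (pure U (fun j => ev U (partial a j p)) (ev U q) UU).
apply: eq_bigr => b _; rewrite e; congr (_ * _^*).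
by rewrite epoly_evalM epoly_evalX.
Qed.

End GramPartial.

Section BlockGram.
Variables (R : realType) (N L : nat) (P : probability (cmatrix R (N + L)) R).
Hypothesis hP : haar_unitary P.
Local Notation C := (R[i] : comNzRingType).
Local Notation A := (epoly C (N + L)).
Local Notation W := (gen_mx C (N + L)).
Local Notation gram := (gram P).
Local Notation T := (gen_block C N L).
Implicit Types (p q r : A).

(** [gram_partial] summed over the diagonal of the block. Its first term does not depend on [b],
    which takes [N + L] values: hence the multiplier. *)
Lemma gram_block_transl p q :
  gram (block_transl p) q = gram p ((N + L)%:R * \tr T * q + block_sqr q).
Proof.
rewrite /block_transl gram_suml.
transitivity (gram p (\sum_(a < N) \sum_b (W (lshift L a) (lshift L a) * q +
    W b (lshift L a) * left_deriv (delta_mx b (lshift L a)) q))).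
  by rewrite gram_sumr; apply: eq_bigr => a _; rewrite mul1r; exact: gram_partial.
congr (gram p _).
transitivity (\sum_(a < N) \sum_(b < N + L) W (lshift L a) (lshift L a) * q + block_sqr q).
  rewrite /block_sqr -big_split; apply: eq_bigr => a _ /=.
  by rewrite -big_split.
congr (_ + _); rewrite /mxtrace mulr_sumr mulr_suml; apply: eq_bigr => a _.
by rewrite sumr_const card_ord -[LHS]mulr_natl [LHS]mulrA /gen_block [ulsubmx _ _ _]mxE [usubmx _ _ _]mxE.
Qed.

Lemma block_minor_gram k (f g : 'I_k -> 'I_(N + k)) :
  gram (shift_minor T (fun i => f i)) (shift_minor T (fun i => g i)) =
  (\prod_(i < k) fact_ratio R[i] L (N + i))^-1 *
  (\prod_i fact_ratio R[i] L (g i) * match_det R[i] (fun i => f i) (fun i => g i)).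
Proof.
apply: (@minor_gram R[i] A N L T (@block_left C N L) (@block_transl C N L) (@block_sqr C N L) gram).
- exact: block_left_derivation.
- exact: map_block_left.
- exact: block_transl_derivation.
- exact: map_block_transl.
- exact: block_sqr_derivation.
- exact: map_block_sqr.
- exact: gramDl.
- exact: gramDr.
- exact: gram11.
- by move=> a b p q; exact: gram_delta_adj.
- exact: gram_block_transl.
Qed.

End BlockGram.

(** * The moment of the characteristic polynomial *)

Section Moment.
Variables (R : realType) (N L : nat) (P : probability (cmatrix R (N + L)) R).
Hypothesis hP : haar_unitary P.
Local Notation C := (R[i] : comNzRingType).
Local Notation A := (epoly C (N + L)).
Local Notation gram := (gram P).
Local Notation T := (gen_block C N L).
Local Notation ev := (@epoly_eval C (N + L)).
Implicit Types (p q r : A).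

Lemma gramZl (c : R[i]) p q : gram (epolyC (N + L) (c : C) * p) q = c * gram p q.
Proof.
apply/esym; apply: etrans (esym (ExZ P c (nice_gram p q))) _; apply: eq_Ex => U _.
rewrite mulrA; congr (_ * _); apply/esym; apply: etrans (epoly_evalM U _ _) _.
by congr (_ * _); exact: epoly_evalC.
Qed.

Lemma gramZr (c : R[i]) p q : gram p (epolyC (N + L) (c : C) * q) = c^* * gram p q.
Proof.
apply/esym; apply: etrans (esym (ExZ P c^* (nice_gram p q))) _; apply: eq_Ex => U _.
rewrite mulrCA; congr (_ * _); apply/esym.
apply: etrans (congr1 Num.conj (epoly_evalM U _ _)) _.
rewrite rmorphM /=; congr (_ * _); congr (Num.conj _); exact: epoly_evalC.
Qed.

Section Point.
Variables (k : nat) (z : R[i]).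

Definition taylor_coef (f : {ffun 'I_k -> 'I_(N + k)}) : R[i] :=
  \prod_i taylor_mx k z (N + k) i (f i).

Definition char_pow : A :=
  \sum_(f : {ffun 'I_k -> 'I_(N + k)})
    epolyC (N + L) (taylor_coef f : C) * shift_minor T (fun i => f i).

Lemma map_gen_block (U : 'M[R[i]]_(N + L)) : map_mx (ev U) T = @ulsubmx _ N L N L U.
Proof.
apply/matrixP => i j; rewrite [LHS]mxE /gen_block [ulsubmx _ _ _ in LHS]mxE [usubmx _ _ _ in LHS]mxE.
by rewrite epoly_evalX !mxE.
Qed.

Lemma char_powE (U : 'M[R[i]]_(N + L)) :
  ev U char_pow = (char_poly (@ulsubmx _ N L N L U)).[z] ^+ k.
Proof.
rewrite char_poly_expn /char_pow epoly_eval_sum; apply: eq_bigr => f _.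
rewrite epoly_evalM epoly_evalC; congr (_ * _).
by apply: etrans (map_shift_minor _ T _) _; rewrite map_gen_block.
Qed.

Lemma gram_char_pow :
  gram char_pow char_pow =
  (\prod_(i < k) fact_ratio R[i] L (N + i))^-1 * \det (gram_mx L (N + k) k z^* z).
Proof.
have conjY f : (taylor_coef f)^* = \prod_i taylor_mx k z^* (N + k) i (f i).
  rewrite /taylor_coef rmorph_prod; apply: eq_bigr => i _.
  by rewrite -(map_taylor_mx Num.conj) [RHS]mxE.
rewrite /char_pow gram_suml.
transitivity (\sum_(f : {ffun 'I_k -> 'I_(N + k)}) \sum_(g : {ffun 'I_k -> 'I_(N + k)})
   taylor_coef f * ((taylor_coef g)^* *
     gram (shift_minor T (fun i => f i)) (shift_minor T (fun i => g i)))).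
  apply: eq_bigr => f _; rewrite gramZl -mulr_sumr; congr (_ * _).
  by rewrite gram_sumr; apply: eq_bigr => g _; exact: gramZr.
have -> : gram_mx L (N + k) k z^* z = \matrix_(l < k, i < k) \sum_(s < N + k)
   fact_ratio R[i] L s * taylor_mx k z^* (N + k) l s * taylor_mx k z (N + k) i s.
  by apply/matrixP => l i; rewrite !mxE.
rewrite -(sum_match_det (taylor_mx k z (N + k)) (taylor_mx k z^* (N + k)) (fun s : 'I_(N + k) => fact_ratio R[i] L s)).
rewrite mulr_sumr; apply: eq_bigr => f _; rewrite mulr_sumr; apply: eq_bigr => g _.
apply: etrans (congr1 (fun x => _ * (_ * x)) (block_minor_gram hP f g)) _.
rewrite conjY /taylor_coef; move: (match_det _ _ _) (\prod_i _) (\prod_i _) (\prod_i _) (_^-1) => a b c d e.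
by ring.
Qed.

(** By [det_gram_mx] only the product of [z] and its conjugate enters, so the complex determinant is
    the image of a real one. *)
Lemma gram_char_pow_real :
  gram char_pow char_pow =
  ((\prod_(i < k) fact_ratio R L (N + i))^-1 * (\prod_(i < k) fact_ratio R L i *
     (hankel_det L N k (1 - cmod z ^+ 2) / hankel_det L N k 1)))%:C%C.
Proof.
have zz : z^* * z = (cmod z ^+ 2)%:C%C by rewrite mulrC -normCK normc_cmod rmorphXn.
rewrite gram_char_pow det_gram_mx zz -det_gram_ratio.
apply/esym; apply: etrans (rmorphM _ _ _) _; congr (_ * _).
  rewrite fmorphV rmorph_prod; congr (_^-1).
  by apply: eq_bigr => i _; exact: (map_fact_ratio (real_complex R)).
by rewrite -(det_map_mx (real_complex R)) (map_gram_mx (real_complex R)) (rmorph1 (real_complex R)).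
Qed.

Lemma cmod_charE (U : 'M[R[i]]_(N + L)) :
  cmod (\det (@ulsubmx _ N L N L U - z%:M)) ^+ (2 * k) =
  complex.Re (ev U char_pow * (ev U char_pow)^*).
Proof.
set B := ulsubmx U.
have -> : ev U char_pow * (ev U char_pow)^* = (cmod (\det (B - z%:M)) ^+ (2 * k))%:C%C; last by [].
rewrite -normCK char_powE normrX -exprM mulnC.
apply: etrans _ (esym (rmorphXn (real_complex R) _ _)); congr (_ ^+ _).
rewrite /= -normc_cmod.
rewrite /char_poly -[_.[z]]/(horner_eval z _) -det_map_mx.
have -> : map_mx (horner_eval z) (char_poly_mx B) = - (B - z%:M).
  apply/matrixP => i j; rewrite !mxE /horner_eval hornerD hornerN hornerC opprB.
  by congr (_ - _); case: (i == j); rewrite ?mulr1n ?mulr0n ?hornerX ?horner0.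
by rewrite -scaleN1r detZ normrM normrX normrN1 expr1n mul1r.
Qed.

(** The integrand is nonnegative and the non-unitary matrices form a null set, so the integral
    reduces to the set over which [Ex] is taken. *)
Lemma integral_char_pow :
  (\int[P]_(U in [set: cmatrix R (N + L)])
     ((cmod (\det (@ulsubmx _ N L N L (U : 'M[R[i]]_(N + L)) - z%:M))) ^+ (2 * k))%:E)%E =
  (complex.Re (gram char_pow char_pow))%:E.
Proof.
pose h (U : cmatrix R (N + L)) : R := complex.Re (ev U char_pow * (ev U char_pow)^*).
have nF := nice_gram char_pow char_pow.
have [ih _] := nice_integrable P nF.
have mD := @measurable_unit_set R (N + L).
transitivity (\int[P]_(U in [set: cmatrix R (N + L)]) (h U)%:E)%E.
  by apply: eq_integral => U _; rewrite cmod_charE.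
rewrite (@ge0_negligible_integral _ _ _ P setT (~` (@unit_set R (N + L)))) //.
- rewrite setTD setCK -[LHS]fineK; first by [].
  exact: (integrable_fin_num mD ih).
- exact: measurableC.
- by apply/measurable_EFinP; exact: nF.1.1.
- by move=> U _; rewrite lee_fin /h -cmod_charE exprn_ge0 // sqrtr_ge0.
apply: etrans (probability_setC P mD) _.
by apply: etrans (congr1 (fun x => 1 - x)%E (P_unit_set hP)) _; rewrite subee.
Qed.

End Point.
End Moment.

(** * The Jacobi ensemble *)

Section IteratedIntegral.
Variable R : realType.
Local Notation mu := (@lebesgue_measure R).
Local Notation I := `[0%R, 1%R].
Local Notation integrable01 g := (mu.-integrable I (EFin \o g)).
Local Notation int01 g := (Rintegral mu I g).

Lemma eq_iter_int01 k (F G : seq R -> R) :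
  (forall t, size t = k -> F t = G t) -> iter_int01 k F = iter_int01 k G.
Proof.
elim: k F G => [|k IH] F G FG /=; first exact: FG.
by apply: eq_Rintegral => x _; apply: IH => t tk; apply: FG; rewrite /= tk.
Qed.

Lemma Rintegral_lincomb (A : Type) (r : seq A) (c : A -> R) (G : A -> R -> R) :
  (forall a, integrable01 (G a)) ->
  int01 (fun x => \sum_(a <- r) c a * G a x) = \sum_(a <- r) c a * int01 (G a).
Proof.
move=> iG; have mI : measurable (I : set (measurableTypeR R)) by exact: measurable_itv.
have iZ a : integrable01 (fun x => c a * G a x).
  exact: integrableZl mI (c a) _ (iG a).
elim: r => [|a r IH].
  under eq_Rintegral do rewrite big_nil.
  by rewrite Rintegral_cst // big_nil mul0r.
under eq_Rintegral do rewrite big_cons.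
rewrite RintegralD //; first by rewrite IH big_cons RintegralZl.
apply: (eq_integrable mI) (integrable_sum mI r (P := xpredT) (fun a _ => iZ a)) => //.
by move=> x _ /=; rewrite sumEFin.
Qed.

(** A finite sum of products can be integrated one variable at a time, so no Fubini theorem
    intervenes. *)
Lemma iter_int01_lincomb (A : finType) k (c : A -> R) (G : A -> 'I_k -> R -> R) :
  (forall a i, integrable01 (G a i)) ->
  iter_int01 k (fun t => \sum_a c a * \prod_(i < k) G a i t`_i) =
  \sum_a c a * \prod_(i < k) int01 (G a i).
Proof.
elim: k c G => [|k IH] c G iG /=.
  by apply: eq_bigr => a _; rewrite !big_ord0.
transitivity (int01 (fun x =>
    \sum_a (c a * \prod_(i < k) int01 (G a (lift ord0 i))) * G a ord0 x)).
  apply: eq_Rintegral => x _.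
  rewrite (@eq_iter_int01 _ _ (fun s => \sum_a (c a * G a ord0 x) *
      \prod_(i < k) G a (lift ord0 i) s`_i)); last first.
    by move=> t _; apply: eq_bigr => a _; rewrite big_ord_recl mulrA.
  rewrite (IH (fun a => c a * G a ord0 x) (fun a i => G a (lift ord0 i))) //.
  by apply: eq_bigr => a _; rewrite mulrAC.
rewrite Rintegral_lincomb //; apply: eq_bigr => a _.
by rewrite big_ord_recl -mulrA [X in _ * X]mulrC.
Qed.

Lemma sum_perm_prod k (H : 'I_k -> 'I_k -> R) :
  \sum_(st : 'S_k * 'S_k) ((-1) ^+ st.1 * (-1) ^+ st.2) * \prod_i H (st.1 i) (st.2 i) =
  k`!%:R * \det (\matrix_(i, j) H i j).
Proof.
rewrite -(pair_bigA _ (fun s t : 'S_k => (-1) ^+ s * (-1) ^+ t * \prod_i H (s i) (t i))) /=.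
transitivity (\sum_(s : 'S_k) \det (\matrix_(i, j) H i j)); last first.
  by rewrite sumr_const mulr_natl -(card_Sn k); congr (_ *+ _); exact: eq_card.
apply: eq_bigr => s _; set B := \matrix_(i, j) _.
transitivity ((-1) ^+ s * \det (row_perm s B)).
  rewrite /determinant mulr_sumr; apply: eq_bigr => t _; rewrite -mulrA; congr (_ * (_ * _)).
  by apply: eq_bigr => i _; rewrite !mxE.
by rewrite row_permE det_mulmx det_perm mulrA -expr2 sqrr_sign mul1r.
Qed.

(** The squared Vandermonde determinant is expanded over two permutations; each term integrates to a
    product of moments, and the sum is [k!] equal determinants. *)
Lemma iter_int01_andreief k (g : R -> R) :
  (forall n, integrable01 (fun x => x ^+ n * g x)) ->
  iter_int01 k (fun t => \prod_(x <- t) g x *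
     \prod_(i < size t) \prod_(j < size t | (i < j)%N) (t`_j - t`_i) ^+ 2) =
  k`!%:R * \det (\matrix_(i < k, j < k) int01 (fun x => x ^+ (i + j) * g x)).
Proof.
move=> ig; rewrite -(sum_perm_prod (fun i j : 'I_k => int01 (fun x => x ^+ (i + j) * g x))).
rewrite -(iter_int01_lincomb (fun st : 'S_k * 'S_k => (-1) ^+ st.1 * (-1) ^+ st.2)
  (G := fun st i x => x ^+ (st.1 i + st.2 i) * g x)) //.
apply: eq_iter_int01 => t tk; rewrite (big_nth 0) big_mkord tk.
pose a : 'rV[R]_k := \row_i t`_i.
transitivity (\prod_(i < k) g t`_i * \det (matrix.Vandermonde k a)^T ^+ 2).
  rewrite det_tr det_Vandermonde -prodrXl; congr (_ * _); apply: eq_bigr => i _.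
  by rewrite -prodrXl; apply: eq_bigr => j _; rewrite !mxE.
have -> : \det (matrix.Vandermonde k a)^T = \sum_(s : 'S_k) (-1) ^+ s * \prod_(i < k) t`_i ^+ (s i).
  by apply: eq_bigr => s _; congr (_ * _); apply: eq_bigr => i _; rewrite !mxE.
rewrite expr2 big_distrlr /= pair_bigA /= mulr_sumr; apply: eq_bigr => -[s u] _ /=.
under [in RHS]eq_bigr do rewrite exprD.
by rewrite !big_split /= mulrC mulrACA -!mulrA.
Qed.

Lemma Rintegral_horner (p : {poly R}) (s : R) : 0 < s ->
  mu.-integrable `[0, s] (EFin \o horner p) /\
  Rintegral mu `[0, s] (horner p) = s * poly_int01 (p \Po (s *: 'X)).
Proof.
move=> s0; have cp (A : set R) : {within A, continuous (horner p : R -> R)}.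
  by apply: continuous_subspaceT => x; exact: continuous_horner.
split; first by apply: continuous_compact_integrable => //; exact: segment_compact.
(* A primitive of [p]. Its constant term is a division by zero, hence zero. *)
pose q : {poly R} := \poly_(i < (size p).+1) (p`_i.-1 / i%:R).
have dq : deriv q = p.
  apply/polyP => i; rewrite coef_deriv coef_poly ltnS; case: ltnP => h /=.
    by rewrite -[LHS]mulr_natr divfK // pnatr_eq0.
  by rewrite mul0rn nth_default.
rewrite /Rintegral (@continuous_FTC2 _ _ (horner q)) //.
- have := poly_int01_deriv (q \Po (s *: 'X)).
  rewrite deriv_comp dq derivZ derivX !horner_comp -scalerAr mulr1 poly_int01Z => ->.
  by rewrite !hornerE.
- split=> [x _| |].
  + exact: derivable_horner.
  + by apply: cvg_at_right_filter; exact: continuous_horner.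
  + by apply: cvg_at_left_filter; exact: continuous_horner.
- by move=> x _; rewrite -derivE dq.
Qed.

Lemma Rintegral_lt_horner (p : {poly R}) (s : R) : 0 < s <= 1 ->
  let f x := (if x < s then 1 else 0) * p.[x] in
  integrable01 f /\ int01 f = s * poly_int01 (p \Po (s *: 'X)).
Proof.
move=> /andP[s0 s1] f; have [ip intp] := Rintegral_horner p s0.
have fE : f = horner p \_ `]-oo, s[.
  by apply/funext => x; rewrite /f patchE mem_setE in_itv /=; case: ifP; rewrite ?mul1r ?mul0r.
have setE : `[0%R, 1%R] `&` `]-oo, s[ = `[0%R, s[ :> set R.
  apply/seteqP; split => x /=; rewrite !in_itv /=.
    by case=> /andP[-> _] ->.
  by move=> /andP[x0 xs]; rewrite x0 xs (le_trans (ltW xs)).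
have ips : mu.-integrable `[0, s[ (EFin \o horner p).
  by apply: integrableS ip => //; apply: subset_itvl; rewrite bnd_simp.
rewrite fE; split.
  have := integrable_restrict mu (measurable_itv `]-oo, s[%R) (measurable_itv `[0%R, 1%R]%R) (EFin \o horner p).
  by rewrite setE -restrict_EFin => -[h _]; exact: h.
by rewrite -Rintegral_mkcondr setE Rintegral_itv_bndo_bndc.
Qed.

Lemma det_scale_hankel k (c s : R) (h : 'I_k -> 'I_k -> R) :
  \det (\matrix_(i < k, j < k) (c * s ^+ (i + j) * h i j)) =
  c ^+ k * s ^+ (k * k.-1) * \det (\matrix_(i < k, j < k) h i j).
Proof.
pose D := \row_(i < k) s ^+ i.
have -> : \matrix_(i < k, j < k) (c * s ^+ (i + j) * h i j) =
   c *: (diag_mx D *m (\matrix_(i < k, j < k) h i j) *m diag_mx D).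
  rewrite mul_diag_mx mul_mx_diag; apply/matrixP => i j; rewrite !mxE exprD; ring.
rewrite detZ !det_mulmx !det_diag.
have -> : \prod_i D 0 i = s ^+ 'C(k, 2).
  under eq_bigr do rewrite mxE.
  by rewrite -bin2_sum big_mkord expr_sum.
have -> : (k * k.-1 = 'C(k, 2) + 'C(k, 2))%N by rewrite addnn -mul2n -mul_bin_diag bin1.
by rewrite exprD -!mulrA [\det _ * _]mulrC.
Qed.

(** [phi] is the indicator of [x < s], or 1 with [s = 1], which covers numerator and denominator of
    the distribution function. Rescaling to [[0, 1]] gives each entry a factor [s^(L+1+i+j)], and
    the determinant [s^(k (L + 1) + k (k - 1)) = s^(k L + k^2)]. *)
Lemma iter_int01_jue k L N (phi : R -> R) (s : R) :
  (forall p : {poly R}, integrable01 (fun x => phi x * p.[x]) /\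
     int01 (fun x => phi x * p.[x]) = s * poly_int01 (p \Po (s *: 'X))) ->
  iter_int01 k (fun t => \prod_(x <- t) phi x * jue_weight L N t) =
  k`!%:R * (s ^+ (k * L + k ^ 2) * hankel_det L N k s).
Proof.
move=> phiP; pose p : {poly R} := 'X^L * (1 - 'X) ^+ N.
pose g x := phi x * (x ^+ L * (1 - x) ^+ N).
have gE n : (fun x => x ^+ n * g x) = (fun x => phi x * ('X^n * p).[x]).
  by apply/funext => x; rewrite /g /p !(hornerM, hornerXn, horner_exp, hornerD, hornerN, hornerC, hornerX) mulrCA.
rewrite (@eq_iter_int01 _ _ (fun t => \prod_(x <- t) g x *
     \prod_(i < size t) \prod_(j < size t | (i < j)%N) (t`_j - t`_i) ^+ 2)); last first.
  by move=> t _; rewrite /jue_weight mulrA /g [in RHS]big_split.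
rewrite iter_int01_andreief => [|n]; last by rewrite gE; case: (phiP ('X^n * p)).
congr (_ * _).
have -> : \matrix_(i < k, j < k) int01 (fun x => x ^+ (i + j) * g x) =
          \matrix_(i < k, j < k) (s ^+ L.+1 * s ^+ (i + j) * beta_trunc (L + i + j) N s).
  apply/matrixP => i j; rewrite !mxE gE.
  have [_ ->] := phiP ('X^(i + j) * p).
  rewrite exprS -[X in _ = X * _]mulrA -exprD -mulrA /beta_trunc; congr (_ * _).
  rewrite -poly_int01Z; congr poly_int01.
  rewrite /p !comp_polyM !(rmorphXn (comp_poly _)) rmorphB rmorph1 /= !comp_polyX.
  by rewrite !exprZn -!mul_polyC !exprD !polyCM; ring.
rewrite (det_scale_hankel _ _ (fun i j => beta_trunc (L + i + j) N s)) -exprM -exprD; congr (_ ^+ _ * _).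
by case: k => [|k] /=; rewrite ?muln0 ?mul0n // expnS expn1; nia.
Qed.

Lemma jue_lmax_cdfE k L N (s : R) : 0 < s <= 1 ->
  jue_lmax_cdf k L N s = s ^+ (k * L + k ^ 2) * (hankel_det L N k s / hankel_det L N k 1).
Proof.
move=> s01; rewrite /jue_lmax_cdf.
rewrite (@eq_iter_int01 _ _ (fun t => \prod_(x <- t) (if x < s then 1 else 0) * jue_weight L N t)); last first.
  move=> t _; congr (_ * _).
  by elim: t => [|x t IH] /=; rewrite ?big_nil // big_cons -IH; case: (x < s); rewrite ?mul1r ?mul0r.
rewrite (@iter_int01_jue _ _ _ _ s) => [|p]; last exact: Rintegral_lt_horner.
rewrite (@eq_iter_int01 _ (jue_weight L N) (fun t => \prod_(x <- t) 1 * jue_weight L N t)); last first.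
  by move=> t _; rewrite big1_eq mul1r.
rewrite (@iter_int01_jue _ _ _ (fun=> 1) 1) => [|p]; last first.
  have [ip intp] := Rintegral_horner p (@ltr01 R).
  by rewrite (_ : (fun x => 1 * p.[x]) = horner p) //; apply/funext => x; rewrite mul1r.
have kn0 : k`!%:R != 0 :> R by rewrite pnatr_eq0 -lt0n fact_gt0.
have hn0 := @hankel_det1_neq0 R L N k.
by rewrite expr1n mul1r; field; rewrite kn0 hn0.
Qed.

End IteratedIntegral.

Unset Implicit Arguments.

(** In terms of the Hankel ratio, which is 1 at [z = 0], both claims of the theorem are instances of
    one formula. *)
Lemma integral_det_sub_scalar (R : realType) (N L : nat)
  (P : probability (cmatrix R (N + L)) R) (hP : haar_unitary P) (k : nat) (z : R[i]) :
  (\int[P]_(U in [set: cmatrix R (N + L)])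
      ((cmod (\det (ulsubmx (U : 'M[R[i]]_(N + L)) - z%:M))) ^+ (2 * k))%:E
   = (\prod_(j < k) (((L + j)`!)%:R * ((N + j)`!)%:R / (((N + L + j)`!)%:R * (j`!)%:R))
      * (hankel_det L N k (1 - cmod z ^+ 2) / hankel_det L N k 1))%:E)%E.
Proof.
rewrite (integral_char_pow hP k z) (gram_char_pow_real hP k z) [complex.Re _]/=.
congr EFin; rewrite [LHS]mulrA -prodfV -big_split /=.
congr (_ * _); apply: eq_bigr => i _; rewrite /fact_ratio /= invf_div.
rewrite [(L + (N + i))%N]addnCA addnA mulf_div; congr (_ / _).
exact: mulrC.
Qed.

(* M = N + L with L >= 1 (i.e. M > N); T = upper-left N x N block of U. *)
Theorem theorem1p7 (R : realType) (N L : nat) (hL : (0 < L)%N)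
  (P : probability (cmatrix R (N + L)) R) (hP : haar_unitary P)
  (k : nat) (z : R[i]) (hz : cmod z < 1) :
  let M := (N + L)%N in
  let C := \prod_(j < k)
             (((L + j)`!)%:R * ((N + j)`!)%:R / (((M + j)`!)%:R * (j`!)%:R)) : R in
  (\int[P]_(U in [set: cmatrix R M])
      ((cmod (\det (ulsubmx (U : 'M[R[i]]_(N + L)) - z%:M))) ^+ (2 * k))%:E
    = (C / (1 - cmod z ^+ 2) ^+ (k * L + k ^ 2)
         * jue_lmax_cdf k L N (1 - cmod z ^+ 2))%:E)%E
  /\
  (\int[P]_(U in [set: cmatrix R M])
      ((cmod (\det (ulsubmx (U : 'M[R[i]]_(N + L))))) ^+ (2 * k))%:E
    = C%:E)%E.
Proof.
move=> M C; split.
  have z0 : 0 <= cmod z by exact: sqrtr_ge0.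
  have s01 : 0 < 1 - cmod z ^+ 2 <= 1.
    by rewrite subr_gt0 expr_lt1 // hz gerBl sqr_ge0.
  (* The power of [1 - |z|^2] in the distribution function cancels the denominator, which is nonzero
     as [|z| < 1]. *)
  rewrite integral_det_sub_scalar // jue_lmax_cdfE // [in RHS]mulrA divfK //.
  by rewrite expf_neq0 // gt_eqF //; case/andP: s01.
have := @integral_det_sub_scalar R N L P hP k 0.
have -> : cmod (0 : R[i]) = 0 by rewrite /cmod /= !expr0n addr0 sqrtr0.
rewrite expr0n subr0 divff ?hankel_det1_neq0 // mulr1 => <-.
by apply: eq_integral => U _; rewrite raddf0 subr0.
Qed.
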